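(* $1141\leqslant\dim_{\mathbb F_2}(QP_5)_{63}\leqslant 1155$.
   Context: $P_5=\mathbb F_2[x_1,\ldots,x_5]$ is the graded polynomial algebra with each $x_i$ of degree $1$, regarded as a module over the mod-2 Steenrod algebra $\mathcal A$ in the usual way (it is $H^*(B(\mathbb Z/2)^5;\mathbb F_2)$; the action is determined by $Sq^0=\mathrm{id}$, $Sq^1x_i=x_i^2$, $Sq^jx_i=0$ for $j>1$, and the Cartan formula). $\mathcal A^+$ is the augmentation ideal of $\mathcal A$, $QP_5=P_5/\mathcal A^+P_5$, and $(QP_5)_n$ is its degree $n$ part. *)

(* Defs.v *)
From HB Require Import structures.
From Stdlib Require Import ClassicalEpsilon.
From mathcomp Require Import all_boot all_order all_algebra ring_quotient.
From mathcomp Require Import mpoly.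

Set Implicit Arguments.
Unset Strict Implicit.
Unset Printing Implicit Defensive.

Import GRing.Theory Quotient.

Local Open Scope ring_scope.
Local Open Scope quotient_scope.

Local Notation P n := {mpoly 'F_2[n]}.

(** Steenrod squares. The generating function [sum_k Sq^k(f) t^k] is, by the
    Cartan formula, the ring morphism [P n -> P n[t]] sending [x_i] to
    [x_i + x_i^2 t]. *)

Section Squares.

Variable n : nat.
Implicit Types (f g : P n) (i : 'I_n) (k : nat).

Definition Sq_gen f : {poly P n} :=
  mmap (fun c : 'F_2 => (c%:MP_[n])%:P)
       (fun i => ('X_i : P n)%:P + (('X_i : P n) ^+ 2)%:P * 'X) f.

Definition Sq k f : P n := (Sq_gen f)`_k.

Let cP : {rmorphism 'F_2 -> {poly P n}} := (@polyC (P n)) \o (@mpolyC n 'F_2).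

Let Sq_genE f : Sq_gen f =
  mmap cP (fun i => ('X_i : P n)%:P + (('X_i : P n) ^+ 2)%:P * 'X) f.
Proof. by []. Qed.

Lemma Sq_is_linear k : linear (Sq k).
Proof.
move=> c f g; rewrite /Sq !Sq_genE mmapD mmapZ coefD /=.
by rewrite coefCM mul_mpolyC.
Qed.

HB.instance Definition _ k :=
  GRing.isLinear.Build 'F_2 (P n) (P n) _ (Sq k) (@Sq_is_linear k).

Lemma Sq_cartan k f g : Sq k (f * g) = \sum_(j < k.+1) Sq j f * Sq (k - j) g.
Proof. by rewrite /Sq !Sq_genE rmorphM /= coefM. Qed.

Lemma Sq_X k i :
  Sq k 'X_i = if k == 0%N then 'X_i else if k == 1%N then 'X_i ^+ 2 else 0.
Proof.
rewrite /Sq Sq_genE mmapX mmap1U coefD coefC coefCM coefX.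
by case: k => [|[|k]] /=; rewrite ?mulr0 ?mulr1 ?addr0 ?add0r.
Qed.

Lemma Sq_1 k : Sq k 1 = (k == 0%N)%:R.
Proof. by rewrite /Sq Sq_genE rmorph1 coef1. Qed.

Lemma Sq_unique (S : nat -> P n -> P n) :
  (forall k, linear (S k)) ->
  (forall f, S 0%N f = f) ->
  (forall i, S 1%N 'X_i = 'X_i ^+ 2) ->
  (forall k i, (1 < k)%N -> S k 'X_i = 0) ->
  (forall k f g, S k (f * g) = \sum_(j < k.+1) S j f * S (k - j)%N g) ->
  forall k f, S k f = Sq k f.
Proof.
move=> Slin S0 S1X SX Scartan.
have SXE k i : S k 'X_i = Sq k 'X_i.
  by rewrite Sq_X; case: k => [|[|k]] //=; rewrite SX.
have S1 k : S k 1 = Sq k 1.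
  rewrite Sq_1; elim/ltn_ind: k => -[|k] IHk; first by rewrite S0.
  have := Scartan k.+1 1 1; rewrite mul1r big_ord_recr big_ord_recl /=.
  rewrite S0 subn0 subnn S0 mul1r mulr1 big1 ?addr0; last first.
    by move=> [j ltjk] _ /=; rewrite /bump /= add1n IHk // mul0r.
  by move/eqP; rewrite -subr_eq subrr => /eqP <-.
have SM k m : S k 'X_[m] = Sq k 'X_[m].
  rewrite mpolyXE_id; elim/big_ind: _ k => [k|f g IHf IHg k|i _ k] //.
    by rewrite Scartan Sq_cartan; apply: eq_bigr => j _; rewrite IHf IHg.
  elim: (m i) k => [|e IHe] k; first by rewrite expr0.
  by rewrite exprS Scartan Sq_cartan; apply: eq_bigr => j _; rewrite SXE IHe.
have S_0 k : S k 0 = 0.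
  have := Slin k 1 0 0; rewrite !scale1r addr0 => /eqP.
  by rewrite -subr_eq subrr => /eqP <-.
move=> k; elim/mpolyind => [|c m f _ _ IHf]; first by rewrite S_0 linear0.
by rewrite Slin linearP IHf SM.
Qed.

Lemma Sq_0 f : Sq 0%N f = f.
Proof.
elim/mpolyind: f => [|c m f _ _ IHf]; first by rewrite linear0.
rewrite linearP /= IHf; congr (_ *: _ + _).
rewrite mpolyXE_id; elim/big_ind: _ => [|f' g' IHf' IHg'|i _].
- by rewrite Sq_1.
- by rewrite Sq_cartan big_ord1 /= IHf' IHg'.
elim: (m i) => [|e IHe]; first by rewrite expr0 Sq_1.
by rewrite exprS Sq_cartan big_ord1 /= IHe Sq_X.
Qed.

(** [Sq_word [:: i_1; ...; i_r] f = Sq^{i_1} (... (Sq^{i_r} f))]. *)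
Definition Sq_word (w : seq nat) f : P n := foldr Sq f w.

(** The submodule [A^+ P_n]: as [A] is generated by the squares, [A^+] is
    spanned by the words [Sq^{i_1} ... Sq^{i_r}] of positive degree. *)
Definition hit f : Prop :=
  exists2 s : seq (seq nat * P n),
    {in s, forall p, (0 < sumn p.1)%N} & f = \sum_(p <- s) Sq_word p.1 p.2.

Definition hit_pred : {pred P n} :=
  fun f => if excluded_middle_informative (hit f) then true else false.

Lemma hit_predP f : reflect (hit f) (f \in hit_pred).
Proof.
by rewrite unfold_in /hit_pred; case: excluded_middle_informative => h;
  constructor.
Qed.

Lemma Sq_word_is_linear w : linear (Sq_word w).
Proof.
by elim: w => [|k w IHw] c f g //=; rewrite IHw linearP.
Qed.

HB.instance Definition _ w :=
  GRing.isLinear.Build 'F_2 (P n) (P n) _ (Sq_word w) (@Sq_word_is_linear w).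

Lemma hit_submod_closed : submod_closed hit_pred.
Proof.
split=> [|c f g /hit_predP[s sP ->] /hit_predP[t tP ->]]; apply/hit_predP.
  by exists [::] => //; rewrite big_nil.
exists ([seq (p.1, c *: p.2) | p <- s] ++ t).
  by move=> p; rewrite mem_cat => /orP[/mapP[q /sP qP ->]|/tP].
rewrite big_cat big_map /= scaler_sumr.
by congr (_ + _); apply: eq_bigr => p _; rewrite linearZ.
Qed.

HB.instance Definition _ :=
  GRing.isSubmodClosed.Build 'F_2 (P n) hit_pred hit_submod_closed.

(** [QP = P_n / A^+ P_n] as a vector space over [F_2]. *)
Definition QP : Type := {quot hit_pred}.

HB.instance Definition _ := GRing.Zmodule.on QP.

Definition QP_proj f : QP := \pi_{quot hit_pred} f.

Definition QP_scale (c : 'F_2) (q : QP) : QP :=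
  QP_proj (c *: repr (q : {quot hit_pred})).

Lemma QP_projP f g : QP_proj f = QP_proj g <-> hit (f - g).
Proof.
split=> [/eqP|/hit_predP]; rewrite /QP_proj.
  by rewrite -idealrBE => /hit_predP.
by rewrite idealrBE => /eqP.
Qed.

Lemma QP_projZ c f : QP_scale c (QP_proj f) = QP_proj (c *: f).
Proof.
apply/QP_projP; rewrite -scalerBr; apply/hit_predP/rpredZ.
by rewrite idealrBE reprK.
Qed.

Lemma QP_projD f g : QP_proj (f + g) = QP_proj f + QP_proj g.
Proof. by rewrite /QP_proj !piE. Qed.

Lemma QP_proj_surj (q : QP) : exists f, q = QP_proj f.
Proof. by exists (repr (q : {quot hit_pred})); rewrite /QP_proj reprK. Qed.

Fact QP_scaleA a b (q : QP) : QP_scale a (QP_scale b q) = QP_scale (a * b) q.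
Proof. by have [f ->] := QP_proj_surj q; rewrite !QP_projZ scalerA. Qed.

Fact QP_scale1 : left_id 1 QP_scale.
Proof. by move=> q; have [f ->] := QP_proj_surj q; rewrite QP_projZ scale1r. Qed.

Fact QP_scaleDr : right_distributive QP_scale +%R.
Proof.
move=> c q r; have [f ->] := QP_proj_surj q; have [g ->] := QP_proj_surj r.
by rewrite -QP_projD !QP_projZ scalerDr QP_projD.
Qed.

Fact QP_scaleDl (q : QP) : {morph QP_scale^~ q : a b / a + b}.
Proof.
move=> a b; have [f ->] := QP_proj_surj q.
by rewrite !QP_projZ scalerDl QP_projD.
Qed.

HB.instance Definition _ := GRing.Zmodule_isLmodule.Build 'F_2 QP
  QP_scaleA QP_scale1 QP_scaleDr QP_scaleDl.

Lemma QP_proj_is_linear : linear QP_proj.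
Proof. by move=> c f g; rewrite QP_projD -QP_projZ. Qed.

HB.instance Definition _ :=
  GRing.isLinear.Build 'F_2 (P n) QP _ QP_proj QP_proj_is_linear.

(** The degree [d] part of [QP]. *)
Definition QP_deg (d : nat) (q : QP) : Prop :=
  exists2 f : P n, f \is d.-homog & q = QP_proj f.

Lemma QP_deg0 d : QP_deg d 0.
Proof. by exists 0; rewrite ?linear0 // rpred0. Qed.

Lemma QP_deg_linear d c q r : QP_deg d q -> QP_deg d r -> QP_deg d (c *: q + r).
Proof.
by move=> [f fd ->] [g gd ->]; exists (c *: f + g);
  rewrite ?linearP // rpredD // rpredZ.
Qed.

End Squares.

(** The dimension of a linear subspace [S] of [V], as a relation: the subspaces
    of interest do not come with a [vectType] structure. *)
Definition has_dim (K : fieldType) (V : lmodType K) (S : V -> Prop) (d : nat) :=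
  exists b : 'I_d -> V,
    [/\ forall i, S (b i),
        forall c : 'I_d -> K, \sum_i c i *: b i = 0 -> forall i, c i = 0
      & forall v, S v -> exists c : 'I_d -> K, v = \sum_i c i *: b i].

Lemma has_dim_leq (K : fieldType) (V : lmodType K) (S : V -> Prop) d e :
  has_dim S d -> has_dim S e -> (d <= e)%N.
Proof.
move=> [b [Sb b_free _]] [b' [_ _ b'_gen]]; rewrite leqNgt; apply/negP => ltde.
have /fin_all_exists[A bE] i : exists c, b i = \sum_j c j *: b' j.
  exact: b'_gen.
pose M := \matrix_(i < d, j < e) A i j.
have: kermx M != 0.
  by rewrite -mxrank_eq0 mxrank_ker subn_eq0 -ltnNge (leq_ltn_trans (rank_leq_col M)).
case/rowV0Pn => u /sub_kermxP uM /negP[]; apply/eqP/rowP => i; rewrite mxE.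
apply: (b_free (u 0)).
under eq_bigr => j _ do rewrite bE scaler_sumr.
rewrite exchange_big big1 // => j _.
under eq_bigr => k _ do rewrite scalerA.
have /rowP/(_ j) := uM; rewrite !mxE -scaler_suml => uMj.
rewrite (_ : \sum_i _ = 0) ?scale0r // -[RHS]uMj.
by apply: eq_bigr => k _; rewrite mxE.
Qed.

Lemma has_dim_unique (K : fieldType) (V : lmodType K) (S : V -> Prop) d e :
  has_dim S d -> has_dim S e -> d = e.
Proof.
by move=> hd he; apply/eqP; rewrite eqn_leq !(has_dim_leq _ hd, has_dim_leq _ he).
Qed.

(* Main.v *)
From Stdlib Require Import Classical BinNums BinPos BinNat Nnat Pnat.
Require Import Defs.
From mathcomp Require Import all_boot all_order all_algebra.
From mathcomp Require Import mpoly zify.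

(** Reading the exponents of a monomial in base 2, one digit at a time, writes
    it as a word [L0 L1 L2 ...] of subsets of the five variables: with [x^L] the
    squarefree monomial of [L], the word stands for
    [x^L0 (x^L1)^2 (x^L2)^4 ...].  Its weight is the sequence [|L0|, |L1|, ...],
    and weights are compared lexicographically.

    Upper bound.  Take a sum of [Sq^j (x^h)] with [0 < j < 2^s] and keep its
    terms of greatest weight, all of them words of length [s].  Their sum is hit
    modulo terms of smaller weight.  It remains so when the words are extended
    on the right, since [Sq^j (f g^(2^s)) = Sq^j f g^(2^s)] for [j < 2^s]
    ([Sq_mul_pow2]), and on the left, since by the Cartan formula
    [Sq^2k (x^L f^2) = x^L (Sq^k f)^2] up to terms of smaller weight
    ([hl_letter]).  So such a sum is a relation between factors of words
    ([valid_context], [relationP]); solved for its leading word it becomes a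
    rewriting rule ([saturateP]).  The order on words is well founded, and a word
    of degree 63 has at most 6 letters, hence the words of length 6 and degree 63
    without reducible factor span [QP_5] in that degree ([in_span_homog]).  The
    rules obtained from [relations] leave 1153 of them.  Most of these rules come
    from a single square; the remaining ones use that [u Sq^j v] and
    [chi(Sq^j)(u) v] agree modulo hits, [chi] the conjugation of the Steenrod
    algebra.

    Lower bound.  Let [E] be a set of monomials such that the sum of the
    coefficients over [E] vanishes on every [Sq^k g], [k > 0]: for instance a
    single spike, whose exponents have the form [2^a - 1].  Linear substitutions
    commute with the squares, so for every 5 by 5 matrix [A] the functional
    [f |-> sum over E of the coefficients of f(A x)] factors through [QP_5]
    ([phi_hit]).  On a word [w] its value is computed letter by letter: the
    coefficient of [e] is 0 if [w] has smaller weight than [e]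
    ([mcoeff_subst_lt]), and a product of minors of [A] if the weights agree
    ([mcoeff_subst_eq]).  Ordered by weight, the functionals thus form a block
    triangular matrix on the irreducible words, and Gaussian elimination in each
    block shows that the 1141 functionals of [functionals] are independent
    ([blocks_free]); the blocks have 31, 465, 455, 175 and 15 rows.

    Both computations are the boolean [check], evaluated in [check_degree63];
    [check_dim] draws the conclusion. *)

Set Implicit Arguments.
Unset Strict Implicit.
Unset Printing Implicit Defensive.

(** * Words, weights and their orders *)

(** The characteristic sequence of a set of variables. *)
Definition letter := seq bool.
Definition word := seq letter.

Fixpoint lsize (L : letter) : nat :=
  if L is b :: L' then (if b then (lsize L').+1 else lsize L') else 0.

Definition weight (w : word) : seq nat := map lsize w.

Fixpoint cmp_letter (u v : letter) : comparison :=
  match u, v with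
  | [::], [::] => Eq
  | [::], _ => Lt
  | _, [::] => Gt
  | a :: u', b :: v' =>
    match a, b with
    | true, false => Gt
    | false, true => Lt
    | _, _ => cmp_letter u' v'
    end
  end.

Fixpoint cmp_word (u v : word) : comparison :=
  match u, v with
  | [::], [::] => Eq
  | [::], _ => Lt
  | _, [::] => Gt
  | L :: u', M :: v' =>
    match cmp_letter L M with Eq => cmp_word u' v' | c => c end
  end.

Fixpoint cmp_nat (a b : nat) : comparison :=
  match a, b with
  | 0, 0 => Eq
  | 0, _ => Lt
  | _, 0 => Gt
  | a'.+1, b'.+1 => cmp_nat a' b'
  end.

(** Only the common prefix counts, so that a word can be compared with the
    weight of a longer or shorter one; on sequences of equal length this is the
    lexicographic order. *)
Fixpoint cmp_lex (a b : seq nat) : comparison :=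
  match a, b with
  | x :: a', y :: b' =>
    match cmp_nat x y with Eq => cmp_lex a' b' | c => c end
  | _, _ => Eq
  end.

Definition is_Lt c := if c is Lt then true else false.
Definition is_Eq c := if c is Eq then true else false.

(** * Rewriting sums of words *)

(** Sums over the field with two elements are lists sorted by decreasing
    [cmp_word]; adding them cancels equal words. *)
Fixpoint xmerge (p : seq word) : seq word -> seq word :=
  fix aux (q : seq word) : seq word :=
    match p, q with
    | [::], _ => q
    | _, [::] => p
    | x :: p', y :: q' =>
      match cmp_word x y with
      | Gt => x :: xmerge p' q
      | Lt => y :: aux q'
      | Eq => xmerge p' q'
      end
    end.

(** The rules, keyed by the concatenated letters of their left-hand side. All
    letters have five entries, so the concatenation determines the word. *)
Inductive trie := Tip | Node of option (seq word) & trie & trie.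

Definition trie_val t := if t is Node v _ _ then v else None.
Definition tchild (b : bool) t :=
  if t is Node _ l r then (if b then r else l) else Tip.
Fixpoint tget (bs : seq bool) t :=
  if bs is b :: bs' then tget bs' (tchild b t) else trie_val t.
Fixpoint twalk (L : letter) t :=
  if L is b :: L' then twalk L' (tchild b t) else t.

Fixpoint tset (bs : seq bool) (T : seq word) t : trie :=
  match bs with
  | [::] => Node (Some T) (tchild false t) (tchild true t)
  | b :: bs' =>
    let t' := tset bs' T (tchild b t) in
    if b then Node (trie_val t) (tchild false t) t'
    else Node (trie_val t) t' (tchild true t)
  end.

(** Looks for a rule whose left-hand side is a prefix of [w], and returns its
    right-hand side with the rest of [w]. *)
Fixpoint tfind (w : word) t : option (seq word * word) :=
  match t with
  | Tip => None
  | Node (Some T) _ _ => Some (T, w)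
  | _ => if w is L :: w' then tfind w' (twalk L t) else None
  end.

Fixpoint rewrite_word t (w : word) : option (seq word) :=
  match tfind w t with
  | Some (T, y) => Some [seq u ++ y | u <- T]
  | None =>
    if w is L :: w' then
      if rewrite_word t w' is Some R then Some [seq L :: u | u <- R] else None
    else None
  end.

(** Rewrites the leading word only, until it is irreducible. A result obtained
    with insufficient [fuel] is still an equivalent sum. *)
Fixpoint reduce (fuel : nat) t (p : seq word) : seq word :=
  match fuel, p with
  | k.+1, c :: p' =>
    if rewrite_word t c is Some R then reduce k t (xmerge p' R) else p
  | _, _ => p
  end.

(** * Leading parts of Steenrod squares *)

(** The pairs [(i, b)] with [Sq^i (x^a) = x^b] for a variable [x], that is
    [b = a + i] and ['C(a, i)] odd. They are found by recursion on the binary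
    digits of [a], from [(x + x^2 t)^(2a) = ((x + x^2 t)^a)^2]. *)
Fixpoint sq_pos (a : positive) : seq (N * N) :=
  match a with
  | xH => [:: (N0, Npos xH); (Npos xH, Npos (xO xH))]
  | xO a' => [seq (N.double x.1, N.double x.2) | x <- sq_pos a']
  | xI a' =>
    flatten [seq [:: (N.double x.1, N.succ_double x.2);
                     (N.succ_double x.1, N.double (N.succ x.2))]
            | x <- sq_pos a']
  end.
Definition sq_var (a : N) := if a is Npos p then sq_pos p else [:: (N0, N0)].

(** The exponents of the terms of [Sq^j (x^h)], by the Cartan formula. *)
Fixpoint sq_terms (j : N) (h : seq N) : seq (seq N) :=
  match h with
  | [::] => if j is N0 then [:: [::]] else [::]
  | a :: h' =>
    flatten [seq (if N.leb x.1 j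
                  then [seq x.2 :: m | m <- sq_terms (N.sub j x.1) h']
                  else [::])
            | x <- sq_var a]
  end.

(** The first [s] letters of a monomial, and the exponents of what remains. *)
Fixpoint bits (s : nat) (m : seq N) : word * seq N :=
  if s is s'.+1 then
    let r := bits s' (map N.div2 m) in (map N.odd m :: r.1, r.2)
  else ([::], m).

Definition is_N0 (a : N) := if a is N0 then true else false.

(** Drops the terms of weight below [al]. The remaining ones must be words of
    length [size al], otherwise the computation fails. *)
Definition high_terms (al : seq nat) (ts : seq (seq N)) : option (seq word) :=
  foldr (fun t acc =>
           if acc is Some p then
             let r := bits (size al) t in
             if is_Lt (cmp_lex (weight r.1) al) then acc
             else if all is_N0 r.2 then Some (xmerge [:: r.1] p) else None
           else None)
        (Some [::]) ts.

Definition square := (N * seq N)%type.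

Definition high_part (s : nat) (al : seq nat) (q : square) :=
  if [&& ~~ is_N0 q.1, N.ltb q.1 (N.pow (Npos (xO xH)) (N.of_nat s)) & size q.2 == 5]
  then high_terms al (sq_terms q.1 q.2) else None.

Definition xmerge_opt (p q : option (seq word)) :=
  match p, q with Some p', Some q' => Some (xmerge p' q') | _, _ => None end.

(** Terms are read on three letters more than [al], so that a term of weight at
    least [al] is seen in full; those left in the sum must have weight [al]
    followed by empty letters. *)
Definition relation (al : seq nat) (qs : seq square) : option (seq word) :=
  let s := size al in
  let al' := al ++ [:: 0; 0; 0] in
  if foldr (fun q acc => xmerge_opt (high_part s al' q) acc) (Some [::]) qs
       is Some p
  then if all (fun w => is_Eq (cmp_lex (weight w) al')) p
       then Some (map (take s) p) else None
  else None.

(** * Rules from a certificate *)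

Definition wf (w : word) := all (fun L => size L == 5) w.

Fixpoint low_bits (k : nat) (a : N) : N * N :=
  if k is k'.+1 then
    let r := low_bits k' (N.div2 a) in
    ((if N.odd a then N.succ_double r.1 else N.double r.1), r.2)
  else (N0, a).
Fixpoint decode_exps (n : nat) (c : N) : seq N * N :=
  if n is n'.+1 then
    let r := low_bits 6 c in let q := decode_exps n' r.2 in (r.1 :: q.1, q.2)
  else ([::], c).
Definition decode_square (c : N) : square :=
  let r := decode_exps 5 c in (r.2, r.1).
Fixpoint decode_letter (n : nat) (c : N) : letter * N :=
  if n is n'.+1 then
    let r := decode_letter n' (N.div2 c) in (rcons r.1 (N.odd c), r.2)
  else ([::], c).

(** Five bits for each letter, the first letter in the lowest ones, and a leading
    1 after the last letter. *)
Fixpoint decode_word (k : nat) (c : N) : word :=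
  if k is k'.+1 then
    if N.leb c (Npos xH) then [::]
    else let r := decode_letter 5 c in r.1 :: decode_word k' r.2
  else [::].

(** An entry codes a prefix word followed by the summands of a [relation]. The
    prefixed relation is reduced by the rules found so far, and what remains is
    solved for its leading word. *)
Definition add_rule (al : seq nat) (t : option trie) (e : seq N) : option trie :=
  match t, e with
  | Some t', pc :: cs =>
    let u := decode_word 6 pc in
    if ~~ wf u then None else
    if relation (drop (size u) al) (map decode_square cs) is Some p then
      if reduce 2000 t' (map (cat u) p) is c :: T then
        if all (fun w => is_Lt (cmp_word w c)) T
        then Some (tset (flatten c) T t') else None
      else None
    else None
  | _, _ => None
  end.

Definition saturate (cert : seq (seq nat * seq (seq N))) : option trie :=
  foldl (fun t g => foldl (add_rule g.1) t g.2) (Some Tip) cert.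

(** * Irreducible words *)

Fixpoint all_letters (n : nat) : seq letter :=
  if n is n'.+1 then
    [seq false :: L | L <- all_letters n'] ++ [seq true :: L | L <- all_letters n']
  else [:: [::]].
Definition letters_by_size : seq (nat * seq letter) :=
  [seq (a, [seq L <- all_letters 5 | lsize L == a]) | a <- iota 0 6].

Definition is_Tip t := if t is Tip then true else false.
Definition has_val t := isSome (trie_val t).

(** The words of length [d] and degree [r] without reducible factor. The tries in
    [act] are the positions reached in [root] by the suffixes of the letters
    already read: a new letter is rejected when it completes a left-hand side.
    The parity of [r] restricts the size of the letter. *)
Fixpoint irreducibles (bs : seq (nat * seq letter)) (root : trie)
    (d r : nat) (act : seq trie) : seq word :=
  if d is d'.+1 then
    flatten [seq (if (odd g.1 == odd r) && (g.1 <= r) then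
        flatten [seq (let act' := [seq t <- [seq twalk L t | t <- root :: act]
                                  | ~~ is_Tip t] in
                      if has has_val act' then [::] else
                      [seq L :: w | w <- irreducibles bs root d' (r - g.1)./2 act'])
                | L <- g.2]
      else [::])
    | g <- bs]
  else if r is 0 then [:: [::]] else [::].

(** * Values of functionals *)

(** The minor of the matrix with rows [rs] on the columns [T], expanded along the
    first row; signs do not matter modulo 2. It is 0 unless [rs] has as many rows
    as [T] has elements. *)
Fixpoint minor (rs : seq letter) (T : letter) : bool :=
  if rs is l :: rs' then
    foldr (fun j b => if nth false l j then
                        if nth false T j then
                          if minor rs' (set_nth false T j false) then ~~ b else b
                        else b
                      else b)
          false (iota 0 (size T))
  else ~~ has id T.

Inductive btree := Leaf of bool | Fork of btree & btree.

(** The same minors are needed for many words: they are computed once for all the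
    32 letters. *)
Fixpoint tabulate (n : nat) (f : letter -> bool) : btree :=
  if n is n'.+1 then
    Fork (tabulate n' (fun L => f (false :: L))) (tabulate n' (fun L => f (true :: L)))
  else Leaf (f [::]).
Fixpoint lookup (t : btree) (L : letter) : bool :=
  match t, L with
  | Leaf b, _ => b
  | Fork l r, b :: L' => lookup (if b then r else l) L'
  | Fork _ _, [::] => false
  end.

Definition level_value (A : word) (T L : letter) : bool :=
  if eqn (lsize L) (lsize T) then minor (mask L A) T else false.
Fixpoint all_levels (ts : seq btree) (w : word) : bool :=
  match ts, w with
  | t :: ts', L :: w' => if lookup t L then all_levels ts' w' else false
  | _, _ => true
  end.

(** The values on the words [ws] of the functional of [E] and [A], provided that
    the words have the weight of the elements of [E]. *)
Definition values (E : seq word) (A : word) (ws : seq word) : seq bool :=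
  let tss := [seq [seq tabulate 5 (level_value A T) | T <- e] | e <- E] in
  [seq foldr (fun ts b => if all_levels ts w then ~~ b else b) false tss | w <- ws].

(** * Gaussian elimination over the field with two elements *)

Fixpoint vxor (u v : seq bool) : seq bool :=
  match u, v with
  | a :: u', b :: v' => (if a then ~~ b else b) :: vxor u' v'
  | _, _ => [::]
  end.

(** For each column, possibly a vector with leading entry 1 in that column, of
    which only the entries behind it are stored. *)
Definition echelon := seq (option (seq bool)).

(** Fails when the vector depends on the rows already there. *)
Fixpoint add_row (P : echelon) (v : seq bool) : option echelon :=
  match P, v with
  | None :: P', h :: v' =>
    if h then Some (Some v' :: P')
    else if add_row P' v' is Some Q then Some (None :: Q) else None
  | Some t :: P', h :: v' =>
    if add_row P' (if h then vxor v' t else v') is Some Q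
    then Some (Some t :: Q) else None
  | _, _ => None
  end.
Definition independent_rows (n : nat) (vs : seq (seq bool)) : bool :=
  isSome (foldl (fun P v => if P is Some P' then add_row P' v else None)
                (Some (nseq n None)) vs).

(** * Functionals that vanish on hits *)

Definition family := (seq N * seq N)%type.
Definition decode_family (F : family) : seq word * seq word :=
  (map (decode_word 6) F.1, map (decode_word 5) F.2).

Fixpoint word_exps (w : word) : seq N :=
  if w is L :: w' then
    [seq (if x.1 then N.succ_double x.2 else N.double x.2) | x <- zip L (word_exps w')]
  else nseq 5 N0.

(** Whether [x^e] is a term of the total square of [x^b], for one variable [x]. *)
Definition coef_var (b e : N) : bool :=
  odd (count (fun x => N.eqb x.2 e) (sq_var b)).
Fixpoint coef_exps (b e : seq N) : bool :=
  match b, e with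
  | x :: b', y :: e' => if coef_var x y then coef_exps b' e' else false
  | _, _ => true
  end.
Fixpoint sources (e : seq N) : seq (seq N) :=
  if e is y :: e' then
    let r := sources e' in
    flatten [seq [seq x :: b | b <- r]
            | x <- [seq b <- [seq N.of_nat i | i <- iota 0 (N.to_nat y).+1] | coef_var b y]]
  else [:: [::]].
Definition exps_degree (b : seq N) := foldr N.add N0 b.

(** It suffices to test the monomials of degree below [d] that have an element of
    [E] among the terms of their total square; [sources] lists them. *)
Definition annihilated (d : N) (E : seq word) : bool :=
  let es := map word_exps E in
  all (fun e => (size e == 5) && N.eqb (exps_degree e) d) es &&
  all (fun b => if N.ltb (exps_degree b) d
                then ~~ odd (count (coef_exps b) es) else true)
      (flatten (map sources es)).

(** * The check *)

Definition block := (seq nat * seq family)%type.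

(** The elements of [E] have weight at least [al], the weight of the block, and
    strictly greater than the weights of the preceding blocks. *)
Definition check_family (al : seq nat) (lower : seq (seq nat)) (E : seq word) : bool :=
  [&& all wf E, all (fun e => size e == 6) E, annihilated (Npos 63) E,
      all (fun e => ~~ is_Lt (cmp_lex (weight e) al)) E &
      all (fun be => all (fun e => is_Lt (cmp_lex be (weight e))) E) lower].
Definition check_block (ws : seq word) (lower : seq (seq nat)) (B : block) : bool :=
  let al := B.1 in
  let fs := map decode_family B.2 in
  let cols := [seq w <- ws | is_Eq (cmp_lex (weight w) al)] in
  [&& all (fun F => check_family al lower F.1) fs,
      all (fun F => all (fun A => wf A && (size A == 5)) F.2) fs &
      independent_rows (size cols)
        (flatten [seq (let E := [seq e <- F.1 | is_Eq (cmp_lex (weight e) al)] in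
                       [seq values E A cols | A <- F.2]) | F <- fs])].
Fixpoint check_blocks (ws : seq word) (lower : seq (seq nat)) (Bs : seq block) : bool :=
  if Bs is B :: Bs' then
    check_block ws lower B && check_blocks ws (B.1 :: lower) Bs'
  else true.
Definition count_functionals (Bs : seq block) : nat :=
  foldr addn 0 [seq foldr addn 0 [seq size F.2 | F <- B.2] | B <- Bs].

Definition check (cert : seq (seq nat * seq (seq N))) (Bs : seq block) : bool :=
  if saturate cert is Some t then
    let ws := irreducibles letters_by_size t 6 63 [::] in
    (size ws <= 1155) && check_blocks ws [::] Bs
  else false.

Import GRing.Theory.
Local Open Scope ring_scope.

Local Notation P n := {mpoly 'F_2[n]}.
Local Notation P5 := {mpoly 'F_2[5]}.

(** * Squares in characteristic 2 *)

Lemma addpp n (p : P n) : p + p = 0.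
Proof. by rewrite -mulr2n -scaler_nat (_ : 2%:R = 0 :> 'F_2) ?scale0r //; apply/eqP. Qed.

Lemma addpp_poly n (p : {poly P n}) : p + p = 0.
Proof. by apply/polyP => k; rewrite coefD addpp coef0. Qed.

Lemma oppp n (p : P n) : - p = p.
Proof. by apply/eqP; rewrite eq_sym -addr_eq0 addpp. Qed.

Lemma sqrpD n (p q : P n) : (p + q) ^+ 2 = p ^+ 2 + q ^+ 2.
Proof. by rewrite sqrrD mulr2n addpp addr0. Qed.

Lemma sqrp_sum n (I : Type) (s : seq I) (F : I -> P n) :
  (\sum_(i <- s) F i) ^+ 2 = \sum_(i <- s) F i ^+ 2.
Proof.
elim: s => [|i s IHs]; first by rewrite !big_nil expr0n.
by rewrite !big_cons sqrpD IHs.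
Qed.

Lemma sqr_polyD n (p q : {poly P n}) : (p + q) ^+ 2 = p ^+ 2 + q ^+ 2.
Proof. by rewrite sqrrD mulr2n (addpp_poly (p * q)) addr0. Qed.

(** Squaring a polynomial in characteristic 2 doubles the exponents. *)
Lemma coef_sqr n (p : {poly P n}) k :
  (p ^+ 2)`_k = if odd k then 0 else (p`_k./2) ^+ 2.
Proof.
elim/poly_ind: p k => [|p c IHp] k.
  by rewrite expr0n !coef0 expr0n if_same.
have cE : c%:P ^+ 2 = (c ^+ 2)%:P by rewrite [RHS]polyC_exp.
rewrite sqr_polyD exprMn cE [LHS]coefD.
rewrite coefMXn coefC.
have -> : (p * 'X + c%:P)`_k./2 = (p * 'X)`_k./2 + (c%:P)`_k./2 by rewrite [LHS]coefD.
rewrite coefMX coefC.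
case: k => [|[|k]] /=; [by rewrite !add0r | by rewrite addr0 | ].
by rewrite !addr0 !subSS subn0 IHp negbK.
Qed.

Section SquareRules.
Variable n : nat.
Implicit Types (f g : P n).

Lemma Sq_gen_mmap f :
  Sq_gen f = mmap ((@polyC (P n)) \o (@mpolyC n 'F_2))
    (fun i => ('X_i : P n)%:P + (('X_i : P n) ^+ 2)%:P * 'X) f.
Proof. by []. Qed.

Lemma Sq_genXn f k : Sq_gen (f ^+ k) = Sq_gen f ^+ k.
Proof. by rewrite !Sq_gen_mmap rmorphXn. Qed.

Lemma Sq_gen_prod (I : Type) (s : seq I) (F : I -> P n) :
  Sq_gen (\prod_(i <- s) F i) = \prod_(i <- s) Sq_gen (F i).
Proof. by rewrite Sq_gen_mmap rmorph_prod. Qed.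

Lemma Sq_gen_X i :
  Sq_gen ('X_i : P n) = ('X_i)%:P + (('X_i : P n) ^+ 2)%:P * 'X.
Proof. by rewrite Sq_gen_mmap mmapX mmap1U. Qed.

Lemma Sq_sqr k f : Sq k (f ^+ 2) = if odd k then 0 else Sq k./2 f ^+ 2.
Proof. by rewrite /Sq Sq_genXn coef_sqr. Qed.

Lemma Sq_pow2 s j g : (0 < j < 2 ^ s)%N -> Sq j (g ^+ (2 ^ s)) = 0.
Proof.
elim: s j => [|s IHs] j; first by rewrite expn0; case: j => [|[]].
case/andP=> j_gt0 j_lt; rewrite expnSr exprM Sq_sqr.
case: ifPn => // j_even; rewrite IHs ?expr0n //.
have jE : j = (j./2).*2 by rewrite -[LHS]odd_double_half (negPf j_even).
by move: j_gt0 j_lt; rewrite jE expnSr muln2 ltn_double double_gt0 doubleK => -> ->.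
Qed.

(** By the Cartan formula, as [Sq^i (g^(2^s)) = 0] for [0 < i < 2^s]: this
    extends relations to the right. *)
Lemma Sq_mul_pow2 s j f g :
  (j < 2 ^ s)%N -> Sq j (f * g ^+ (2 ^ s)) = Sq j f * g ^+ (2 ^ s).
Proof.
move=> j_lt; rewrite Sq_cartan big_ord_recr /= subnn Sq_0 big1 ?add0r // => -[i /= i_lt] _.
by rewrite Sq_pow2 ?mulr0 // subn_gt0 i_lt (leq_ltn_trans (leq_subr _ _)).
Qed.

Lemma Sq_sum k (I : Type) (s : seq I) (F : I -> P n) :
  Sq k (\sum_(i <- s) F i) = \sum_(i <- s) Sq k (F i).
Proof. exact: linear_sum. Qed.

Lemma hit_Sq k f : (0 < k)%N -> hit (Sq k f).
Proof.
move=> k_gt0; exists [:: ([:: k], f)]; last by rewrite big_seq1.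
by move=> p; rewrite inE => /eqP -> /=; rewrite addn0.
Qed.

Lemma hit0 : hit (0 : P n).
Proof. by apply/hit_predP; rewrite rpred0. Qed.

Lemma hitD f g : hit f -> hit g -> hit (f + g).
Proof. by move=> /hit_predP hf /hit_predP hg; apply/hit_predP; rewrite rpredD. Qed.

Lemma hit_sum (I : eqType) (s : seq I) (F : I -> P n) :
  (forall i, i \in s -> hit (F i)) -> hit (\sum_(i <- s) F i).
Proof.
move=> hF; rewrite big_seq; elim/big_ind: _ => //; first exact: hit0.
exact: hitD.
Qed.

Lemma Sq_homog d k f : f \is d.-homog -> Sq k f \is (d + k).-homog.
Proof.
have homM d1 d2 (p q : {poly P n}) :
    (forall k, p`_k \is (d1 + k).-homog) -> (forall k, q`_k \is (d2 + k).-homog) ->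
    forall k, (p * q)`_k \is ((d1 + d2) + k).-homog.
  move=> hp hq m; rewrite coefM rpred_sum // => -[i /= i_le] _.
  rewrite (_ : d1 + d2 + m = (d1 + i) + (d2 + (m - i)))%N ?dhomogM //.
  by rewrite addnACA subnKC.
have homX (m : 'X_{1..n}) i : Sq i ('X_[m] : P n) \is (mdeg m + i).-homog.
  rewrite /Sq mpolyXE_id Sq_gen_prod mdegE; move: i.
  elim/big_rec2: _ => [i|i q d1 _ IH].
    by rewrite coef1; case: i => [|i]; rewrite ?dhomog1 ?dhomog0.
  rewrite Sq_genXn; apply: (homM) => //; elim: (m i) => [|e IHe] j.
    by rewrite expr0 coef1; case: j => [|j]; rewrite ?dhomog1 ?dhomog0.
  rewrite exprS -[e.+1]add1n; apply: (homM) => // l.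
  rewrite Sq_gen_X coefD coefC coefCM coefX.
  case: l => [|[|l]] /=; rewrite ?mulr0 ?mulr1 ?addr0 ?add0r ?dhomog0 //.
    by rewrite dhomogX /= mdeg1.
  by rewrite expr2 (dhomogM (d := 1) (e := 1)) // dhomogX /= mdeg1.
move=> /dhomogP fd; rewrite [f]mpolyE Sq_sum big_seq rpred_sum // => m mf.
by rewrite linearZ rpredZ //= -(fd m mf) homX.
Qed.

Lemma F2_sqr (c : 'F_2) : c ^+ 2 = c.
Proof. by case: c => [[|[|//]] i]; apply/val_inj. Qed.

(** Linear substitutions commute with the Steenrod squares: on a linear form [l]
    the total square is [l + l^2 t], as on a variable. *)
Lemma Sq_comp (A : n.-tuple (P n)) k f :
  (forall i, exists c : 'I_n -> 'F_2, tnth A i = \sum_j c j *: 'X_j) ->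
  Sq k (f \mPo A) = (Sq k f) \mPo A.
Proof.
move=> linA.
have SA i j : Sq j (tnth A i) =
    if j == 0%N then tnth A i else if j == 1%N then tnth A i ^+ 2 else 0.
  case: j => [|[|j]] /=; first by rewrite Sq_0.
    have [c ->] := linA i; rewrite Sq_sum sqrp_sum; apply: eq_bigr => l _.
    by rewrite linearZ /= Sq_X /= exprZn F2_sqr.
  have [c ->] := linA i; rewrite Sq_sum big1 // => l _.
  by rewrite linearZ /= Sq_X /= scaler0.
have SX i j : Sq j ('X_i \mPo A) = (Sq j 'X_i) \mPo A.
  rewrite comp_mpolyXU -tnth_nth SA Sq_X.
  case: j => [|[|j]] /=; rewrite ?rmorphXn /= ?comp_mpolyXU -?tnth_nth //.
  by rewrite comp_mpoly0.
have SM (p q : P n) : (forall j, Sq j (p \mPo A) = (Sq j p) \mPo A) ->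
    (forall j, Sq j (q \mPo A) = (Sq j q) \mPo A) ->
    forall j, Sq j ((p * q) \mPo A) = (Sq j (p * q)) \mPo A.
  move=> hp hq j; rewrite rmorphM /= !Sq_cartan rmorph_sum /=.
  by apply: eq_bigr => i _; rewrite hp hq rmorphM.
have S1 j : Sq j (1 \mPo A) = (Sq j 1) \mPo A.
  by rewrite comp_mpoly1 Sq_1 rmorph_nat.
rewrite [f]mpolyE [_ \mPo A]linear_sum !Sq_sum [RHS]linear_sum /=.
apply: eq_bigr => m _; rewrite !linearZ /=; congr (_ *: _).
rewrite mpolyXE_id.
have SP i (e : nat) j : Sq j ('X_i ^+ e \mPo A) = (Sq j ('X_i ^+ e)) \mPo A.
  elim: e j => [|e IHe] j; first by rewrite expr0 S1.
  by rewrite exprS; exact: (SM _ _ (SX i) IHe).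
move: k; apply: (big_ind (fun p => forall j, Sq j (p \mPo A) = (Sq j p) \mPo A)).
- exact: S1.
- by move=> p q hp hq; exact: (SM p q hp hq).
- by move=> i _ j; exact: SP.
Qed.

End SquareRules.

(** * Words as monomials *)

Lemma nat_of_binE (a : N) : nat_of_bin a = N.to_nat a.
Proof.
case: a => //=; elim=> [p IHp|p IHp|] //=.
  by rewrite IHp Pos2Nat.inj_xI NatTrec.doubleE -mul2n multE.
by rewrite IHp Pos2Nat.inj_xO NatTrec.doubleE -mul2n multE.
Qed.

Lemma nat_of_double (a : N) : N.double a = a.*2 :> nat.
Proof. by rewrite !nat_of_binE N2Nat.inj_double multE mul2n. Qed.

Lemma nat_of_succ_double (a : N) : N.succ_double a = a.*2.+1 :> nat.
Proof. by rewrite !nat_of_binE N2Nat.inj_succ_double multE mul2n. Qed.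

Lemma nat_of_succ (a : N) : N.succ a = a.+1 :> nat.
Proof. by rewrite !nat_of_binE N2Nat.inj_succ. Qed.

Lemma nat_of_sub (a b : N) : N.sub a b = (a - b)%N :> nat.
Proof. by rewrite !nat_of_binE N2Nat.inj_sub. Qed.

Lemma nat_of_leb (a b : N) : N.leb a b = (a <= b)%N.
Proof.
rewrite !nat_of_binE; apply/idP/idP => [/N.leb_le|/leP] h.
  by apply/leP; lia.
by apply/N.leb_le; lia.
Qed.

Lemma nat_of_odd_div2 (a : N) : a = (N.odd a + (N.div2 a).*2)%N :> nat.
Proof.
case: a => // -[p|p|] //=; first by rewrite NatTrec.doubleE.
by rewrite NatTrec.doubleE.
Qed.

Definition lpoly (L : letter) : P5 := \prod_(i < 5) 'X_i ^+ nth false L i.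
Fixpoint wpoly (w : word) : P5 :=
  if w is L :: w' then lpoly L * wpoly w' ^+ 2 else 1.
Definition mon (h : seq N) : P5 := \prod_(i < 5) 'X_i ^+ nth N0 h i.

Lemma wpoly_cat u v : wpoly (u ++ v) = wpoly u * wpoly v ^+ (2 ^ size u).
Proof.
elim: u => [|L u IHu] /=; first by rewrite expn0 mul1r.
by rewrite IHu exprMn -exprM -expnSr mulrA.
Qed.

Lemma mon_odd_div2 h : mon h = lpoly (map N.odd h) * mon (map N.div2 h) ^+ 2.
Proof.
rewrite /mon /lpoly -prodrXl -big_split /=; apply: eq_bigr => i _.
rewrite -exprM -exprD; congr (_ ^+ _).
have -> : nth false (map N.odd h) i = N.odd (nth N0 h i).
  by elim: h (i : nat) => [|a h IHh] [|k] /=.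
have -> : nth N0 (map N.div2 h) i = N.div2 (nth N0 h i).
  by elim: h (i : nat) => [|a h IHh] [|k] /=.
by rewrite muln2 [LHS]nat_of_odd_div2.
Qed.

Lemma mon_bits s h :
  mon h = wpoly (bits s h).1 * mon (bits s h).2 ^+ (2 ^ s).
Proof.
elim: s h => [|s IHs] h /=; first by rewrite expn0 mul1r.
by rewrite mon_odd_div2 [mon (map N.div2 h)]IHs exprMn -exprM -expnSr mulrA.
Qed.

Lemma lpoly_lsize0 L : lsize L = 0%N -> lpoly L = 1.
Proof.
move=> L0; rewrite /lpoly big1 // => i _.
suff -> : nth false L i = false by [].
elim: L (i : nat) L0 => [|b L IHL] [|k] //=; case: b => //; exact: IHL.
Qed.

Lemma sqr_poly_sum n (I : Type) (s : seq I) (F : I -> {poly {mpoly 'F_2[n]}}) :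
  (\sum_(i <- s) F i) ^+ 2 = \sum_(i <- s) F i ^+ 2.
Proof.
elim: s => [|i s IHs]; first by rewrite !big_nil expr0n.
by rewrite !big_cons sqr_polyD IHs.
Qed.

Lemma sq_varE (y : P5) (a : N) :
  (y%:P + (y ^+ 2)%:P * 'X) ^+ a =
  \sum_(z <- sq_var a) (y ^+ z.2)%:P * 'X^(z.1) :> {poly P5}.
Proof.
case: a => [|p] /=; first by rewrite big_seq1 /= !expr0 mulr1.
set B := y%:P + _.
have dbl q : B ^+ nat_of_pos q = \sum_(z <- sq_pos q) (y ^+ z.2)%:P * 'X^(z.1) ->
    B ^+ (nat_of_pos q).*2 =
    \sum_(z <- sq_pos q) (y ^+ (z.2).*2)%:P * 'X^((z.1).*2) :> {poly P5}.
  move=> E; rewrite -muln2 exprM E sqr_poly_sum; apply: eq_bigr => z _.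
  have -> : (y ^+ (z.2).*2)%:P = (y ^+ z.2)%:P ^+ 2 by rewrite -polyC_exp -exprM muln2.
  by rewrite exprMn -exprM muln2.
elim: p => [p IHp|p IHp|] /=.
- rewrite NatTrec.doubleE exprS (dbl _ IHp) mulr_sumr big_flatten big_map /=.
  apply: eq_bigr => z _; rewrite big_cons big_seq1 /=.
  rewrite !nat_of_double !nat_of_succ_double nat_of_succ doubleS /B mulrDl.
  congr (_ + _); first by rewrite mulrA -polyCM -exprS.
  by rewrite -mulrA (mulrCA 'X) -exprS mulrA -polyCM -exprD.
- rewrite NatTrec.doubleE (dbl _ IHp) big_map /=.
  by apply: eq_bigr => z _; rewrite !nat_of_double.
- by rewrite big_cons big_seq1 /= expr0 mulr1 !expr1.
Qed.

(** The values [x i] are arbitrary in order to allow an induction on the number of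
    variables. *)
Lemma sq_termsE (x : nat -> P5) (j : N) (h : seq N) :
  (\prod_(i < size h) ((x i)%:P + (x i ^+ 2)%:P * 'X) ^+ nth N0 h i)`_j =
  \sum_(m <- sq_terms j h) \prod_(i < size h) x i ^+ nth N0 m i.
Proof.
elim: h x j => [|a h IHh] x j /=.
  rewrite big_ord0 coef1; case: j => [|p] /=.
    by rewrite big_seq1 big_ord0.
  rewrite big_nil (_ : (nat_of_pos p == 0)%N = false) //.
  by elim: p => [p IHp|p IHp|] //=; rewrite NatTrec.doubleE ?double_eq0.
rewrite big_ord_recl big_flatten big_map /=; set Q := \prod_(i < _) _.
transitivity (((\sum_(z <- sq_var a) (x 0 ^+ z.2)%:P * 'X^(z.1)) * Q)`_j).
  exact: (congr1 (fun A : {poly P5} => (A * Q)`_j) (sq_varE (x 0%N) a)).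
have QE (i : N) : Q`_i = \sum_(m <- sq_terms i h) \prod_(k < size h) x k.+1 ^+ nth N0 m k.
  exact: (IHh (fun i => x i.+1) i).
rewrite mulr_suml coef_sum.
apply: eq_bigr => z _; rewrite -mulrA coefCM coefXnM nat_of_leb.
rewrite ltnNge; case: (leqP z.1 j) => [le_zj|lt_jz] /=; last by rewrite big_nil mulr0.
rewrite big_map.
rewrite -nat_of_sub QE mulr_sumr; apply: eq_bigr => m _.
by rewrite big_ord_recl /=.
Qed.

Lemma Sq_mon (j : N) h :
  size h = 5 -> Sq j (mon h) = \sum_(m <- sq_terms j h) mon m.
Proof.
move=> h5; rewrite /Sq /mon Sq_gen_prod.
pose x i : P5 := 'X_(inord i); have xE (i : 'I_5) : x i = 'X_i by rewrite /x inord_val.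
transitivity ((\prod_(i < size h) ((x i)%:P + (x i ^+ 2)%:P * 'X) ^+ nth N0 h i)`_j).
  rewrite h5; congr (polyseq _)`_ _; apply: eq_bigr => i _.
  by rewrite Sq_genXn Sq_gen_X xE.
rewrite sq_termsE h5; apply: eq_bigr => m _.
by apply: eq_bigr => i _; rewrite xE.
Qed.

(** * Relations modulo hits and smaller weight *)

Lemma cmp_natP a b :
  match cmp_nat a b with Eq => a = b | Lt => (a < b)%N | Gt => (b < a)%N end.
Proof.
elim: a b => [|a IHa] [|b] //=; have := IHa b.
by case: cmp_nat => // ->.
Qed.

Lemma cmp_nat_refl a : cmp_nat a a = Eq.
Proof. by elim: a. Qed.

Lemma cmp_nat_lt a b : (a < b)%N -> cmp_nat a b = Lt.
Proof. by have := cmp_natP a b; case: cmp_nat => // [->|]; lia. Qed.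

Lemma cmp_lex_cat_Lt a b a' b' :
  cmp_lex a b = Lt -> cmp_lex (a ++ a') (b ++ b') = Lt.
Proof.
elim: a b => [|x a IHa] [|y b] //=; case: cmp_nat => //; exact: IHa.
Qed.

Lemma cmp_lex_cat a b a' b' : size a = size b ->
  cmp_lex (a ++ a') (b ++ b') =
  match cmp_lex a b with Eq => cmp_lex a' b' | c => c end.
Proof.
by elim: a b => [|x a IHa] [|y b] //= [/IHa ->]; case: cmp_nat.
Qed.

Lemma cmp_lex_Eq a b : size a = size b -> cmp_lex a b = Eq -> a = b.
Proof.
elim: a b => [|x a IHa] [|y b] //= [/IHa IH].
by have := cmp_natP x y; case: cmp_nat => // -> /IH ->.
Qed.

Lemma cmp_lex_refl a : cmp_lex a a = Eq.
Proof. by elim: a => //= x a ->; rewrite cmp_nat_refl. Qed.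

Lemma cmp_lex_take a b c : cmp_lex a (b ++ nseq c 0%N) = Lt ->
  cmp_lex (take (size b) a) b = Lt.
Proof.
elim: b a => [|y b IHb] [|x a] //=; last by case: cmp_nat => //; exact: IHb.
by elim: c x a => [|c IHc] //= [|x] [|x' a] //=; case: c IHc => //= c; apply.
Qed.

Lemma wf_cat u v : wf (u ++ v) = wf u && wf v.
Proof. by rewrite /wf all_cat. Qed.

(** A pair [(u, g)] stands for the polynomial [u g^(2^|u|)], each term of which
    starts with the word [u]. *)
Definition low_term (be : seq nat) (x : word * P5) :=
  [&& wf x.1, (size x.1 <= size be)%N & is_Lt (cmp_lex (weight x.1) be)].

Definition low (be : seq nat) (f : P5) : Prop :=
  exists2 s : seq (word * P5), all (low_term be) s &
    f = \sum_(x <- s) wpoly x.1 * x.2 ^+ (2 ^ size x.1).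

Lemma low0 be : low be 0.
Proof. by exists [::]; rewrite ?big_nil. Qed.

Lemma lowD be f g : low be f -> low be g -> low be (f + g).
Proof.
move=> [s hs ->] [t ht ->]; exists (s ++ t); first by rewrite all_cat hs.
by rewrite big_cat.
Qed.

Lemma low_sum be (I : eqType) (s : seq I) (F : I -> P5) :
  (forall i, i \in s -> low be (F i)) -> low be (\sum_(i <- s) F i).
Proof.
move=> hF; rewrite big_seq; elim/big_ind: _ => //; first exact: low0.
exact: lowD.
Qed.

Lemma low1 be u g :
  low_term be (u, g) -> low be (wpoly u * g ^+ (2 ^ size u)).
Proof. by move=> h; exists [:: (u, g)]; rewrite /= ?h ?big_seq1. Qed.

Lemma low_cat be ga f : low be f -> low (be ++ ga) f.
Proof.
move=> [s hs ->]; exists s => //; apply: sub_all hs => -[u g] /and3P[/= wu su lu].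
rewrite /low_term /= wu size_cat (leq_trans su) ?leq_addr //=.
by rewrite -[weight u]cats0 cmp_lex_cat_Lt //; case: cmp_lex lu.
Qed.

Lemma low_letter L be f :
  size L = 5 -> low be f -> low (lsize L :: be) (lpoly L * f ^+ 2).
Proof.
move=> L5 [s hs ->]; exists [seq (L :: x.1, x.2) | x <- s].
  rewrite all_map; apply: sub_all hs => -[u g] /and3P[/= wu su lu].
  by rewrite /low_term /= L5 wu ltnS su cmp_nat_refl.
rewrite sqrp_sum mulr_sumr big_map; apply: eq_bigr => x _ /=.
by rewrite exprMn -exprM -expnSr mulrA.
Qed.

Lemma size_sq_terms j h m : m \in sq_terms j h -> size m = size h.
Proof.
elim: h j m => [|a h IHh] j m /=; first by case: j => [|//]; rewrite inE => /eqP ->.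
case/flatten_mapP => z _; case: N.leb => // /mapP[m' /IHh m'h ->] /=.
by rewrite m'h.
Qed.

(** In [Sq^j (x^L)] each of the [j] variables that are squared leaves the first
    letter, which gets smaller. *)
Lemma lsize_sq_terms j L m :
  m \in sq_terms j [seq (if b then Npos xH else N0) | b <- L] ->
  (lsize (map N.odd m) + j)%N = lsize L.
Proof.
elim: L j m => [|b L IHL] j m /=.
  by case: j => [|//]; rewrite inE => /eqP ->.
case/flatten_mapP => z hz; rewrite nat_of_leb; case: leqP => // le_zj.
case/mapP => m' /IHL + ->; rewrite nat_of_sub => IH.
case: b hz => /=; rewrite !inE.
  by case/orP=> /eqP E; move: le_zj IH; rewrite E /=; lia.
by move/eqP => E; move: le_zj IH; rewrite E /=; lia.
Qed.

Lemma lpoly_mon L : lpoly L = mon [seq (if b then Npos xH else N0) | b <- L].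
Proof.
apply: eq_bigr => i _; congr (_ ^+ _).
by elim: L (i : nat) => [|[] L IHL] [|k] /=.
Qed.

Lemma low_Sq_lpoly L be j g : size L = 5 -> (0 < j)%N ->
  low (lsize L :: be) (Sq j (lpoly L) * g ^+ 2).
Proof.
move=> L5 j_gt0; rewrite lpoly_mon -[j]bin_of_natK Sq_mon ?size_map // mulr_suml.
apply: low_sum => m mj; rewrite mon_odd_div2 -mulrA -exprMn.
have -> : lpoly [seq N.odd i | i <- m] = wpoly [:: [seq N.odd i | i <- m]].
  by rewrite /= expr1n mulr1.
apply: low1; rewrite /low_term /= size_map (size_sq_terms mj) size_map L5 /=.
have := lsize_sq_terms mj; rewrite bin_of_natK => <-.
by rewrite cmp_nat_lt // -addn1 leq_add2l.
Qed.

Lemma hit_Sq_sum f : hit f -> exists2 s : seq (nat * P5),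
  all (fun x => 0 < x.1)%N s & f = \sum_(x <- s) Sq x.1 x.2.
Proof.
case=> s s_pos ->.
elim: s s_pos => [|[w h] s IHs] s_pos; first by exists [::]; rewrite ?big_nil.
have [|t t_pos E] := IHs; first by move=> p ps; apply: s_pos; rewrite inE ps orbT.
have w_pos : (0 < sumn w)%N by apply: (s_pos (w, h)); rewrite inE eqxx.
have [[k g] /= k_pos kE] : exists2 x, (0 < x.1)%N & Sq_word w h = Sq x.1 x.2.
  elim: w w_pos {s_pos} => [|k w IHw] //= w_pos.
  case: k w_pos => [|k] w_pos; last by exists (k.+1, Sq_word w h).
  by rewrite Sq_0; apply: IHw.
exists ((k, g) :: t); first by rewrite /= k_pos.
by rewrite !big_cons E /= kE.
Qed.

(** Hit modulo smaller weight. *)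
Definition hl (be : seq nat) (f : P5) : Prop :=
  exists2 q, hit q & low be (f - q).

Lemma hlD be f g : hl be f -> hl be g -> hl be (f + g).
Proof.
move=> [p hp lp] [q hq lq]; exists (p + q); first exact: hitD.
by rewrite opprD addrACA; apply: lowD.
Qed.

Lemma hl_hit be f : hit f -> hl be f.
Proof. by move=> hf; exists f => //; rewrite subrr; apply: low0. Qed.

Lemma hl_low be f : low be f -> hl be f.
Proof. by move=> lf; exists 0; [apply: hit0 | rewrite subr0]. Qed.

Lemma hl_cat be ga f : hl be f -> hl (be ++ ga) f.
Proof. by move=> [q hq lq]; exists q => //; apply: low_cat. Qed.

Lemma hl_sum be (I : eqType) (s : seq I) (F : I -> P5) :
  (forall i, i \in s -> hl be (F i)) -> hl be (\sum_(i <- s) F i).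
Proof.
move=> hF; rewrite big_seq; elim/big_ind: _ => //; last exact: hlD.
exact/hl_low/low0.
Qed.

(** Apply [Sq^2k (x^L h^2) = x^L (Sq^k h)^2 + ...], where the other terms contain
    [Sq^i (x^L)] with [i > 0] and so have a smaller first letter. *)
Lemma hl_letter L be f :
  size L = 5 -> hl be f -> hl (lsize L :: be) (lpoly L * f ^+ 2).
Proof.
move=> L5 [q /hit_Sq_sum[s s_pos qE] lq].
rewrite -[f](subrK q) sqrpD mulrDr; apply: hlD; first exact/hl_low/low_letter.
rewrite qE sqrp_sum mulr_sumr; apply: hl_sum => -[k h] /(allP s_pos) /= k_pos.
(* The summand with no square on [lpoly L] is the wanted one. *)
have := Sq_cartan k.*2 (lpoly L) (h ^+ 2).
rewrite big_ord_recl Sq_0 subn0 Sq_sqr odd_double doubleK.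
set R := \sum_(i < _) _ => /eqP; rewrite -subr_eq => /eqP <-; rewrite {}/R.
apply: hlD; first by apply/hl_hit/hit_Sq; rewrite double_gt0.
rewrite oppp; apply: hl_sum => i _; apply: hl_low; rewrite Sq_sqr.
case: ifP => _; first by rewrite mulr0; apply: low0.
exact: low_Sq_lpoly.
Qed.

Lemma hl_word x be f :
  wf x -> hl be f -> hl (weight x ++ be) (wpoly x * f ^+ (2 ^ size x)).
Proof.
elim: x => [|L x IHx] /=; first by rewrite expn0 expr1 mul1r.
case/andP=> /eqP L5 wx hf; rewrite -mulrA expnSr exprM -exprMn.
by apply: hl_letter => //; apply: IHx.
Qed.

Definition wsum (W : seq word) : P5 := \sum_(w <- W) wpoly w.

(** Quantifying over the right context [g] is what makes [valid] stable under
    extension on both sides. *)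
Definition valid (al : seq nat) (W : seq word) : Prop :=
  all (fun w => wf w && (weight w == al)) W /\
  forall g, hl al (wsum W * g ^+ (2 ^ size al)).

Lemma wsum_cat x y W (s : nat) : all (fun w => size w == s) W ->
  wsum [seq x ++ w ++ y | w <- W] =
  wpoly x * (wsum W * wpoly y ^+ (2 ^ s)) ^+ (2 ^ size x).
Proof.
move=> hW; rewrite /wsum big_map; elim: W hW => [|w W IHW] /=.
  by rewrite !big_nil mul0r expr0n expn_eq0 /= mulr0.
case/andP=> /eqP sw /IHW E; rewrite !big_cons E !wpoly_cat sw.
have sqD (a b : P5) k : (a + b) ^+ (2 ^ k) = a ^+ (2 ^ k) + b ^+ (2 ^ k).
  by elim: k => [|k IHk]; rewrite ?expn0 // expnSr !exprM IHk sqrpD.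
by rewrite mulrDl sqD mulrDr.
Qed.

(** A word [w y] stands for [w] times the power [2^|w|] of [y], so a right context
    is a special choice of [g]; left contexts are dealt with by [hl_word]. *)
Lemma valid_context x y al W : wf x -> wf y -> valid al W ->
  valid (weight x ++ al ++ weight y) [seq x ++ w ++ y | w <- W].
Proof.
move=> wx wy [wW hW]; split.
  rewrite all_map; apply: sub_all wW => w /andP[ww /eqP <-] /=.
  by rewrite !wf_cat wx ww wy /weight !map_cat eqxx.
move=> g; rewrite (wsum_cat _ _ (s := size al)); last first.
  by apply: sub_all wW => w /andP[_ /eqP <-]; rewrite size_map.
rewrite !size_cat size_map expnD [in g ^+ _]mulnC exprM -mulrA -exprMn.
apply: hl_word => //; rewrite -mulrA expnD [(2 ^ size al * _)%N]mulnC exprM -exprMn.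
by apply: hl_cat; apply: hW.
Qed.

(** * Soundness of the rules *)

Lemma cmp_letter_Eq u v : cmp_letter u v = Eq -> u = v.
Proof. by elim: u v => [|[] u IHu] [|[] v] //= /IHu ->. Qed.

Lemma cmp_word_Eq u v : cmp_word u v = Eq -> u = v.
Proof.
elim: u v => [|L u IHu] [|M v] //=.
by case E: cmp_letter => // /IHu ->; rewrite (cmp_letter_Eq E).
Qed.

Lemma wsum_xmerge p q : wsum (xmerge p q) = wsum p + wsum q.
Proof.
rewrite /wsum; elim: p q => [|x p IHp] q; first by case: q => [|y q]; rewrite big_nil add0r.
elim: q => [|y q IHq]; first by rewrite [X in _ + X]big_nil addr0.
rewrite /=; case E: cmp_word.
- rewrite IHp (cmp_word_Eq E) !big_cons addrACA.
  by rewrite addpp add0r.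
- by rewrite big_cons [xmerge _ _]/= in IHq *; rewrite IHq !big_cons addrCA.
- by rewrite big_cons IHp !big_cons addrA.
Qed.

Lemma all_xmerge (a : pred word) p q : all a p -> all a q -> all a (xmerge p q).
Proof.
elim: p q => [|x p IHp] q; first by case: q.
elim: q => [|y q IHq] // /andP[ax ap] /andP[ay aq]; rewrite /=.
case: cmp_word.
- exact: IHp.
- by rewrite /= ay /=; apply: IHq => //=; rewrite ax.
- by rewrite /= ax /=; apply: IHp => //=; rewrite ay.
Qed.

Lemma take_bits s k h : take s (bits (s + k) h).1 = (bits s h).1.
Proof. by elim: s h => [|s IHs] h; rewrite ?take0 //= IHs. Qed.

Lemma size_bits s h : size (bits s h).1 = s.
Proof. by elim: s h => //= s IHs h; rewrite IHs. Qed.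

Lemma wf_bits s h : size h = 5 -> wf (bits s h).1.
Proof. by elim: s h => //= s IHs h h5; rewrite size_map h5 /= IHs ?size_map. Qed.

Lemma mon_N0 h : all is_N0 h -> mon h = 1.
Proof.
move=> h0; rewrite /mon big1 // => i _.
suff -> : nth N0 h i = N0 by [].
by elim: h (i : nat) h0 => [|[|a] h IHh] [|k] //= h0; apply: IHh.
Qed.

(** The discarded terms are recognised on [size al + 3] letters, but the
    comparison with [al] is decided by the first [size al] of them. *)
Lemma high_termsP al ts p g :
  all (fun t => size t == 5) ts ->
  high_terms (al ++ nseq 3 0%N) ts = Some p ->
  all (fun w => wf w && (size w == size al + 3)%N) p /\
  low al (\sum_(t <- ts) mon t * g ^+ (2 ^ size al) - wsum p * g ^+ (2 ^ size al)).
Proof.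
set al' := al ++ _; have al's : size al' = (size al + 3)%N by rewrite size_cat size_nseq.
elim: ts p => [|t ts IHts] p /=.
  by move=> _ [<-]; rewrite /wsum !big_nil mul0r subrr; split => //; apply: low0.
case/andP=> /eqP t5 ts5; case E: high_terms => [p'|] //.
have [wp' lp'] := IHts _ ts5 E.
case: ifP => [lt_al [<-]|_].
  split => //; rewrite big_cons -addrA; apply: lowD => //.
  rewrite (mon_bits (size al)) -mulrA -exprMn -[X in (2 ^ X)%N](size_bits (size al) t).
  apply: low1; rewrite /low_term /= wf_bits // size_bits leqnn /=.
  have := @cmp_lex_take (weight (bits (size al') t).1) al 3; rewrite -/al'.
  rewrite /weight -map_take al's take_bits => -> //.
  by move: lt_al; rewrite -/al' /weight al's; case: cmp_lex.
case: ifP => // t0 [<-]; split.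
  by apply: (@all_xmerge _ [:: _] p'); rewrite //= wf_bits // size_bits al's eqxx.
rewrite big_cons (wsum_xmerge [:: _] p') /wsum big_seq1 mulrDl opprD addrACA.
rewrite (mon_bits (size al')) (mon_N0 t0) expr1n mulr1 subrr add0r //.
Qed.

Definition wide (s : nat) (p : seq word) := all (fun w => wf w && (size w == s + 3)%N) p.

Lemma high_partP al q p :
  high_part (size al) (al ++ nseq 3 0%N) q = Some p ->
  wide (size al) p /\ forall g, hl al (wsum p * g ^+ (2 ^ size al)).
Proof.
rewrite /high_part; case: q => j h /=; case: ifP => // /and3P[j_neq0 j_lt /eqP h5] E.
have ts5 : all (fun t => size t == 5) (sq_terms j h).
  by apply/allP => t /size_sq_terms ->; rewrite h5.
split=> [|g]; first by have [] := high_termsP 0 ts5 E.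
have [_] := high_termsP g ts5 E; rewrite -mulr_suml -Sq_mon //.
have j_lt' : (j < 2 ^ size al)%N.
  move: j_lt; rewrite /N.ltb; case C: N.compare => // _; rewrite nat_of_binE.
  have := (proj1 (N.compare_lt_iff _ _) C); move: (size al) => s.
  have -> : (2 ^ s)%N = N.to_nat (N.pow (Npos (xO xH)) (N.of_nat s)).
    elim: s => [|s IHs] //; rewrite expnS IHs Nat2N.inj_succ N.pow_succ_r'; lia.
  by move=> lt_j; apply/ltP; lia.
(* The relation is the leading part of [Sq^j (x^h g^(2^s))], a hit. *)
rewrite -Sq_mul_pow2 // => lq; exists (Sq j (mon h * g ^+ (2 ^ size al))).
  apply: hit_Sq; case: j j_neq0 {E ts5 j_lt j_lt' lq} => //= p' _.
  by elim: p' => //= p' IH; rewrite NatTrec.doubleE double_gt0.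
by rewrite -opprB oppp.
Qed.

Lemma relationP al qs W : relation al qs = Some W -> valid al W.
Proof.
rewrite /relation (_ : [:: 0; 0; 0] = nseq 3 0)%N //; set F := foldr _ _ _.
case E: F => [p|] //; case: ifP => // p_al [<-].
have {E} [wp hp] : wide (size al) p /\ forall g, hl al (wsum p * g ^+ (2 ^ size al)).
  elim: qs p @F E {p_al} => [|q qs IHqs] p /=.
    by case=> <-; split => // g; rewrite /wsum big_nil mul0r; apply/hl_low/low0.
  case Eq: high_part => [p1|] //=; case Eqs: foldr => [p2|] //= [<-].
  have [w1 h1] := high_partP Eq; have [w2 h2] := IHqs _ Eqs.
  split=> [|g]; first exact: all_xmerge.
  by rewrite wsum_xmerge mulrDl; apply: hlD.
have tw w : w \in p -> weight w = al ++ nseq 3 0%N.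
  move=> wp'; have /andP[ww /eqP sw] := allP wp w wp'.
  apply: cmp_lex_Eq; first by rewrite size_map sw size_cat size_nseq.
  by move: (allP p_al w wp'); case: cmp_lex.
split.
  rewrite all_map; apply/allP => w wp' /=.
  have /andP[ww /eqP sw] := allP wp w wp'.
  rewrite /weight map_take -/(weight w) tw // take_size_cat // eqxx andbT.
  by move: ww; rewrite -{1}[w](cat_take_drop (size al)) wf_cat => /andP[].
move=> g; rewrite (_ : wsum _ = wsum p) //.
rewrite /wsum big_map; apply: eq_big_seq => w wp'.
rewrite -[in RHS](cat_take_drop (size al) w) wpoly_cat.
have : weight (drop (size al) w) = nseq 3 0%N.
  by rewrite /weight map_drop -/(weight w) tw // drop_size_cat.
case: (drop _ w) => [|L1 [|L2 [|L3 [|]]]] //= [z1 z2 z3].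
by rewrite !lpoly_lsize0 // !(expr1n, mulr1).
Qed.

Lemma tget_cat L bs t : tget (L ++ bs) t = tget bs (twalk L t).
Proof. by elim: L t => //= b L IHL t; rewrite IHL. Qed.

Lemma tget_Tip bs : tget bs Tip = None.
Proof. by elim: bs. Qed.

Lemma tget_tset bs bs' T t :
  tget bs' (tset bs T t) = if bs' == bs then Some T else tget bs' t.
Proof.
elim: bs bs' t => [|b bs IHbs] [|b' bs'] t //=.
- by case: t => //; case: b' => //=; rewrite tget_Tip.
- by case: b; case: t.
- by rewrite eqseq_cons; case: b b' => [] [] /=; rewrite ?IHbs.
Qed.

Lemma tfindP w t T y : tfind w t = Some (T, y) ->
  exists2 c, w = c ++ y & tget (flatten c) t = Some T.
Proof.
elim: w t => [|L w IHw] [|[T'|] l r] //=.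
- by case=> -> <-; exists [::].
- by case=> -> <-; exists [::].
by case/IHw => c -> tc; exists (L :: c) => //=; rewrite tget_cat.
Qed.

Lemma rewrite_wordP t w R : rewrite_word t w = Some R ->
  exists x c y T, [/\ w = x ++ c ++ y, tget (flatten c) t = Some T &
    R = [seq x ++ u ++ y | u <- T]].
Proof.
elim: w R => [|L w IHw] R.
  rewrite (_ : rewrite_word t [::] = if tfind [::] t is Some (T, y) then
      Some [seq u ++ y | u <- T] else None) //.
  case E: tfind => [[T y]|] // [<-].
  by have [c wc tc] := tfindP E; exists [::], c, y, T.
rewrite (_ : rewrite_word t (L :: w) = if tfind (L :: w) t is Some (T, y) then
    Some [seq u ++ y | u <- T] else if rewrite_word t w is Some R' then
    Some [seq L :: u | u <- R'] else None) //.
case E: tfind => [[T y]|].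
  by case=> <-; have [c wc tc] := tfindP E; exists [::], c, y, T.
case Ew: rewrite_word => [R'|] // [<-].
have [x [c [y [T [-> tc ->]]]]] := IHw _ Ew.
by exists (L :: x), c, y, T; split=> //; rewrite -map_comp.
Qed.

(** Each rule is a relation, and its right-hand side is smaller than its left-hand
    side. *)
Definition trie_ok t := forall c T, wf c -> tget (flatten c) t = Some T ->
  valid (weight c) (c :: T) /\ all (fun w => is_Lt (cmp_word w c)) T.

Lemma valid_add al W W' X : valid al W -> valid al W' ->
  all (fun w => wf w && (weight w == al)) X -> wsum X = wsum W + wsum W' ->
  valid al X.
Proof.
by move=> [_ h] [_ h'] wX E; split=> // g; rewrite E mulrDl; apply: hlD.
Qed.

Lemma valid_rewrite t c R : trie_ok t -> wf c -> rewrite_word t c = Some R ->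
  valid (weight c) (c :: R).
Proof.
move=> okt wc /rewrite_wordP[x [k [y [T [E tk ->]]]]].
move: wc; rewrite E !wf_cat => /and3P[wx wk wy].
rewrite /weight !map_cat -!/(weight _) -[_ :: map _ _]/[seq x ++ u ++ y | u <- k :: T].
by apply: valid_context => //; have [] := okt k T wk tk.
Qed.

Lemma reduceP n t al p : trie_ok t -> valid al p -> valid al (reduce n t p).
Proof.
move=> okt; elim: n p => [|n IHn] [|c p] //= vcp.
case E: rewrite_word => [R|] //; apply: IHn.
have /andP[/andP[wc /eqP cal] wp] := vcp.1.
have vcR := valid_rewrite okt wc E; rewrite cal in vcR.
apply: (valid_add vcp vcR).
  by apply: all_xmerge => //; have /andP[] := vcR.1.
rewrite wsum_xmerge /wsum !big_cons addrACA.
by rewrite addpp add0r.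
Qed.

Lemma flatten_inj c c' : wf c -> wf c' -> flatten c = flatten c' -> c = c'.
Proof.
elim: c c' => [|L c IHc] [|L' c'] //=.
- by case: L'.
- by case: L.
case/andP=> /eqP L5 wc /andP[/eqP L5' wc'] /eqP.
by rewrite eqseq_cat ?L5 // => /andP[/eqP -> /eqP /IHc ->].
Qed.

Lemma add_ruleP al t e t' : trie_ok t -> add_rule al (Some t) e = Some t' -> trie_ok t'.
Proof.
move=> okt; case: e => [|pc cs] //; rewrite /add_rule.
set u := decode_word 6 pc; case: ifP => // /negbFE wu.
case E: relation => [p|] //; case Er: reduce => [|c T] //; case: ifP => // lt_c [<-].
have vp := relationP E.
have := @valid_context u [::] _ _ wu isT vp.
rewrite (eq_map (g := cat u)); last by move=> w; rewrite cats0.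
move=> /(reduceP 2000 okt); rewrite Er => vcT k T' wk; rewrite tget_tset.
case: eqP => [/flatten_inj E' [<-]|_]; last exact: okt.
have kc : k = c by apply: E' => //; have /andP[/andP[]] := vcT.1.
rewrite kc; have /andP[/andP[_ /eqP ->] _] := vcT.1.
by split.
Qed.

Lemma saturateP cert t : saturate cert = Some t -> trie_ok t.
Proof.
have ok0 : trie_ok Tip by move=> c T _; rewrite tget_Tip.
rewrite /saturate.
have addN al es : foldl (add_rule al) None es = None.
  by elim: es => [|e es IHes] //; rewrite -[RHS]IHes.
have ok_al al es t0 t1 : trie_ok t0 -> foldl (add_rule al) (Some t0) es = Some t1 -> trie_ok t1.
  elim: es t0 => [|e es IHes] t0 ok; first by case=> <-.
  rewrite (_ : foldl _ _ _ = foldl (add_rule al) (add_rule al (Some t0) e) es) //.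
  case E: (add_rule al (Some t0) e) => [t2|]; last by rewrite addN.
  by apply: IHes; apply: add_ruleP E.
elim: cert (Tip) ok0 => [|[al es] cert IHc] t0 ok; first by case=> <-.
rewrite [foldl _ _ _](_ : _ = foldl (fun t g => foldl (add_rule g.1) t g.2)
  (foldl (add_rule al) (Some t0) es) cert) //.
case E: (foldl (add_rule al) (Some t0) es) => [t1|].
  by apply: IHc; apply: ok_al E.
by elim: cert {IHc} => [|g cert IH] //; rewrite (_ : foldl _ _ _ = foldl
  (fun t g => foldl (add_rule g.1) t g.2) (foldl (add_rule g.1) None g.2) cert) // addN.
Qed.

(** * The irreducible words exhaust the normal forms *)

Fixpoint wdeg (w : word) : nat :=
  if w is L :: w' then (lsize L + (wdeg w').*2)%N else 0%N.

Lemma mem_all_letters n L : (L \in all_letters n) = (size L == n).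
Proof.
elim: n L => [|n IHn] [|b L] //=.
  by rewrite mem_cat; apply/negP => /orP[] /mapP[].
rewrite mem_cat eqSS -IHn; apply/orP/idP => [[] /mapP[L' hL [_ ->]] //|hL].
by case: b; [right | left]; apply/mapP; exists L.
Qed.

Lemma lsize_le L : (lsize L <= size L)%N.
Proof. by elim: L => //= -[] L IHL; lia. Qed.

(** If [t] is a subtrie of the trie of rules, [c] is the part of a left-hand side
    that is still to be read. *)
Definition has_prefix t (w : word) :=
  exists c y T, w = c ++ y /\ tget (flatten c) t = Some T.
Definition reducible t (w : word) := exists x v, w = x ++ v /\ has_prefix t v.

Lemma In_filter_map (T1 T2 : Type) (a : pred T2) (f : T1 -> T2) s y :
  List.In y [seq x <- map f s | a x] -> exists2 x, List.In x s & y = f x.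
Proof.
elim: s => //= x s IHs; case: ifP => _ /=.
  by case=> [<-|/IHs[x' ? ?]]; [exists x; [left|] | exists x'; [right|]].
by case/IHs=> x' ? ?; exists x'; [right|].
Qed.

Lemma irreduciblesS bs root d r act :
  irreducibles bs root d.+1 r act =
  flatten [seq (if (odd g.1 == odd r) && (g.1 <= r)%N then
      flatten [seq (let act' := [seq t <- [seq twalk L t | t <- root :: act]
                                | ~~ is_Tip t] in
                    if has has_val act' then [::] else
                    [seq L :: w | w <- irreducibles bs root d (r - g.1)./2 act'])
              | L <- g.2]
    else [::])
  | g <- bs].
Proof. by []. Qed.

(** The third case covers the rules a part of which has been read before [w]. *)
Lemma irreduciblesP root d r act w :
  wf w -> size w = d -> wdeg w = r ->
  [\/ w \in irreducibles letters_by_size root d r act, reducible root w |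
    exists2 t, List.In t act & has_prefix t w].
Proof.
elim: d r act w => [|d IHd] r act [|L w] //.
  by move=> _ _ <-; constructor 1; rewrite inE.
rewrite [wf _]/= [size _]/= [wdeg _]/=.
case/andP=> /eqP L5 ww [sw] dw.
have [gr Lgr Lin] : exists2 gr, (lsize L, gr) \in letters_by_size & L \in gr.
  exists [seq M <- all_letters 5 | lsize M == lsize L]; last first.
    by rewrite mem_filter eqxx mem_all_letters L5.
  apply/mapP; exists (lsize L) => //.
  by rewrite mem_iota; have := lsize_le L; rewrite L5; lia.
set act' := [seq t <- [seq twalk L t | t <- root :: act] | ~~ is_Tip t].
have actP t : List.In t act' -> exists2 t0, t0 = root \/ List.In t0 act & t = twalk L t0.
  move=> /(@In_filter_map _ _ (fun t => ~~ is_Tip t) (twalk L)) [t0 ht0 ->].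
  by exists t0 => //; case: ht0 => [->|]; [left|right].
have lift t0 v : has_prefix (twalk L t0) v -> has_prefix t0 (L :: v).
  by move=> [c [y [T [-> tc]]]]; exists (L :: c), y, T; rewrite /= tget_cat.
have done_ t0 : t0 = root \/ List.In t0 act -> has_prefix t0 (L :: w) ->
    [\/ L :: w \in irreducibles letters_by_size root d.+1 r act, reducible root (L :: w) |
       exists2 t, List.In t act & has_prefix t (L :: w)].
  move=> [-> hp|ht hp]; first by constructor 2; exists [::], (L :: w).
  by constructor 3; exists t0.
case E: (has has_val act').
  have [t ta ht] : exists2 t, List.In t act' & has_val t.
    elim: (act') E => //= t s IHs /orP[ht|/IHs[t' ht' vt']]; first by exists t; [left|].
    by exists t'; [right|].
  have [t0 ht0 tE] := actP t ta; apply: (done_ t0 ht0); apply: lift; rewrite -tE.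
  move: ht; rewrite /has_val; case Et: (trie_val t) => [T|] // _.
  by exists [::], w, T.
have rE : (r - lsize L)./2 = wdeg w by rewrite -dw addKn doubleK.
case: (IHd (wdeg w) act' w ww sw erefl) => [win|[x [v [-> hv]]]|[t ta ht]].
- constructor 1; rewrite irreduciblesS; apply/flatten_mapP; exists (lsize L, gr) => //.
  rewrite [_.1]/= -dw oddD odd_double addbF eqxx leq_addr /=.
  by apply/flatten_mapP; exists L => //; rewrite -/act' E addKn doubleK map_f.
- by constructor 2; exists (L :: x), v.
- by have [t0 ht0 tE] := actP t ta; apply: (done_ t0 ht0); apply: lift; rewrite -tE.
Qed.

(** * A well-founded measure on words *)

Fixpoint val8 (a : seq nat) : nat :=
  if a is x :: a' then (x * 8 ^ size a' + val8 a')%N else 0%N.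

Lemma val8_lt a : all (fun x => x < 8)%N a -> (val8 a < 8 ^ size a)%N.
Proof.
elim: a => //= x a IHa /andP[x8 /IHa va]; rewrite expnS.
move: (8 ^ size a)%N va => m va; nia.
Qed.

Lemma val8_cmp a b : all (fun x => x < 8)%N a -> size a = size b ->
  cmp_lex a b = Lt -> (val8 a < val8 b)%N.
Proof.
elim: a b => [|x a IHa] [|y b] //= /andP[x8 a8] [sab].
have := cmp_natP x y; case: cmp_nat => // [-> /IHa|lt_xy _]; rewrite -sab.
  by move=> h; rewrite ltn_add2l h.
have := val8_lt a8; move: (8 ^ size a)%N => m va; nia.
Qed.

Definition bitsn (w : word) := map nat_of_bool (flatten w).

(** Weight first, then the order of the letters, encoded as the digits of one
    number in base 8: the entries are at most 5. This allows an induction on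
    natural numbers. *)
Definition mu w := val8 (weight w ++ bitsn w).

Lemma size_bitsn w : wf w -> size (bitsn w) = (5 * size w)%N.
Proof.
rewrite size_map; elim: w => //= L w IHw /andP[/eqP L5 /IHw].
by rewrite size_cat L5 => ->; lia.
Qed.

Lemma mu_lt8 w : wf w -> all (fun x => x < 8)%N (weight w ++ bitsn w).
Proof.
move=> ww; rewrite all_cat all_map; apply/andP; split.
  by apply: sub_all ww => L /eqP L5 /=; have := lsize_le L; rewrite L5; lia.
by rewrite all_map; apply/allP => -[].
Qed.

Lemma mu_weight w w' : wf w -> wf w' -> size w = size w' ->
  cmp_lex (weight w) (weight w') = Lt -> (mu w < mu w')%N.
Proof.
move=> h h' s c; apply: val8_cmp; first exact: mu_lt8.
  by rewrite !size_cat !size_bitsn // !size_map s.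
exact: cmp_lex_cat_Lt.
Qed.

Lemma cmp_letter_Lt u v : size u = size v ->
  cmp_letter u v = cmp_lex (map nat_of_bool u) (map nat_of_bool v).
Proof. by elim: u v => [|[] u IHu] [|[] v] //= [/IHu]. Qed.

Lemma cmp_word_bitsn u v : wf u -> wf v -> size u = size v ->
  cmp_word u v = cmp_lex (bitsn u) (bitsn v).
Proof.
elim: u v => [|L u IHu] [|M v] //= /andP[/eqP L5 wu] /andP[/eqP M5 wv] [s].
rewrite /bitsn /= !map_cat cmp_lex_cat ?size_map ?L5 ?M5 //.
by rewrite IHu // cmp_letter_Lt ?L5 ?M5.
Qed.

Lemma mu_context x y u c : wf (x ++ u ++ y) -> wf (x ++ c ++ y) ->
  weight u = weight c -> cmp_word u c = Lt -> (mu (x ++ u ++ y) < mu (x ++ c ++ y))%N.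
Proof.
rewrite !wf_cat => /and3P[wx wu wy] /and3P[_ wc _] E lt_uc.
have s : size u = size c by rewrite -(size_map lsize u) -/(weight u) E size_map.
apply: val8_cmp; first by apply: mu_lt8; rewrite !wf_cat wx wu.
  by rewrite !size_cat !size_bitsn ?wf_cat ?wx ?wu ?wc // !size_map !size_cat s.
rewrite /weight !map_cat -!/(weight _) E cmp_lex_cat // cmp_lex_refl.
rewrite /bitsn !flatten_cat !map_cat -!/(bitsn _) cmp_lex_cat // cmp_lex_refl.
by apply: cmp_lex_cat_Lt; rewrite -cmp_word_bitsn.
Qed.

(** * The irreducible words span *)

Lemma F2_cases (c : 'F_2) : c = 0 \/ c = 1.
Proof. by case: c => [[|[|//]] i]; [left | right]; apply/val_inj. Qed.

(** Squares are homogeneous, so the homogeneous components of a hit polynomial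
    are hit. *)
Lemma hit_pihomog d (f : P5) : hit f -> hit (pihomog mdeg d f).
Proof.
case/hit_Sq_sum => s s_pos ->; rewrite linear_sum.
apply: hit_sum => -[k h] /(allP s_pos) /= k_pos.
rewrite [h]mpolyE Sq_sum linear_sum; apply: hit_sum => m _.
rewrite !linearZ /=; apply/hit_predP/rpredZ/hit_predP.
have hm : ('X_[m] : P5) \is (mdeg m).-homog by rewrite dhomogX /=.
have [<-|ne] := eqVneq (mdeg m + k)%N d.
  by rewrite pihomog_dE ?Sq_homog //; apply: hit_Sq.
by rewrite (pihomog_ne0 ne) ?Sq_homog //; apply: hit0.
Qed.

Lemma lsize_sum L : size L = 5 -> lsize L = (\sum_(i < 5) nth false L i)%N.
Proof.
case: L => [|a [|b [|c [|d [|e [|]]]]]] // _.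
by rewrite !big_ord_recl big_ord0 /=; case: a b c d e => [] [] [] [] [].
Qed.

Lemma monomial_homog (e : 'I_5 -> nat) :
  (\prod_(i < 5) ('X_i : P5) ^+ e i) \is (\sum_(i < 5) e i)%N.-homog.
Proof.
elim/big_rec2: _ => [|i d p _ hp]; first exact: dhomog1.
by apply: dhomogM => //; rewrite mpolyXn dhomogX /= mdegMn mdeg1 mul1n.
Qed.

Lemma dhomogXn (f : P5) d k : f \is d.-homog -> f ^+ k \is (d * k)%N.-homog.
Proof.
move=> hf; elim: k => [|k IHk]; first by rewrite muln0 expr0 dhomog1.
by rewrite mulnS exprS dhomogM.
Qed.

Lemma wpoly_homog w : wf w -> wpoly w \is (wdeg w).-homog.
Proof.
elim: w => [|L w IHw] /=; first by rewrite dhomog1.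
case/andP=> /eqP L5 /IHw hw; apply: dhomogM.
  by rewrite lsize_sum //; apply: monomial_homog.
by rewrite -muln2; apply: dhomogXn.
Qed.

Definition exps (m : 'X_{1..5}) : seq N := [seq bin_of_nat (m i) | i <- enum 'I_5].

Lemma size_exps m : size (exps m) = 5.
Proof. by rewrite size_map size_enum_ord. Qed.

Lemma mon_exps m : mon (exps m) = 'X_[m].
Proof.
rewrite mpolyXE_id; apply: eq_bigr => i _; congr (_ ^+ _).
by rewrite (nth_map i) ?size_enum_ord // nth_ord_enum bin_of_natK.
Qed.

Section Spanning.
Variables (d : nat) (B : seq word).

Definition in_span (f : P5) := exists2 s : seq word, {subset s <= B} & hit (f - wsum s).

Lemma in_span_hit f : hit f -> in_span f.
Proof. by exists [::] => //; rewrite /wsum big_nil subr0. Qed.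

Lemma in_spanD f g : in_span f -> in_span g -> in_span (f + g).
Proof.
move=> [s sB hs] [t tB ht]; exists (s ++ t).
  by move=> w; rewrite mem_cat => /orP[/sB|/tB].
by rewrite /wsum big_cat opprD addrACA; apply: hitD.
Qed.

Lemma in_span_sum (I : eqType) (s : seq I) (F : I -> P5) :
  (forall i, i \in s -> in_span (F i)) -> in_span (\sum_(i <- s) F i).
Proof.
move=> hF; rewrite big_seq; elim/big_ind: _ => //; last exact: in_spanD.
exact/in_span_hit/hit0.
Qed.

Lemma in_spanZ (c : 'F_2) f : in_span f -> in_span (c *: f).
Proof.
case: (F2_cases c) => -> hf; last by rewrite scale1r.
by rewrite scale0r; apply/in_span_hit/hit0.
Qed.

Lemma pow2_sum (I : Type) (s : seq I) (F : I -> P5) k :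
  (\sum_(i <- s) F i) ^+ (2 ^ k) = \sum_(i <- s) F i ^+ (2 ^ k).
Proof. by elim: k => [|k IHk]; rewrite ?expn0 // expnSr exprM IHk sqrp_sum;
  apply: eq_bigr => i _; rewrite -exprM. Qed.

Lemma F2_exp (c : 'F_2) k : c ^+ (2 ^ k) = c.
Proof. by elim: k => [|k IHk] //; rewrite expnSr exprM IHk F2_sqr. Qed.

(** A monomial of degree below [2^6] has only 6 letters. The terms of other
    degrees vanish under the projection to degree [d]. *)
Lemma in_span_monomial u m : wf u -> (size u <= 6)%N -> (d < 2 ^ 6)%N ->
  (forall v, wf (u ++ v) -> size (u ++ v) = 6 -> wdeg (u ++ v) = d ->
     in_span (wpoly (u ++ v))) ->
  in_span (pihomog mdeg d (wpoly u * 'X_[m] ^+ (2 ^ size u))).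
Proof.
move=> wu su d_lt hw; have k6 := subnKC su.
rewrite -mon_exps (mon_bits (6 - size u)) exprMn mulrA -wpoly_cat -exprM -expnD.
rewrite [(_ - _ + _)%N]addnC k6; set v := (bits _ _).1; set h := (bits _ _).2.
have ww : wf (u ++ v) by rewrite wf_cat wu wf_bits // size_exps.
have w6 : size (u ++ v) = 6 by rewrite size_cat size_bits.
(* What remains after six letters is a 64th power, hence 1 in degree below 64. *)
have hw0 := dhomogM (wpoly_homog ww)
  (dhomogXn (2 ^ 6) (monomial_homog (fun i => nat_of_bin (nth N0 h i)))).
rewrite -/(mon h) in hw0.
set D := (\sum_(i < 5) nth N0 h i)%N in hw0.
have [E|ne] := eqVneq (wdeg (u ++ v) + D * 2 ^ 6)%N d; last first.
  by rewrite (pihomog_ne0 ne hw0); apply/in_span_hit/hit0.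
rewrite E in hw0; rewrite (pihomog_dE hw0).
have D0 : D = 0%N.
  by move: d_lt; rewrite -E; case: (D) => // D'; rewrite mulSn addnCA ltnNge leq_addr.
have -> : mon h = 1.
  rewrite /mon big1 // => i _; move/eqP: D0; rewrite /D sum_nat_eq0.
  by move=> /forallP/(_ i)/eqP /= ->.
by rewrite expr1n mulr1; apply: hw => //; rewrite -E D0 mul0n addn0.
Qed.

Lemma in_span_low be f : size be = 6 -> (d < 2 ^ 6)%N ->
  (forall w, wf w -> size w = 6 -> wdeg w = d -> cmp_lex (weight w) be = Lt ->
     in_span (wpoly w)) ->
  low be f -> in_span (pihomog mdeg d f).
Proof.
move=> be6 d_lt hw [s hs ->]; rewrite linear_sum; apply: in_span_sum => -[u g].
move=> /(allP hs) /and3P[/= wu su lu].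
rewrite [g]mpolyE pow2_sum mulr_sumr linear_sum; apply: in_span_sum => m _.
rewrite exprZn F2_exp -scalerAr linearZ /=; apply: in_spanZ.
apply: in_span_monomial => //; first by rewrite be6 in su.
move=> v wv v6 vd; apply: hw => //.
rewrite /weight map_cat -[be]cats0 cmp_lex_cat_Lt //.
by move: lu; rewrite /weight; case: cmp_lex.
Qed.

(** Induction on [mu]: a reducible word is replaced by words with the same weight
    that are smaller in the order of words, by words of smaller weight, and by a hit.
    The last two need not be homogeneous, whence the projections to degree [d]. *)
Lemma in_span_word t w : trie_ok t -> (d < 2 ^ 6)%N ->
  B = irreducibles letters_by_size t 6 d [::] ->
  wf w -> size w = 6 -> wdeg w = d -> in_span (wpoly w).
Proof.
move=> okt d_lt BE.
have [n] := ubnP (mu w); elim: n w => // n IHn w /ltnSE mu_w ww w6 wd.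
case: (irreduciblesP t [::] ww w6 wd) => [wB|[x [v [wE [c [y [T [vE tc]]]]]]]|[]] //.
  exists [:: w]; first by move=> w'; rewrite inE => /eqP ->; rewrite BE.
  by rewrite /wsum big_seq1 subrr; apply: hit0.
have wE' : w = x ++ c ++ y by rewrite wE vE.
move: (ww); rewrite wE' !wf_cat => /and3P[wx wc wy].
have [vT lT] := okt c T wc tc.
have weE : weight w = weight x ++ weight c ++ weight y by rewrite wE' /weight !map_cat.
have [aT hT] := valid_context wx wy vT; rewrite -weE in aT hT.
(* Here [q] is hit, and [w] plus the rewritten words plus [q] has smaller weight. *)
have := hT 1; rewrite expr1n mulr1 /wsum big_cons -wE' => -[q hq lq].
have w_homog := wpoly_homog ww; rewrite wd in w_homog.
have T_ok u : u \in T -> [/\ wf (x ++ u ++ y), size (x ++ u ++ y) = 6,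
    wdeg (x ++ u ++ y) = d & (mu (x ++ u ++ y) < mu w)%N].
  move=> uT; have uW : x ++ u ++ y \in [seq x ++ w' ++ y | w' <- c :: T].
    by apply/mapP; exists u; rewrite // inE uT orbT.
  have /andP[wu /eqP Eu] := allP aT _ uW.
  have /andP[wu0 /eqP Eu0] : wf u && (weight u == weight c).
    by have := allP vT.1 u; rewrite inE uT orbT; apply.
  have wdegE w1 w2 : weight w1 = weight w2 -> wdeg w1 = wdeg w2.
    by elim: w1 w2 => [|L1 w1 IH] [|L2 w2] //= [-> /IH ->].
  split=> //; first by rewrite -(size_map lsize) -/(weight _) Eu size_map.
    by rewrite -wd; apply: wdegE.
  rewrite wE'; apply: mu_context => //; first by rewrite -wE'.
  by have := allP lT u uT; case: cmp_word.
have -> : wpoly w = pihomog mdeg d (wpoly w + \sum_(j <- [seq x ++ w' ++ y | w' <- T]) wpoly j - q)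
    + pihomog mdeg d q + \sum_(j <- [seq x ++ w' ++ y | w' <- T]) wpoly j.
  have hs : \sum_(j <- [seq x ++ w' ++ y | w' <- T]) wpoly j \is d.-homog.
    rewrite big_map big_seq rpred_sum // => u /T_ok[wu _ ud _].
    by rewrite -[d]ud; apply: wpoly_homog.
  rewrite -linearD subrK linearD /= !pihomog_dE // -addrA addpp addr0 //.
apply: in_spanD; last first.
  rewrite big_map; apply: in_span_sum => u /T_ok[wu su ud lu].
  by apply: IHn => //; apply: leq_trans lu mu_w.
apply: in_spanD; last by apply/in_span_hit/hit_pihomog.
apply: (in_span_low (be := weight w)) => //; first by rewrite size_map.
move=> w' ww' w6' wd' lt_w'; apply: IHn => //; apply: leq_trans _ mu_w.
by apply: mu_weight => //; rewrite w6.
Qed.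

Lemma in_span_homog t f : trie_ok t -> (d < 2 ^ 6)%N ->
  B = irreducibles letters_by_size t 6 d [::] -> f \is d.-homog -> in_span f.
Proof.
move=> okt d_lt BE fd.
rewrite -(pihomog_dE fd) [f in pihomog _ _ f]mpolyE linear_sum.
apply: in_span_sum => m _; rewrite linearZ; apply: in_spanZ.
rewrite -['X_[m]]mul1r -['X_[m]]expr1; apply: (@in_span_monomial [::]) => //.
by move=> v wv v6 vd; apply: in_span_word BE wv v6 vd.
Qed.

End Spanning.

(** * Coefficients after a linear substitution *)

Definition lform (l : letter) : P5 := \sum_(j < 5) (nth false l j)%:R *: 'X_j.
Definition subst (A : word) (f : P5) : P5 :=
  f \mPo [tuple lform (nth [::] A i) | i < 5].

(** The exponents of the squarefree monomial of [L]. *)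
Definition lmnm (L : letter) : 'X_{1..5} := [multinom nth false L i : nat | i < 5].
Fixpoint wmnm (w : word) : 'X_{1..5} :=
  if w is L :: w' then (lmnm L + wmnm w' *+ 2)%MM else 0%MM.

(** The rows of [A] are the linear forms that are substituted for the variables.
    Over the field with two elements the sum of coefficients over [E] is an
    arbitrary functional of finite support. *)
Definition phi (E : seq word) (A : word) (f : P5) : 'F_2 :=
  \sum_(e <- E) (subst A f)@_(wmnm e).

Lemma phiD E A f g : phi E A (f + g) = phi E A f + phi E A g.
Proof.
by rewrite /phi -big_split; apply: eq_bigr => e _; rewrite /subst rmorphD /= mcoeffD.
Qed.

Lemma phiZ E A c f : phi E A (c *: f) = c * phi E A f.
Proof.
rewrite /phi mulr_sumr; apply: eq_bigr => e _.
by rewrite /subst comp_mpolyZ mcoeffZ.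
Qed.

Lemma phi0 E A : phi E A 0 = 0.
Proof. by rewrite -[0 in LHS](scale0r 0) phiZ mul0r. Qed.

Lemma phi_sum E A (I : Type) (s : seq I) (F : I -> P5) :
  phi E A (\sum_(i <- s) F i) = \sum_(i <- s) phi E A (F i).
Proof.
by elim: s => [|i s IHs]; rewrite ?big_nil ?phi0 // !big_cons phiD IHs.
Qed.

Lemma mcoeffXM (u m : 'X_{1..5}) (G : P5) :
  ('X_[u] * G)@_m = if (u <= m)%MM then G@_(m - u) else 0.
Proof.
case: ifP => [le_um|nle].
  by rewrite mulrC -{1}(submK le_um) addmC mcoeffMX.
rewrite [G]mpolyE mulr_sumr raddf_sum big1 //= => k _.
rewrite -scalerAr mcoeffZ -mpolyXD mcoeffX.
case: eqP => [E|_]; last by rewrite mulr0.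
by move: nle; rewrite -E lem_addr.
Qed.

Lemma lform_homog l : lform l \is 1.-homog.
Proof. by rewrite rpred_sum // => i _; rewrite rpredZ // dhomogX /= mdeg1. Qed.

Lemma prod_lform_homog rs : \prod_(l <- rs) lform l \is (size rs).-homog.
Proof.
elim: rs => [|l rs IH]; first by rewrite big_nil dhomog1.
by rewrite big_cons -[size _]add1n dhomogM // lform_homog.
Qed.

Lemma has_nth (T : letter) : has id T = [exists j : 'I_(size T), nth false T j].
Proof.
apply/(has_nthP false)/existsP => [[j jT Tj]|[j Tj]]; first by exists (Ordinal jT).
by exists j.
Qed.

(** The coefficient of a squarefree monomial in a product of linear forms is a
    permanent; modulo 2 this is a determinant. *)
Lemma minorP rs T : size T = 5 ->
  (\prod_(l <- rs) lform l)@_(lmnm T) = (minor rs T)%:R.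
Proof.
elim: rs T => [|l rs IHrs] T T5 /=.
  rewrite big_nil mcoeff1; congr ((nat_of_bool _)%:R); apply/idP/idP => [/eqP/mnmP E|].
    rewrite has_nth; apply/existsP => -[j Tj]; have j5 : (j < 5)%N by have := ltn_ord j; lia.
    by have := E (Ordinal j5); rewrite mnmE mnm0E /= Tj.
  move=> nT; apply/eqP/mnmP => j; rewrite mnmE mnm0E.
  case Tj: (nth _ _ _) => //; case/negP: nT; apply/(has_nthP false).
  by exists j => //; rewrite T5.
rewrite big_cons /lform mulr_suml raddf_sum /=.
transitivity (\sum_(j <- iota 0 5) (nth false l j && nth false T j &&
    minor rs (set_nth false T j false))%:R : 'F_2).
  rewrite -[iota 0 5]/(index_iota 0 5) big_mkord; apply: eq_bigr => j _.
  rewrite -scalerAl mcoeffZ mcoeffXM.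
  case: (nth false l j) => /=; last by rewrite mul0r.
  rewrite mul1r.
  have -> : (U_(j) <= lmnm T)%MM = nth false T j.
    apply/mnm_lepP/idP => [/(_ j)|Tj i]; rewrite !mnmE ?eqxx /=; first by case: nth.
    by case: eqP => [<-|//]; rewrite Tj.
  case Tj: (nth false T j) => //=.
  rewrite -IHrs ?size_set_nth ?T5 ?(maxn_idPr (ltn_ord j)) //; congr (_@__).
  apply/mnmP => i; rewrite !mnmE nth_set_nth /= [(i == j :> nat)]eq_sym -val_eqE /=.
  by case: eqP => [<-|_]; rewrite ?Tj ?subn0.
rewrite T5; elim: (iota 0 5) => [|j s IHs]; first by rewrite big_nil.
rewrite big_cons IHs /=; case: (nth false l j) => /=; last by rewrite add0r.
case: (nth false T j) => /=; last by rewrite add0r.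
case: (minor rs _) => /=; last by rewrite add0r.
by case: (foldr _ _ _); apply/val_inj.
Qed.

Lemma prod_mask A L : size A = size L ->
  \prod_(i < size L) lform (nth [::] A i) ^+ nth false L i =
  \prod_(l <- mask L A) lform l.
Proof.
elim: A L => [|a A IHA] [|b L] //= => [_|[/IHA E]]; first by rewrite big_ord0 big_nil.
rewrite big_ord_recl /=.
transitivity (lform a ^+ b * \prod_(i < size L) lform (nth [::] A i) ^+ nth false L i).
  by [].
by rewrite E; case: b; rewrite ?big_cons ?mul1r.
Qed.

Lemma subst_lpoly A L : size A = 5 -> size L = 5 ->
  subst A (lpoly L) = \prod_(l <- mask L A) lform l.
Proof.
move=> A5 L5; rewrite /subst /lpoly rmorph_prod /= -prod_mask ?A5 ?L5 //.
apply: eq_bigr => i _; rewrite rmorphXn /= comp_mpolyXU; congr (_ ^+ _).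
by rewrite -tnth_nth tnth_mktuple.
Qed.

Lemma size_mask_lsize L (A : word) : size A = size L -> size (mask L A) = lsize L.
Proof. by elim: A L => [|a A IHA] [|[] L] //= [/IHA ->]. Qed.

Lemma mdeg_lmnm T : size T = 5 -> mdeg (lmnm T) = lsize T.
Proof.
by move=> T5; rewrite mdegE lsize_sum //; apply: eq_bigr => i _; rewrite mnmE.
Qed.

(** Let a monomial of [Q] and the square of a monomial of [F] have product
    [x^T m^2]. The exponents of the former are odd on [T], so its degree is at
    least [|T|]; as [d <= |T|] it is [x^T]. *)
Lemma mcoeff_mul_sqr (Q F : P5) d T m : Q \is d.-homog -> size T = 5 ->
  (d <= lsize T)%N -> (Q * F ^+ 2)@_(lmnm T + m *+ 2) = Q@_(lmnm T) * F@_m.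
Proof.
move=> /dhomogP hQ T5 dT.
have split_mnm (k l : 'X_{1..5}) : mdeg k = d ->
    ((k + l *+ 2)%MM == (lmnm T + m *+ 2)%MM) = (k == lmnm T) && (l == m).
  move=> ka; apply/eqP/andP => [E|[/eqP -> /eqP ->]] //.
  have Ei i : (k i + l i * 2 = nth false T i + m i * 2)%N.
    by have /mnmP/(_ i) := E; rewrite !(mnmDE, mulmnE) mnmE.
  have ge (i : 'I_5) : (nth false T i <= k i)%N.
    by have := Ei i; case: (nth false T i) => /=; lia.
  have kT : k = lmnm T.
    apply/mnmP => i; rewrite mnmE; apply/eqP; rewrite eqn_leq ge andbT leqNgt.
    apply/negP => lt_i; have : (mdeg (lmnm T) < mdeg k)%N.
      rewrite !mdegE (bigD1 i) //= [X in (_ < X)%N](bigD1 i) //= mnmE.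
      by rewrite -addSn leq_add // leq_sum // => j _; rewrite mnmE.
    by rewrite mdeg_lmnm // ka ltnNge dT.
  split; first by rewrite kT.
  by apply/eqP/mnmP => i; have := Ei i; rewrite kT mnmE; move: (nat_of_bool _) => ?; lia.
rewrite {1}[Q]mpolyE {1}[F]mpolyE sqrp_sum mulr_suml raddf_sum /=.
transitivity (\sum_(k <- msupp Q) \sum_(l <- msupp F)
    Q@_k * F@_l * ((k == lmnm T) && (l == m))%:R).
  rewrite big_seq [RHS]big_seq; apply: eq_bigr => k kQ.
  rewrite mulr_sumr raddf_sum /=; apply: eq_bigr => l _.
  rewrite exprZn F2_sqr mpolyXn -scalerAl -scalerAr !mcoeffZ -mpolyXD mcoeffX.
  by rewrite split_mnm ?mulrA //; apply: hQ.
have delta (G : P5) n : G@_n = \sum_(k <- msupp G) G@_k * (k == n)%:R.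
  by rewrite {1}[G]mpolyE raddf_sum; apply: eq_bigr => k _; rewrite /= mcoeffZ mcoeffX.
rewrite [Q@_(lmnm T)]delta [F@_m]delta mulr_suml; apply: eq_bigr => k _.
rewrite mulr_sumr; apply: eq_bigr => l _.
by rewrite -mulnb natrM mulrACA.
Qed.

Lemma substM A f g : subst A (f * g) = subst A f * subst A g.
Proof. by rewrite /subst rmorphM. Qed.
Lemma substXn A f k : subst A (f ^+ k) = subst A f ^+ k.
Proof. by rewrite /subst rmorphXn. Qed.
Lemma subst1 A : subst A 1 = 1.
Proof. by rewrite /subst rmorph1. Qed.

(** For [L] smaller than [T] both sides are 0; this is how a smaller weight makes
    a coefficient vanish. *)
Lemma mcoeff_subst_cons A L w T e : wf A -> size A = 5 ->
  size L = 5 -> size T = 5 -> (lsize L <= lsize T)%N ->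
  (subst A (wpoly (L :: w)))@_(wmnm (T :: e)) =
  (level_value A T L)%:R * (subst A (wpoly w))@_(wmnm e).
Proof.
move=> wA A5 L5 T5 le_LT; rewrite /= substM substXn subst_lpoly //.
have hQ := prod_lform_homog (mask L A).
rewrite size_mask_lsize ?A5 ?L5 // in hQ.
rewrite (mcoeff_mul_sqr _ _ hQ) //; congr (_ * _).
rewrite /level_value eqnE; case: eqP => [_|ne]; first exact: minorP.
by rewrite (dhomog_nemf_coeff hQ) //= mdeg_lmnm // eq_sym; apply/eqP.
Qed.

Lemma mcoeff_subst_lt A w e : wf A -> size A = 5 -> wf w -> wf e ->
  cmp_lex (weight w) (weight e) = Lt -> (subst A (wpoly w))@_(wmnm e) = 0.
Proof.
move=> wA A5; elim: w e => [|L w IHw] [|T e] // /andP[/eqP L5 ww] /andP[/eqP T5 we].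
rewrite [cmp_lex _ _]/=; have := cmp_natP (lsize L) (lsize T).
case: cmp_nat => // [E /(IHw _ ww we) h|lt_LT _]; rewrite mcoeff_subst_cons ?E //.
- by rewrite h mulr0.
- by rewrite /level_value eqnE ltn_eqF // mul0r.
- exact: ltnW.
Qed.

Lemma lookup_tabulate n f L : size L = n -> lookup (tabulate n f) L = f L.
Proof.
elim: n f L => [|n IHn] f [|b L] //= [Ln].
by case: b; rewrite IHn.
Qed.

Lemma mcoeff_subst_eq A w e : wf A -> size A = 5 -> wf w -> wf e ->
  weight w = weight e ->
  (subst A (wpoly w))@_(wmnm e) =
  (all_levels [seq tabulate 5 (level_value A T) | T <- e] w)%:R.
Proof.
move=> wA A5; elim: w e => [|L w IHw] [|T e] //.
  by rewrite /= subst1 mcoeff1 eqxx.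
case/andP=> /eqP L5 ww /andP[/eqP T5 we] [ELT Ewe].
rewrite mcoeff_subst_cons ?ELT // IHw //.
rewrite (_ : all_levels _ (L :: w) = if lookup (tabulate 5 (level_value A T)) L then
  all_levels [seq tabulate 5 (level_value A T) | T <- e] w else false) //.
by rewrite lookup_tabulate //; case: level_value; rewrite ?mul1r ?mul0r.
Qed.

(** * Values of functionals on words *)

Lemma F2_nat n : n%:R = (odd n)%:R :> 'F_2.
Proof.
elim: n => // n IHn; rewrite -[n.+1]addn1 natrD IHn oddD.
by case: (odd n); apply/val_inj.
Qed.

Lemma F2_addb (a b : bool) : (a (+) b)%:R = a%:R + b%:R :> 'F_2.
Proof. by case: a b => [] []; apply/val_inj. Qed.

Lemma F2_bool (a b : bool) : a%:R = b%:R :> 'F_2 -> a = b.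
Proof. by case: a b => [] []. Qed.

Lemma cmp_nat_sym a b : cmp_nat a b = CompOpp (cmp_nat b a).
Proof. by elim: a b => [|a IHa] [|b] //=. Qed.

Lemma cmp_lex_sym a b : cmp_lex a b = CompOpp (cmp_lex b a).
Proof.
elim: a b => [|x a IHa] [|y b] //=.
by rewrite cmp_nat_sym IHa; case: cmp_nat.
Qed.

Lemma phi_lt E A w : wf A -> size A = 5 -> wf w -> all wf E ->
  all (fun e => is_Lt (cmp_lex (weight w) (weight e))) E -> phi E A (wpoly w) = 0.
Proof.
move=> wA A5 ww /allP wE /allP lE; rewrite /phi big_seq big1 // => e eE.
apply: mcoeff_subst_lt => //; first exact: wE.
by have := lE e eE; case: cmp_lex.
Qed.

(** The elements of [E] that have weight above [al] contribute nothing. *)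
Lemma phi_values E A al ws j : wf A -> size A = 5 ->
  all wf E -> all (fun e => size e == size al) E ->
  all (fun e => ~~ is_Lt (cmp_lex (weight e) al)) E ->
  all (fun w => wf w && (weight w == al)) ws -> (j < size ws)%N ->
  phi E A (wpoly (nth [::] ws j)) =
  (nth false (values [seq e <- E | is_Eq (cmp_lex (weight e) al)] A ws) j)%:R.
Proof.
move=> wA A5 wE sE gE wws jws; rewrite /values (nth_map [::]) //.
set w := nth _ _ _.
have /andP[ww /eqP wal] : wf w && (weight w == al) by apply: (allP wws); apply: mem_nth.
elim: E wE sE gE => [|e E IHE] /=; first by rewrite /phi big_nil.
case/andP=> we wE /andP[/eqP se sE] /andP[ge gE].
have {}IHE := IHE wE sE gE.
rewrite /phi big_cons -/(phi E A (wpoly w)) IHE.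
case Ec: (cmp_lex (weight e) al) ge => //= _.
  have eal : weight e = al by apply: cmp_lex_Eq; rewrite ?size_map.
  rewrite mcoeff_subst_eq ?eal // -F2_addb; congr ((nat_of_bool _)%:R).
  by case: (all_levels _ _).
rewrite mcoeff_subst_lt ?add0r // wal cmp_lex_sym Ec //.
Qed.

(** * Sums of coefficients that vanish on hits *)

Definition emnm (h : seq N) : 'X_{1..5} := [multinom nat_of_bin (nth N0 h i) | i < 5].

Lemma mon_emnm h : mon h = 'X_[emnm h].
Proof. by rewrite mpolyXE_id; apply: eq_bigr => i _; rewrite mnmE. Qed.

Lemma nat_of_bin_inj : injective nat_of_bin.
Proof. exact: (can_inj nat_of_binK). Qed.

Lemma emnm_eq h h' : size h = 5 -> size h' = 5 -> (emnm h == emnm h') = (h == h').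
Proof.
move=> s s'; apply/eqP/eqP => [/mnmP E|-> //].
apply: (@eq_from_nth _ N0); rewrite s ?s' // => i i5.
by have := E (Ordinal i5); rewrite !mnmE => /nat_of_bin_inj.
Qed.

Lemma size_word_exps e : wf e -> size (word_exps e) = 5.
Proof.
elim: e => //= L e IHe /andP[/eqP L5 /IHe s].
by rewrite size_map size_zip L5 s.
Qed.

(** The exponents of a word are recovered from its binary digits. *)
Lemma wmnmE e : wf e -> wmnm e = emnm (word_exps e).
Proof.
elim: e => [|L e IHe] /=.
  by move=> _; apply/mnmP => -[i i5]; rewrite mnm0E mnmE; case: i i5 => [|[|[|[|[|]]]]].
case/andP=> /eqP L5 we; have s := size_word_exps we.
rewrite (IHe we); apply/mnmP => i; rewrite mnmDE mulmnE !mnmE.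
rewrite (nth_map (false, N0)) ?size_zip ?L5 ?s // nth_zip ?L5 ?s //=.
by case: nth; rewrite ?nat_of_succ_double ?nat_of_double; lia.
Qed.

Fixpoint all_terms (b : seq N) : seq (seq N) :=
  if b is a :: b' then [seq z.2 :: m | z <- sq_var a, m <- all_terms b'] else [:: [::]].

Lemma all_termsE (x : nat -> P5) b :
  \prod_(i < size b) (\sum_(z <- sq_var (nth N0 b i)) x i ^+ z.2) =
  \sum_(m <- all_terms b) \prod_(i < size b) x i ^+ nth N0 m i.
Proof.
elim: b x => [|a b IHb] x /=; first by rewrite big_seq1 !big_ord0.
rewrite big_ord_recl big_allpairs_dep /= mulr_suml; apply: eq_bigr => z _.
transitivity (x 0%N ^+ z.2 * \prod_(i < size b)
   (\sum_(z <- sq_var (nth N0 b i)) x i.+1 ^+ z.2)); first by [].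
rewrite (IHb (fun i => x i.+1)) mulr_sumr; apply: eq_bigr => m _.
by rewrite big_ord_recl.
Qed.

Lemma size_all_terms b m : m \in all_terms b -> size m = size b.
Proof.
elim: b m => [|a b IHb] m /=; first by rewrite inE => /eqP ->.
by case/allpairsP => -[z m'] /= [_ /IHb E ->] /=; rewrite E.
Qed.

Lemma odd_count_all_terms b e : size b = size e ->
  odd (count_mem e (all_terms b)) = coef_exps b e.
Proof.
elim: b e => [|a b IHb] [|y e] //= [/IHb <-].
rewrite /coef_var; set c := count_mem e _.
transitivity (odd (count (fun x => N.eqb x.2 y) (sq_var a) * c)); last first.
  by rewrite oddM; case: (odd (count _ _)).
congr odd; elim: (sq_var a) => [|z s IHs] //=; rewrite count_cat IHs mulnDl.
congr (_ + _)%N; rewrite count_map /preim /=.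
case Ez: (N.eqb z.2 y) => /=.
  rewrite mul1n; apply: eq_count => m /=.
  by rewrite eqseq_cons; move/N.eqb_eq: Ez => ->; rewrite eqxx.
rewrite mul0n; apply/eqP; rewrite -leqn0 leqNgt -has_count; apply/hasPn => m _ /=.
by rewrite eqseq_cons; case: eqP => // Ezy; rewrite Ezy N.eqb_refl in Ez.
Qed.

(** At [t = 1] the generating function of the squares becomes the total square, a
    ring morphism, which needs no bookkeeping of degrees. *)
Lemma Sq_total b : size b = 5 ->
  (Sq_gen (mon b)).[1] = \sum_(m <- all_terms b) mon m.
Proof.
move=> b5; pose x i : P5 := 'X_(inord i).
have xE (i : 'I_5) : x i = 'X_i by rewrite /x inord_val.
transitivity (\sum_(m <- all_terms b) \prod_(i < size b) x i ^+ nth N0 m i); last first.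
  by apply: eq_bigr => m _; rewrite b5; apply: eq_bigr => i _; rewrite xE.
rewrite -all_termsE b5 /mon Sq_gen_prod horner_prod; apply: eq_bigr => i _.
rewrite Sq_genXn Sq_gen_X xE.
transitivity ((\sum_(z <- sq_var (nth N0 b i)) (('X_i : P5) ^+ z.2)%:P * 'X^(z.1)).[1]).
  by congr (_.[_]); exact: sq_varE.
rewrite horner_sum; apply: eq_bigr => z _.
by rewrite hornerM hornerC hornerXn expr1n mulr1.
Qed.

Lemma Sq_total_coef b e : size b = 5 -> wf e ->
  ((Sq_gen (mon b)).[1])@_(wmnm e) = (coef_exps b (word_exps e))%:R.
Proof.
move=> b5 we; rewrite Sq_total // wmnmE // raddf_sum /=.
rewrite -odd_count_all_terms ?b5 ?size_word_exps // -F2_nat -sum1_count natr_sum [in RHS]big_mkcond.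
apply: eq_big_seq => m /size_all_terms sm /=.
rewrite mon_emnm mcoeffX emnm_eq ?size_word_exps ?sm ?b5 //.
by rewrite eq_sym; case: eqP.
Qed.

(** The degrees of the monomials determine which [Sq^k] contributes to a
    coefficient of the total square. *)
Lemma Sq_coef_total (m n : 'X_{1..5}) k : (mdeg m + k = mdeg n)%N ->
  (Sq k ('X_[m] : P5))@_n = ((Sq_gen ('X_[m] : P5)).[1])@_n.
Proof.
move=> E; set p := Sq_gen _.
rewrite (@horner_coef_wide _ (maxn (size p) k.+1)) ?leq_maxl // raddf_sum /=.
have kN : (k < maxn (size p) k.+1)%N by rewrite leq_maxr.
rewrite (bigD1 (Ordinal kN)) //= expr1n mulr1 big1 ?addr0 // => i ne_ik.
rewrite expr1n mulr1 -/(Sq i _).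
have hm : ('X_[m] : P5) \is (mdeg m).-homog by rewrite dhomogX /=.
rewrite (dhomog_nemf_coeff (Sq_homog i hm)) //= -E eqn_add2l eq_sym.
by apply: contra ne_ik => /eqP ik; apply/eqP/val_inj.
Qed.

Lemma sq_pos_ge p z : z \in sq_pos p -> (nat_of_pos p <= z.2)%N.
Proof.
elim: p z => [p IHp|p IHp|] z /=.
- case/flatten_mapP => y /IHp le_py; rewrite !inE NatTrec.doubleE => /orP[] /eqP -> /=.
    by rewrite nat_of_succ_double ltnS leq_double.
  by rewrite nat_of_double nat_of_succ doubleS !ltnS leqW // leq_double.
- by case/mapP => y /IHp le_py ->; rewrite /= NatTrec.doubleE nat_of_double leq_double.
- by rewrite !inE => /orP[] /eqP ->.
Qed.

Lemma coef_var_le b y : coef_var b y -> (b <= y)%N.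
Proof.
rewrite /coef_var => h; have : has (fun x => N.eqb x.2 y) (sq_var b).
  by rewrite has_count; move: h; case: count.
case/hasP => z zb /N.eqb_eq <-; case: b zb {h} => [|p] //=; exact: sq_pos_ge.
Qed.

Lemma mem_sources b e : size b = size e -> coef_exps b e -> b \in sources e.
Proof.
elim: b e => [|x b IHb] [|y e] // [/IHb IH].
rewrite [coef_exps _ _]/=; case: ifP => // cxy /IH be.
rewrite (_ : sources _ = flatten [seq [seq z :: b | b <- sources e]
  | z <- [seq b <- [seq N.of_nat i | i <- iota 0 (N.to_nat y).+1] | coef_var b y]]) //.
apply/flatten_mapP; exists x; last exact: map_f.
rewrite mem_filter cxy; apply/mapP; exists (nat_of_bin x).
  by rewrite mem_iota /= ltnS -nat_of_binE coef_var_le.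
by rewrite nat_of_binE N2Nat.id.
Qed.

Lemma exps_degreeE h : size h = 5 -> nat_of_bin (exps_degree h) = mdeg (emnm h).
Proof.
case: h => [|a [|b [|c [|d [|e [|]]]]]] // _.
rewrite mdegE !big_ord_recl big_ord0 !mnmE /exps_degree /= !nat_of_binE.
by rewrite !N2Nat.inj_add; lia.
Qed.

Lemma exps_emnm m : emnm (exps m) = m.
Proof. by apply/mnmP => i; rewrite mnmE (nth_map i) ?size_enum_ord // nth_ord_enum bin_of_natK. Qed.

(** For a monomial [g] the sum counts modulo 2 the elements of [E] in the total
    square of [g], and only monomials among the [sources] can reach [E]. *)
Lemma annihilatedP D E k g : all wf E -> annihilated D E -> (0 < k)%N ->
  \sum_(e <- E) (Sq k g)@_(wmnm e) = 0.
Proof.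
move=> /allP wE /andP[/allP dE /allP srcE] k_gt0.
have dE' e : e \in E -> mdeg (wmnm e) = D.
  move=> eE; have /andP[/eqP s /N.eqb_eq <-] := dE _ (map_f word_exps eE).
  by rewrite exps_degreeE // wmnmE // wE.
have SM m : \sum_(e <- E) (Sq k ('X_[m] : P5))@_(wmnm e) = 0.
  have hm : ('X_[m] : P5) \is (mdeg m).-homog by rewrite dhomogX /=.
  have [Ed|ne] := eqVneq (mdeg m + k)%N D; last first.
    rewrite big_seq big1 // => e eE; rewrite (dhomog_nemf_coeff (Sq_homog k hm)) //=.
    by rewrite dE' // eq_sym.
  pose b := exps m; have b5 : size b = 5 := size_exps m.
  transitivity (\sum_(e <- E) (coef_exps b (word_exps e))%:R : 'F_2).
    apply: eq_big_seq => e eE; rewrite Sq_coef_total ?dE' //.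
    by rewrite -mon_exps Sq_total_coef // wE.
  have -> : \sum_(e <- E) (coef_exps b (word_exps e))%:R =
      (count (coef_exps b) (map word_exps E))%:R :> 'F_2.
    rewrite -natr_sum -sum1_count big_map [in RHS]big_mkcond /=.
    by congr (_%:R); apply: eq_bigr => e _; case: coef_exps.
  rewrite F2_nat; have [b_src|b_nsrc] := boolP (b \in flatten (map sources (map word_exps E))).
    have := srcE _ b_src; rewrite /N.ltb.
    have -> : N.compare (exps_degree b) D = Lt.
      apply/N.compare_lt_iff; have := exps_degreeE b5.
      by rewrite exps_emnm !nat_of_binE => dm; move: Ed; rewrite -dm nat_of_binE; lia.
    by move/negbTE => ->.
  rewrite (_ : count _ _ = 0%N) //; apply/eqP; rewrite -leqn0 leqNgt -has_count.
  apply: contra b_nsrc => /hasP[e' /mapP[e eE ->] be].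
  apply/flatten_mapP; exists (word_exps e); first exact: map_f.
  by apply: mem_sources; rewrite // b5 size_word_exps // wE.
transitivity (\sum_(e <- E) \sum_(m <- msupp g) g@_m * (Sq k ('X_[m] : P5))@_(wmnm e)).
  apply: eq_bigr => e _; rewrite {1}[g]mpolyE Sq_sum raddf_sum /=.
  by apply: eq_bigr => m _; rewrite linearZ /= mcoeffZ.
by rewrite exchange_big big1 //= => m _; rewrite -mulr_sumr SM mulr0.
Qed.

(** * Soundness of the elimination *)

Fixpoint wf_echelon (P : echelon) : Prop :=
  if P is p :: P' then
    (if p is Some t then size t = size P' else True) /\ wf_echelon P'
  else True.

(** Whether [v] is reduced to 0 by the rows of [P], that is, lies in their span. *)
Fixpoint dep (P : echelon) (v : seq bool) : bool :=
  match P, v with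
  | None :: P', h :: v' => ~~ h && dep P' v'
  | Some t :: P', h :: v' => dep P' (if h then vxor v' t else v')
  | _, _ => true
  end.

Lemma size_vxor u v : size u = size v -> size (vxor u v) = size u.
Proof. by elim: u v => [|a u IHu] [|b v] //= [/IHu ->]. Qed.

Lemma vxorC u v : vxor u v = vxor v u.
Proof. by elim: u v => [|a u IHu] [|b v] //=; rewrite IHu; case: a b => [] []. Qed.

Lemma vxorA u v w : vxor u (vxor v w) = vxor (vxor u v) w.
Proof. by elim: u v w => [|a u IHu] [|b v] [|c w] //=; rewrite IHu; case: a b c => [] [] []. Qed.

Lemma vxorvv u : vxor u u = nseq (size u) false.
Proof. by elim: u => [|[] u IHu] //=; rewrite IHu. Qed.

Lemma vxorv0 u : vxor u (nseq (size u) false) = u.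
Proof. by elim: u => [|[] u IHu] //=; rewrite IHu. Qed.

Lemma dep0 P : wf_echelon P -> dep P (nseq (size P) false).
Proof. by elim: P => //= -[t|] P IHP [_ /IHP]. Qed.

Lemma dep_vxor P u v : wf_echelon P -> size u = size P -> size v = size P ->
  dep P u -> dep P v -> dep P (vxor u v).
Proof.
elim: P u v => [|p P IHP] [|a u] [|b v] // [wp wP] [su] [sv].
case: p wp => [t st|_] /=.
  move=> du dv; have := IHP _ _ wP _ _ du dv.
  have sz (c : bool) x : size x = size P -> size (if c then vxor x t else x) = size P.
    by case: c => // sx; rewrite size_vxor sx.
  rewrite !sz // => /(_ erefl erefl); case: a b {du dv} => [] [] //=.
  - rewrite [vxor v t]vxorC vxorA -[vxor (vxor u t) t]vxorA vxorvv st -su vxorv0 //.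
  - by rewrite -vxorA [vxor t v]vxorC vxorA.
  - by rewrite vxorA.
by case: a b => [] [] //= du dv; apply: IHP.
Qed.

Lemma add_rowP P v Q : wf_echelon P -> size v = size P -> add_row P v = Some Q ->
  [/\ wf_echelon Q, size Q = size P, ~~ dep P v, dep Q v &
     forall u, size u = size P -> dep P u -> dep Q u].
Proof.
elim: P v Q => [|p P IHP] [|h v] Q // [wp wP] [sv].
case: p wp => [t st|_] /=.
  case E: add_row => [Q'|] // [<-].
  have s' : size (if h then vxor v t else v) = size P by case: h {E}; rewrite // size_vxor ?sv.
  have [wQ sQ nd dQ inc] := IHP _ _ wP s' E.
  split => //=; rewrite ?sQ // => -[|a u] //= [su]; apply: inc.
  by case: a; rewrite // size_vxor ?su.
case: h => /= [[<-]|].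
  split => //=; rewrite ?vxorvv ?sv //; first exact: dep0.
  by case=> [|[] u] //=.
case E: add_row => [Q'|] // [<-].
have [wQ sQ nd dQ inc] := IHP _ _ wP sv E.
by split => //=; rewrite ?sQ // => -[|[] u] //= [su]; apply: inc.
Qed.

Definition lin (n : nat) (c : seq bool) (vs : seq (seq bool)) : seq bool :=
  foldr (fun x acc => if x.1 then vxor x.2 acc else acc) (nseq n false) (zip c vs).

Lemma size_lin n c vs : all (fun v => size v == n) vs -> size (lin n c vs) = n.
Proof.
elim: vs c => [|v vs IHvs] [|b c] //=; rewrite ?size_nseq // => /andP[/eqP sv /IHvs s].
by case: b => /=; rewrite -/(lin n c vs) ?size_vxor ?sv ?s.
Qed.

Lemma lin_cons n b c v vs :
  lin n (b :: c) (v :: vs) = if b then vxor v (lin n c vs) else lin n c vs.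
Proof. by []. Qed.

(** [u] collects the part of a vanishing combination that has already entered the
    echelon form: it stays in the span of the rows, so that a coefficient 1 would
    make the next vector dependent. *)
Lemma add_rows_free n P vs Q c u :
  wf_echelon P -> size P = n -> all (fun v => size v == n) vs ->
  foldl (fun P v => if P is Some P' then add_row P' v else None) (Some P) vs = Some Q ->
  size c = size vs -> size u = n -> dep P u -> vxor u (lin n c vs) = nseq n false ->
  c = nseq (size vs) false.
Proof.
elim: vs P c u => [|v vs IHvs] P [|b c] u // wP sP /andP[/eqP sv svs].
have foldN : foldl (fun P v => if P is Some P' then add_row P' v else None) None vs = None.
  by elim: vs {IHvs svs}.
rewrite [foldl _ _ _]/=; case E: add_row => [P'|]; last by rewrite foldN.
have [wP' sP' nd dv inc] := add_rowP wP (etrans sv (esym sP)) E.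
move=> hQ [sc] su du; rewrite lin_cons; case: b => hz; last first.
  by rewrite (IHvs P' c u) ?sP' //; apply: inc; rewrite ?su.
have c0 : c = nseq (size vs) false.
  apply: (IHvs P' c (vxor u v)) => //; rewrite ?sP' ?size_vxor ?su ?sv //.
    by apply: dep_vxor => //; rewrite ?sP' ?su ?sv ?sP //; apply: inc; rewrite ?su ?sP.
  by rewrite -vxorA.
have lin0 : lin n c vs = nseq n false.
  by rewrite c0; elim: (vs) => //= ? ? ->.
case/negP: nd; suff -> : v = u by [].
have uv0 : vxor u v = nseq n false by rewrite -hz lin0 -sv vxorv0.
rewrite -[u]vxorv0 su -uv0 vxorA vxorvv su.
by rewrite vxorC -sv vxorv0.
Qed.

(** * Independence of the functionals *)

Lemma phi_hit E A f : wf A -> size A = 5 -> all wf E -> annihilated (Npos 63) E ->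
  hit f -> phi E A f = 0.
Proof.
move=> wA A5 wE aE /hit_Sq_sum[s /allP s_pos ->].
rewrite phi_sum big_seq big1 // => -[k g] /s_pos k_gt0.
rewrite /phi /= -[RHS](annihilatedP (subst A g) wE aE k_gt0).
apply: eq_bigr => e _; congr (_@_ _); rewrite /subst Sq_comp // => i.
by exists (fun j => (nth false (nth [::] A i) j)%:R); rewrite tnth_mktuple.
Qed.

Lemma letters_by_sizeP g L : g \in letters_by_size -> L \in g.2 ->
  size L = 5 /\ lsize L = g.1.
Proof.
by case/mapP=> a _ ->; rewrite mem_filter mem_all_letters => /andP[/eqP ? /eqP].
Qed.

Lemma irreducibles_wf root d r act w :
  w \in irreducibles letters_by_size root d r act -> [/\ wf w, size w = d & wdeg w = r].
Proof.
move: letters_by_sizeP; move: letters_by_size => bs bsP.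
elim: d r act w => [|d IHd] r act w.
  by case: r => [|r] //=; rewrite inE => /eqP ->.
rewrite irreduciblesS => /flatten_mapP[g /bsP gP]; case: ifP => // /andP[/eqP g_odd g_le].
case/flatten_mapP => L /gP[L5 Lg] /=; case: has => // /mapP[v /IHd[wv sv dv] ->]; split.
- by rewrite /= L5.
- by rewrite /= sv.
rewrite /= Lg dv -[r in RHS](subnKC g_le) -[in RHS](odd_double_half (r - g.1)).
by rewrite oddB // g_odd addbb.
Qed.

Definition functional := (seq word * word)%type.
Definition apply_functional (x : functional) (f : P5) := phi x.1 x.2 f.
Definition block_functionals (B : block) : seq functional :=
  flatten [seq [seq (F.1, A) | A <- F.2] | F <- map decode_family B.2].
Definition all_functionals (Bs : seq block) := flatten (map block_functionals Bs).

Lemma size_all_functionals Bs : size (all_functionals Bs) = count_functionals Bs.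
Proof.
rewrite size_flatten /shape -map_comp /count_functionals -/(sumn _); congr sumn.
apply: eq_map => B; rewrite /comp size_flatten /shape -!map_comp -/(sumn _); congr sumn.
by apply: eq_map => F; rewrite /comp !size_map.
Qed.

Definition admissible (x : functional) : bool :=
  [&& wf x.2, size x.2 == 5, all wf x.1, all (fun e => size e == 6) x.1 &
      annihilated (Npos 63) x.1].

Lemma block_functionalsP ws lower B x : check_block ws lower B ->
  x \in block_functionals B ->
  [/\ admissible x, all (fun e => ~~ is_Lt (cmp_lex (weight e) B.1)) x.1 &
     all (fun be => all (fun e => is_Lt (cmp_lex be (weight e))) x.1) lower].
Proof.
case/and3P=> /allP chF /allP chA _ /flatten_mapP[F hF /mapP[A hA ->]] /=.
have /and5P[h1 h2 h3 h4 h5] := chF _ hF.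
have /andP[wA A5] := allP (chA _ hF) _ hA.
by split=> //; rewrite /admissible /= wA A5 h1 h2 h3.
Qed.

(** This makes the matrix of values block triangular. *)
Lemma later_vanish ws lower Bs x w : check_blocks ws lower Bs ->
  x \in all_functionals Bs -> wf w -> weight w \in lower ->
  apply_functional x (wpoly w) = 0.
Proof.
elim: Bs lower => [|B Bs IHB] lower // /andP[chB chBs].
rewrite /all_functionals /= mem_cat => /orP[xB|xBs] ww wl; last first.
  by apply: IHB chBs xBs ww _; rewrite inE wl orbT.
have [/and5P[wA /eqP A5 wE _ _] _ /allP lE] := block_functionalsP chB xB.
by apply: phi_lt => //; exact: lE.
Qed.

Lemma nth_lin n c vs j : size c = size vs -> all (fun v => size v == n) vs -> (j < n)%N ->
  (nth false (lin n c vs) j)%:R =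
  \sum_(x <- zip c vs) (x.1 : bool)%:R * (nth false x.2 j)%:R :> 'F_2.
Proof.
elim: c vs => [|b c IHc] [|v vs] //.
  by rewrite big_nil /lin /= nth_nseq if_same.
move=> [sc] /andP[/eqP sv svs] jn; rewrite [zip _ _]/= big_cons lin_cons -IHc //=.
have nth_vxor (u u' : seq bool) i : size u = size u' ->
    nth false (vxor u u') i = nth false u i (+) nth false u' i.
  elim: u u' i => [|a u IHu] [|a' u'] [|i] //=; first by case: a.
  by move=> [/IHu].
case: b; last by rewrite mul0r add0r.
by rewrite nth_vxor ?size_lin // mul1r F2_addb.
Qed.

(** Coefficients are booleans; column by column the combination is read in the
    field with two elements. *)
Lemma independent_rowsP n vs c : independent_rows n vs ->
  all (fun v => size v == n) vs -> size c = size vs ->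
  (forall j, (j < n)%N ->
    \sum_(x <- zip c vs) (x.1 : bool)%:R * (nth false x.2 j)%:R = 0 :> 'F_2) ->
  c = nseq (size vs) false.
Proof.
rewrite /independent_rows; case E: foldl => [Q|] // _ svs sc h.
have wP : wf_echelon (nseq n None) by elim: (n).
apply: (add_rows_free (u := nseq n false) wP _ svs E sc); rewrite ?size_nseq //.
  by rewrite -[n in dep _ (nseq n _)](size_nseq n (None : option (seq bool))) dep0.
rewrite vxorC -[n in nseq n](size_lin c svs) vxorv0.
apply: (@eq_from_nth _ false) => [|j]; rewrite size_lin ?size_nseq // => jn.
by apply: F2_bool; rewrite nth_lin // h // nth_nseq if_same.
Qed.

Lemma size_values E A ws : size (values E A ws) = size ws.
Proof. exact: size_map. Qed.

Lemma block_free ws lower B (c : seq bool) : check_block ws lower B -> size B.1 = 6 ->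
  all (fun w => wf w && (size w == 6)) ws ->
  size c = size (block_functionals B) ->
  (forall w, w \in ws -> weight w = B.1 ->
    \sum_(x <- zip c (block_functionals B)) x.1%:R * apply_functional x.2 (wpoly w) = 0) ->
  c = nseq (size (block_functionals B)) false.
Proof.
move=> chB B6 /allP wws sc h; have := chB; case/and3P=> _ _.
set al := B.1; set cols := [seq w <- ws | _].
pose row (x : functional) :=
  values [seq e <- x.1 | is_Eq (cmp_lex (weight e) al)] x.2 cols.
set vs := flatten _ => ind.
have vsE : vs = map row (block_functionals B).
  rewrite /vs /block_functionals map_flatten; congr flatten.
  move: (map decode_family _) => Fs; elim: Fs => // F Fs IHF.
  rewrite [LHS]map_cons IHF 2![in RHS]map_cons; congr (_ :: _).
  by rewrite -[RHS]map_comp.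
rewrite -(size_map row) -vsE; apply: independent_rowsP ind _ _ _.
- by rewrite vsE all_map; apply/allP => x _ /=; rewrite size_values.
- by rewrite vsE size_map.
move=> j jn; set w := nth [::] cols j.
have : w \in cols by exact: mem_nth.
rewrite mem_filter => /andP[wEq wsw]; have /andP[ww /eqP w6] := wws w wsw.
have wal : weight w = al by apply: cmp_lex_Eq; [rewrite size_map w6 B6 | case: cmp_lex wEq].
rewrite -[RHS](h w wsw wal) vsE.
have -> : zip c (map row (block_functionals B)) =
    [seq (x.1, row x.2) | x <- zip c (block_functionals B)].
  by elim: (c) (block_functionals B) => [|b c' IHc] [|y s] //=; rewrite IHc.
rewrite big_map; apply: eq_big_seq => -[b x] bx; congr (_ * _) => /=.
have xB : x \in block_functionals B.
  have := map_f snd bx; rewrite -/(unzip2 _) unzip2_zip // sc //.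
have [/and5P[wA /eqP A5 wE sE _] gE _] := block_functionalsP chB xB.
rewrite /apply_functional (phi_values (al := al)) ?B6 //.
apply/allP => v; rewrite mem_filter => /andP[vEq /wws /andP[-> /eqP v6]].
apply/eqP/cmp_lex_Eq; first by rewrite size_map v6 B6.
by case: cmp_lex vEq.
Qed.

(** The words with the weight of the first block isolate its functionals, as all
    later ones vanish there; then go on with the remaining blocks. *)
Lemma blocks_free ws lower Bs (c : seq bool) : check_blocks ws lower Bs ->
  all (fun B => size B.1 == 6) Bs ->
  all (fun w => wf w && (size w == 6)) ws ->
  size c = size (all_functionals Bs) ->
  (forall w, w \in ws ->
    \sum_(x <- zip c (all_functionals Bs)) x.1%:R * apply_functional x.2 (wpoly w) = 0) ->
  c = nseq (size (all_functionals Bs)) false.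
Proof.
elim: Bs lower c => [|B Bs IHB] lower c; first by move=> _ _ _ /size0nil.
case/andP=> chB chBs /andP[/eqP B6 B6s] wws.
rewrite /all_functionals /= -/(all_functionals Bs) size_cat => sc h.
set m := size (block_functionals B) in sc *.
pose c1 := take m c; pose c2 := drop m c.
have cE : c = c1 ++ c2 by rewrite cat_take_drop.
have s1 : size c1 = m by rewrite size_take sc; case: ltnP => //; lia.
have s2 : size c2 = size (all_functionals Bs) by rewrite size_drop sc addKn.
move: h; rewrite cE => h.
have {}h w : w \in ws ->
    \sum_(x <- zip c1 (block_functionals B)) x.1%:R * apply_functional x.2 (wpoly w) +
    \sum_(x <- zip c2 (all_functionals Bs)) x.1%:R * apply_functional x.2 (wpoly w) = 0.
  by move=> /h; rewrite zip_cat ?s1 // big_cat.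
have c1_0 : c1 = nseq m false.
  apply: (block_free chB) => // w wsw wB; have := h w wsw.
  rewrite [X in _ + X = _]big1_seq ?addr0 // => -[b x] /= bx.
  have xBs : x \in all_functionals Bs.
    by have := map_f snd bx; rewrite -/(unzip2 _) unzip2_zip // s2.
  have /andP[ww _] := allP wws w wsw.
  by rewrite (later_vanish chBs xBs ww) ?mulr0 // wB inE eqxx.
rewrite c1_0 (IHB _ c2 chBs B6s wws s2); last first.
  move=> w wsw; have := h w wsw; rewrite big1_seq ?add0r // => -[b x] /= bx.
  have := map_f fst bx; rewrite -/(unzip1 _) unzip1_zip ?s1 // c1_0 => /nseqP[/= -> _].
  by rewrite mul0r.
by rewrite nseqD.
Qed.

(** * The dimension *)

(** As long as the generators are linearly dependent one of them can be removed. *)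
Lemma span_has_dim (K : fieldType) (V : lmodType K) (S : V -> Prop) N (g : 'I_N -> V) :
  (forall i, S (g i)) -> (forall v, S v -> exists c : 'I_N -> K, v = \sum_i c i *: g i) ->
  exists2 d, has_dim S d & (d <= N)%N.
Proof.
elim: N g => [|N IHN] g Sg gen.
  by exists 0%N => //; exists g; split=> // c _ [].
have [g_free|] := classic (forall c : 'I_N.+1 -> K, \sum_i c i *: g i = 0 -> forall i, c i = 0).
  by exists N.+1 => //; exists g.
move=> nfree; have [c c_dep] := not_all_ex_not _ _ nfree.
have [c0 c_ne] := imply_to_and _ _ c_dep; have [i /eqP ci] := not_all_ex_not _ _ c_ne.
have [|d dim_d le_d] := IHN (g \o lift i) (fun j => Sg (lift i j)); last first.
  by exists d => //; apply: leqW.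
(* A relation with nonzero coefficient at [i] expresses [g i] by the others. *)
have gi : g i = \sum_j (- (c i)^-1 * c (lift i j)) *: g (lift i j).
  have := congr1 ( *:%R (c i)^-1) c0; rewrite scaler0 (bigD1_ord i) //= scalerDr scalerA.
  rewrite mulVf // scale1r => /eqP; rewrite addr_eq0 => /eqP ->.
  rewrite scaler_sumr -sumrN; apply: eq_bigr => j _.
  by rewrite scalerA mulNr scaleNr.
move=> v /gen[a ->]; exists (fun j => a i * (- (c i)^-1 * c (lift i j)) + a (lift i j)).
rewrite (bigD1_ord i) //= {1}gi scaler_sumr -big_split; apply: eq_bigr => j _ /=.
by rewrite scalerDl scalerA.
Qed.

Lemma QP_deg_word w : wf w -> wdeg w = 63%N -> QP_deg 63 (QP_proj (wpoly w)).
Proof. by move=> ww wd; exists (wpoly w) => //; rewrite -wd wpoly_homog. Qed.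

Lemma span_words (ws : seq word) t : trie_ok t ->
  ws = irreducibles letters_by_size t 6 63 [::] ->
  forall v : QP 5, QP_deg 63 v ->
  exists c : 'I_(size ws) -> 'F_2, v = \sum_i c i *: QP_proj (wpoly (nth [::] ws i)).
Proof.
move=> okt wsE v [f fd ->]; have [s sub h] := in_span_homog (d := 63) okt (erefl true) wsE fd.
have -> : QP_proj f = \sum_(w <- s) QP_proj (wpoly w).
  by rewrite -linear_sum; apply/QP_projP.
elim: s sub {h} => [|w s IHs] sub.
  by exists (fun=> 0); rewrite big_nil big1 // => i _; rewrite scale0r.
have [|c E] := IHs; first by move=> x xs; apply: sub; rewrite inE xs orbT.
have wws : w \in ws by apply: sub; rewrite inE eqxx.
have iw : (index w ws < size ws)%N by rewrite index_mem.
exists (fun i => c i + (i == Ordinal iw)%:R); rewrite big_cons E.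
under [RHS]eq_bigr => i _ do rewrite scalerDl.
rewrite big_split addrC; congr (_ + _).
rewrite (bigD1 (Ordinal iw)) //= eqxx scale1r nth_index // big1 ?addr0 // => i /negPf ->.
by rewrite scale0r.
Qed.

(** In terms of representatives of a basis with [d] elements, the functionals are
    vectors of length [d]. More than [d] of them have a vanishing combination,
    and this also vanishes on the irreducible words, contrary to [blocks_free]. *)
Lemma functionals_le_dim (ws : seq word) Bs d : check_blocks ws [::] Bs ->
  all (fun B => size B.1 == 6) Bs ->
  (forall w, w \in ws -> [/\ wf w, size w = 6%N & wdeg w = 63%N]) ->
  has_dim (@QP_deg 5 63) d -> (count_functionals Bs <= d)%N.
Proof.
move=> chBs B6 wsP [b [b_deg _ b_gen]]; rewrite -size_all_functionals.
set fs := all_functionals Bs; rewrite leqNgt; apply/negP => lt_d.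
have /fin_all_exists[p bE] i := QP_proj_surj (b i).
pose x0 : functional := ([::], [::]).
pose M := \matrix_(i < size fs, j < d) apply_functional (nth x0 fs i) (p j).
have: kermx M != 0.
  by rewrite -mxrank_eq0 mxrank_ker subn_eq0 -ltnNge (leq_ltn_trans (rank_leq_col M)).
case/rowV0Pn => u /sub_kermxP uM /negP[]; apply/eqP/rowP => i; rewrite mxE.
have adm x : x \in fs -> admissible x.
  rewrite /fs; elim: (Bs) [::] chBs => // B Bs' IHB lower /andP[chB chBs'].
  rewrite /all_functionals /= mem_cat => /orP[|/(IHB _ chBs')//].
  by case/(block_functionalsP chB).
pose c := [seq u 0 i != 0 | i <- enum 'I_(size fs)].
have cE : zip c fs = [seq (u 0 i != 0, nth x0 fs i) | i <- enum 'I_(size fs)].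
  rewrite -[fs in zip c fs](mkseq_nth x0) /mkseq -val_enum_ord -map_comp.
  by rewrite /c zip_map.
have sc : size c = size fs by rewrite size_map size_enum_ord.
have: c = nseq (size fs) false.
  apply: (blocks_free chBs B6) => //.
    by apply/allP => w /wsP[-> /eqP].
  move=> w /wsP[ww _ wd]; rewrite -/fs cE big_map big_enum /=.
  have [a aE] := b_gen _ (QP_deg_word ww wd).
  have hw : hit (wpoly w - \sum_j a j *: p j).
    apply/QP_projP; rewrite aE linear_sum; apply: eq_bigr => j _.
    by rewrite linearZ /= bE.
  transitivity (\sum_i \sum_j u 0 i * (a j * M i j)).
    apply: eq_bigr => k _; rewrite -mulr_sumr.
    have /and5P[wA /eqP A5 wE _ aE'] : admissible (nth x0 fs k) by apply: adm; apply: mem_nth.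
    congr (_ * _).
      by case: (F2_cases (u 0 k)) => ->; rewrite ?eqxx ?oner_eq0.
    rewrite /apply_functional -[wpoly w](subrK (\sum_j a j *: p j)) phiD phi_hit //.
    by rewrite add0r phi_sum; apply: eq_bigr => j _; rewrite phiZ mxE.
  rewrite exchange_big big1 //= => j _.
  under eq_bigr => k _ do rewrite mulrCA.
  rewrite -mulr_sumr; have /rowP/(_ j) := uM; rewrite !mxE => ->.
  by rewrite mulr0.
move/(congr1 (nth false ^~ i)); rewrite nth_nseq ltn_ord (nth_map i) ?size_enum_ord //.
by rewrite nth_ord_enum => /negbFE/eqP.
Qed.

Lemma check_dim cert Bs : check cert Bs -> all (fun B => size B.1 == 6) Bs ->
  exists2 d, has_dim (@QP_deg 5 63) d & (count_functionals Bs <= d <= 1155)%N.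
Proof.
rewrite /check; case E: saturate => [t|] //; have okt := saturateP E.
move=> /andP[]; set ws := irreducibles _ _ _ _ _ => le_ws chBs B6.
have wsP w : w \in ws -> [/\ wf w, size w = 6%N & wdeg w = 63%N] by apply: irreducibles_wf.
have [|d dim_d le_d] := span_has_dim _ (span_words okt (erefl ws)).
  by move=> i; have [|ww _ wd] := wsP (nth [::] ws i); [apply: mem_nth | apply: QP_deg_word].
exists d => //; rewrite (functionals_le_dim chBs B6 wsP dim_d).
exact: leq_trans le_ws.
Qed.

(** * The certificates in degree 63 *)

(** An entry in the group of weight [al] starts with the code of a prefix word, 1
    for the empty one. Each further number codes a pair [(j, h)]: the five
    exponents [h] are its lowest digits in base 64, and [j] is what remains. The
    long entries expand
    [u Sq^j v + chi(Sq^j)(u) v = sum over i > 0 of Sq^i (chi(Sq^(j-i))(u) v)],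
    and rewrite words that no single square reaches: [j = 5] in weight (2,3,1),
    [j = 4] in weight (3,3,1) and [j = 8] in weight (3,3,3,1). *)
Definition relations : seq (seq nat * seq (seq N)) :=
 ([:: ([:: 0; 1]%N,
[:: [:: 1; 1073741888]; [:: 1; 1090519040]; [:: 1; 1073745920]; [:: 1; 1073741825];
[:: 1; 1074003968]]);
  ([:: 0; 2]%N,
[:: [:: 1; 2147483713]; [:: 1; 2164523008]; [:: 1; 2147749888]; [:: 1; 2147487745];
[:: 1; 2147487808]; [:: 1; 2147745856]; [:: 1; 2164260928]; [:: 1; 2147745793];
[:: 1; 2164264960]; [:: 1; 2164260865]]);
  ([:: 0; 3]%N,
[:: [:: 1; 1074012162]; [:: 1; 1091043330]; [:: 1; 1073746050]; [:: 1; 1090527234];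
[:: 1; 1090519170]; [:: 1; 1090527360]; [:: 1; 1074012288]; [:: 1; 1091043456];
[:: 1; 1074004098]; [:: 1; 1091051520]]);
  ([:: 0; 4]%N,
[:: [:: 1; 1091051522]; [:: 1; 1074012290]; [:: 1; 1090527362]; [:: 1; 1091043458];
[:: 1; 1091051648]]);
  ([:: 0; 5]%N,
[:: [:: 1; 1091051650]]);
  ([:: 1; 1]%N,
[:: [:: 1; 1074008064]; [:: 1; 1090781184]; [:: 1; 1073745984]; [:: 1; 1074004032];
[:: 1; 1090519041]; [:: 1; 1074003969]; [:: 1; 1073745921]; [:: 1; 1090523136];
[:: 1; 1090519104]; [:: 1; 1073741889]]);
  ([:: 1; 2]%N,
[:: [:: 1; 1090789376]; [:: 1; 1073746112]; [:: 1; 1091043329]; [:: 1; 1074004097];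
[:: 1; 1090519043]; [:: 1; 1074016256]; [:: 1; 1090531328]; [:: 1; 1074532352];
[:: 1; 1074004160]; [:: 1; 1091043392]; [:: 1; 1090781186]; [:: 1; 1073746049];
[:: 1; 1073754176]; [:: 1; 1073745923]; [:: 1; 1073742017]; [:: 1; 1074528320];
[:: 1; 1124073536]; [:: 1; 1090519232]; [:: 1; 1091305472]; [:: 1; 1074528257];
[:: 1; 1091047424]; [:: 1; 1124073473]; [:: 1; 1090527233]; [:: 1; 1090519106];
[:: 1; 1074012224]; [:: 1; 1090527296]; [:: 1; 1124335616]; [:: 1; 1090519169];
[:: 1; 1074003971]; [:: 1; 1074012161]; [:: 1; 1073754113]; [:: 1; 1074008066];
[:: 1; 1074004034]; [:: 1; 1074008192]; [:: 1; 1073745986]; [:: 1; 1090781312];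
[:: 1; 1090523138]; [:: 1; 1073741891]; [:: 1; 1124077568]; [:: 1; 1090523264];
[:: 1; 2164264961]; [:: 1; 2147749952]; [:: 1; 2164523072]; [:: 1; 2164265024];
[:: 1; 2147745857]; [:: 1; 2164260929]; [:: 1; 2147749889]; [:: 1; 2147487809];
[:: 1; 2164527104]; [:: 1; 2164523009]]);
  ([:: 1; 3]%N,
[:: [:: 1; 1091051521]; [:: 1; 1124335744]; [:: 1; 1124077696]; [:: 1; 1090519234];
[:: 1; 1074004099]; [:: 1; 1091305600]; [:: 1; 1073746114]; [:: 1; 1091051584];
[:: 1; 1090789504]; [:: 1; 1090527235]; [:: 1; 1091043520]; [:: 1; 1091043331];
[:: 1; 1091305474]; [:: 1; 1073746051]; [:: 1; 1074016258]; [:: 1; 1091047552];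
[:: 1; 1073754178]; [:: 1; 1074012163]; [:: 1; 1090789378]; [:: 1; 1090531456];
[:: 1; 1090523266]; [:: 1; 1074532480]; [:: 1; 1090531330]; [:: 1; 1074012226];
[:: 1; 1074016384]; [:: 1; 1074532354]; [:: 1; 1124335618]; [:: 1; 1091313664];
[:: 1; 1074004162]; [:: 1; 1090527298]; [:: 1; 1124343808]; [:: 1; 1090527361];
[:: 1; 1124077570]; [:: 1; 1074008194]; [:: 1; 1074012289]; [:: 1; 1090527424];
[:: 1; 1091055616]; [:: 1; 1074528322]; [:: 1; 1091047426]; [:: 1; 1091043457];
[:: 1; 1124073538]; [:: 1; 1090519171]; [:: 1; 1074012352]; [:: 1; 1091043394];
[:: 1; 1090781314]]);
  ([:: 1; 4]%N,
[:: [:: 1; 1074532482]; [:: 1; 1091047554]; [:: 1; 1091051523]; [:: 1; 1091313666];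
[:: 1; 1124077698]; [:: 1; 1091051712]; [:: 1; 1124343936]; [:: 1; 1091055744];
[:: 1; 1090527426]; [:: 1; 1090789506]; [:: 1; 1091051586]; [:: 1; 1091305602];
[:: 1; 1091043459]; [:: 1; 1091051649]; [:: 1; 1091313792]; [:: 1; 1090527363];
[:: 1; 1074016386]; [:: 1; 1074012291]; [:: 1; 1124343810]; [:: 1; 1090531458];
[:: 1; 1091043522]; [:: 1; 1074012354]; [:: 1; 1124335746]; [:: 1; 1091055618]]);
  ([:: 1; 5]%N,
[:: [:: 1; 1091055746]; [:: 1; 1091051651]; [:: 1; 1124343938]; [:: 1; 1091051714];
[:: 1; 1091313794]]);
  ([:: 2; 1]%N,
[:: [:: 1; 1074008128]; [:: 1; 1090523137]; [:: 1; 1074008065]; [:: 1; 1090523200];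
[:: 1; 1090519105]; [:: 1; 1074004033]; [:: 1; 1090785280]; [:: 1; 1090781185];
[:: 1; 1073745985]; [:: 1; 1090781248]]);
  ([:: 2; 2]%N,
[:: [:: 1; 1090523202]; [:: 1; 1091309568]; [:: 1; 1090781376]; [:: 1; 1074016320];
[:: 1; 1074008067]; [:: 1; 1074532353]; [:: 1; 1091043393]; [:: 1; 1090523139];
[:: 1; 1090789377]; [:: 1; 1073754177]; [:: 1; 1090519107]; [:: 1; 1124339712];
[:: 1; 1073745987]; [:: 1; 1074012225]; [:: 1; 1074004161]; [:: 1; 1074532416];
[:: 1; 1091305473]; [:: 1; 1090519233]; [:: 1; 1090785282]; [:: 1; 1090531329];
[:: 1; 1090523265]; [:: 1; 1074008256]; [:: 1; 1091047488]; [:: 1; 1124077569];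
[:: 1; 1090793472]; [:: 1; 1124073537]; [:: 1; 1090781187]; [:: 1; 1074528321];
[:: 1; 1091047425]; [:: 1; 1090781313]; [:: 1; 1074008193]; [:: 1; 1073746113];
[:: 1; 1091305536]; [:: 1; 1090789440]; [:: 1; 1090785408]; [:: 1; 1074004035];
[:: 1; 1090527297]; [:: 1; 1074008130]; [:: 1; 1090531392]; [:: 1; 1074016257];
[:: 1; 1124335617]; [:: 1; 1124335680]; [:: 1; 1090523328]; [:: 1; 1124077632];
[:: 1; 1090781250]; [:: 1; 2164523073]; [:: 1; 2164527105]; [:: 1; 2147749953];
[:: 1; 2164527168]; [:: 1; 2164265025]]);
  ([:: 2; 3]%N,
[:: [:: 1; 1074008195]; [:: 1; 1124335808]; [:: 1; 1090793600]; [:: 1; 1124864000];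
[:: 1; 1074532481]; [:: 1; 1074528323]; [:: 1; 1090531520]; [:: 1; 1091043521];
[:: 1; 1074532355]; [:: 1; 1074532544]; [:: 1; 1074004163]; [:: 1; 1091047427];
[:: 1; 1090785410]; [:: 1; 1090793474]; [:: 1; 1074016259]; [:: 1; 1074016385];
[:: 1; 1074528449]; [:: 1; 1124339714]; [:: 1; 1091047616]; [:: 1; 1091305664];
[:: 1; 1091313665]; [:: 1; 1090527299]; [:: 1; 1091313728]; [:: 1; 1124335619];
[:: 1; 1124343809]; [:: 1; 1124347904]; [:: 1; 1074012353]; [:: 1; 1090527425];
[:: 1; 1091055617]; [:: 1; 1090523267]; [:: 1; 1073746115]; [:: 1; 1091309570];
[:: 1; 1124085824]; [:: 1; 1091309696]; [:: 1; 1124073665]; [:: 1; 1091043395];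
[:: 1; 1090531331]; [:: 1; 1090531394]; [:: 1; 1074540608]; [:: 1; 1124077697];
[:: 1; 1124077760]; [:: 1; 1073754179]; [:: 1; 1090531457]; [:: 1; 1091047553];
[:: 1; 1124085761]; [:: 1; 1124073539]; [:: 1; 1074540545]; [:: 1; 1124077634];
[:: 1; 1090789505]; [:: 1; 1090523330]; [:: 1; 1091317760]; [:: 1; 1074532418];
[:: 1; 1124077571]; [:: 1; 1074016448]; [:: 1; 1090781315]; [:: 1; 1091051585];
[:: 1; 1073754305]; [:: 1; 1090781378]; [:: 1; 1074008258]; [:: 1; 1124859905];
[:: 1; 1091305601]; [:: 1; 1090789379]; [:: 1; 1124335682]; [:: 1; 1091055680];
[:: 1; 1091305475]; [:: 1; 1090789442]; [:: 1; 1090519235]; [:: 1; 1124335745];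
[:: 1; 1074012227]; [:: 1; 1091047490]; [:: 1; 1090789568]; [:: 1; 1091305538];
[:: 1; 1124339840]; [:: 1; 1124343872]; [:: 1; 1074016322]; [:: 1; 1124859968]]);
  ([:: 2; 4]%N,
[:: [:: 1; 1124339842]; [:: 1; 1124864128]; [:: 1; 1091317888]; [:: 1; 1090789570];
[:: 1; 1124077699]; [:: 1; 1124348032]; [:: 1; 1091313667]; [:: 1; 1091047555];
[:: 1; 1091055619]; [:: 1; 1124077762]; [:: 1; 1074012355]; [:: 1; 1124347906];
[:: 1; 1091047618]; [:: 1; 1124343811]; [:: 1; 1124343874]; [:: 1; 1091051587];
[:: 1; 1091313730]; [:: 1; 1091313793]; [:: 1; 1090531459]; [:: 1; 1074016387];
[:: 1; 1090789507]; [:: 1; 1091055745]; [:: 1; 1091317762]; [:: 1; 1091043523];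
[:: 1; 1091055682]; [:: 1; 1124859970]; [:: 1; 1074532546]; [:: 1; 1124864002];
[:: 1; 1124335747]; [:: 1; 1090527427]; [:: 1; 1124335810]; [:: 1; 1091051713];
[:: 1; 1090793602]; [:: 1; 1124343937]; [:: 1; 1074016450]; [:: 1; 1074540610];
[:: 1; 1091309698]; [:: 1; 1124344000]; [:: 1; 1091305603]; [:: 1; 1091313856];
[:: 1; 1090531522]; [:: 1; 1124085826]; [:: 1; 1091305666]; [:: 1; 1091055808];
[:: 1; 1074532483]]);
  ([:: 2; 5]%N,
[:: [:: 1; 1124343939]; [:: 1; 1124864130]; [:: 1; 1091051715]; [:: 1; 1091055810];
[:: 1; 1124344002]; [:: 1; 1091313858]; [:: 1; 1091317890]; [:: 1; 1124348034];
[:: 1; 1091313795]; [:: 1; 1091055747]]);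
  ([:: 3; 1]%N,
[:: [:: 1; 1074008129]; [:: 1; 1090785281]; [:: 1; 1090781249]; [:: 1; 1090785344];
[:: 1; 1090523201]]);
  ([:: 3; 2]%N,
[:: [:: 1; 1090785283]; [:: 1; 1090781251]; [:: 1; 1090793473]; [:: 1; 1074008257];
[:: 1; 1091047489]; [:: 1; 1090785472]; [:: 1; 1124339713]; [:: 1; 1090523329];
[:: 1; 1091305537]; [:: 1; 1090789441]; [:: 1; 1090781377]; [:: 1; 1091309569];
[:: 1; 1091309632]; [:: 1; 1090523203]; [:: 1; 1124335681]; [:: 1; 1124339776];
[:: 1; 1090793536]; [:: 1; 1074008131]; [:: 1; 1090785409]; [:: 1; 1074016321];
[:: 1; 1090785346]; [:: 1; 1074532417]; [:: 1; 1090531393]; [:: 1; 1124077633];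
[:: 1; 2164527169]]);
  ([:: 3; 3]%N,
[:: [:: 1; 1124343873]; [:: 1; 1090789443]; [:: 1; 1124347905]; [:: 1; 1124339715];
[:: 1; 1091309697]; [:: 1; 1090523331]; [:: 1; 1074008259]; [:: 1; 1090789569];
[:: 1; 1090531395]; [:: 1; 1091313729]; [:: 1; 1091309760]; [:: 1; 1124339841];
[:: 1; 1091047617]; [:: 1; 1124085825]; [:: 1; 1090785411]; [:: 1; 1124864001];
[:: 1; 1090781379]; [:: 1; 1124859969]; [:: 1; 1091309571]; [:: 1; 1090793475];
[:: 1; 1124864064]; [:: 1; 1124077635]; [:: 1; 1091305539]; [:: 1; 1124339904];
[:: 1; 1090793601]; [:: 1; 1074016449]; [:: 1; 1124335683]; [:: 1; 1124339778];
[:: 1; 1091309634]; [:: 1; 1090793538]; [:: 1; 1090531521]; [:: 1; 1074532545];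
[:: 1; 1091305665]; [:: 1; 1091055681]; [:: 1; 1074532419]; [:: 1; 1124335809];
[:: 1; 1074540609]; [:: 1; 1091317824]; [:: 1; 1124077761]; [:: 1; 1074016323];
[:: 1; 1091047491]; [:: 1; 1124347968]; [:: 1; 1090785474]; [:: 1; 1090793664];
[:: 1; 1091317761]]);
  ([:: 3; 4]%N,
[:: [:: 1; 1124085827]; [:: 1; 1124864066]; [:: 1; 1124348033]; [:: 1; 1124085953];
[:: 1; 1090793603]; [:: 1; 1124339906]; [:: 1; 1090793666]; [:: 1; 1091317889];
[:: 1; 1074540611]; [:: 1; 1124339843]; [:: 1; 1124860097]; [:: 1; 1091305667];
[:: 1; 1124347970]; [:: 1; 1124335811]; [:: 1; 1091055683]; [:: 1; 1091317763];
[:: 1; 1124343875]; [:: 1; 1074540737]; [:: 1; 1091313731]; [:: 1; 1090789571];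
[:: 1; 1090531523]; [:: 1; 1091309762]; [:: 1; 1074532547]; [:: 1; 1124872256];
[:: 1; 1124872193]; [:: 1; 1124864192]; [:: 1; 1124864003]; [:: 1; 1124348096];
[:: 1; 1124859971]; [:: 1; 1124347907]; [:: 1; 1124864129]; [:: 1; 1124344001];
[:: 1; 1091055809]; [:: 1; 1091047619]; [:: 1; 1091309699]; [:: 1; 1124077763];
[:: 1; 1091317826]; [:: 1; 1091313857]; [:: 1; 1074016451]; [:: 1; 1091317952]]);
  ([:: 3; 5]%N,
[:: [:: 1; 1091317954]; [:: 1; 1124344003]; [:: 1; 1124348098]; [:: 1; 1091317891];
[:: 1; 1091313859]; [:: 1; 1091055811]; [:: 1; 1124864131]; [:: 1; 1124864194];
[:: 1; 1124872258]; [:: 1; 1124348035]]);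
  ([:: 4; 1]%N,
[:: [:: 1; 1090785345]]);
  ([:: 4; 2]%N,
[:: [:: 1; 1090793537]; [:: 1; 1090785473]; [:: 1; 1124339777]; [:: 1; 1091309633];
[:: 1; 1090785347]]);
  ([:: 4; 3]%N,
[:: [:: 1; 1124864065]; [:: 1; 1091317825]; [:: 1; 1091309635]; [:: 1; 1124339905];
[:: 1; 1091309761]; [:: 1; 1124347969]; [:: 1; 1090793665]; [:: 1; 1090793539];
[:: 1; 1124339779]; [:: 1; 1090785475]]);
  ([:: 4; 4]%N,
[:: [:: 1; 1124872257]; [:: 1; 1091317953]; [:: 1; 1124864067]; [:: 1; 1090793667];
[:: 1; 1124864193]; [:: 1; 1124347971]; [:: 1; 1091309763]; [:: 1; 1124348097];
[:: 1; 1124339907]; [:: 1; 1091317827]]);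
  ([:: 4; 5]%N,
[:: [:: 1; 1124872259]; [:: 1; 1124864195]; [:: 1; 1091317955]; [:: 1; 1124872385];
[:: 1; 1124348099]]);
  ([:: 1; 1; 1]%N,
[:: [:: 1; 1124073664]; [:: 1; 1073742019]; [:: 1; 1073754115]; [:: 1; 1073754304];
[:: 1; 1124085760]; [:: 1; 1074528259]; [:: 1; 1124073475]; [:: 1; 1124859904];
[:: 1; 1074540544]; [:: 1; 1074528448]]);
  ([:: 1; 1; 3]%N,
[:: [:: 1; 2149060740]; [:: 1; 2248409220]; [:: 1; 2248417536]; [:: 1; 2248417284];
[:: 1; 2248151172]]);
  ([:: 1; 3; 2]%N,
[:: [:: 1; 2181824898]; [:: 1; 2148020610]; [:: 1; 2181832836]; [:: 1; 2148016326];
[:: 1; 2181562566]; [:: 1; 2181575040]; [:: 1; 2181578946]; [:: 1; 2148032643];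
[:: 1; 2181050754]; [:: 1; 2182619139]; [:: 1; 2181849090]; [:: 1; 2181832962];
[:: 1; 2181570756]; [:: 1; 2181574914]; [:: 1; 2181574662]; [:: 1; 2182611075];
[:: 1; 2181578883]; [:: 1; 2181574788]; [:: 1; 2181570819]; [:: 1; 2181062787];
[:: 1; 2181046470]; [:: 1; 2182619328]; [:: 1; 2181849216]]);
  ([:: 1; 4; 1]%N,
[:: [:: 1; 2181570691]; [:: 1; 2181574786]; [:: 1; 2181832834]; [:: 1; 2181570754]]);
  ([:: 1; 4; 3]%N,
[:: [:: 1; 2182635651]; [:: 1; 2181849474]; [:: 1; 2182619334]; [:: 1; 2181575046]]);
  ([:: 2; 2; 2]%N,
[:: [:: 1; 1124090051]; [:: 1; 1124876480]; [:: 1; 1125920768]; [:: 1; 1074556931];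
[:: 1; 1124872196]; [:: 1; 1124860352]; [:: 1; 1124859911]; [:: 1; 1124102336];
[:: 1; 1074528455]; [:: 1; 1124876291]; [:: 1; 1124073923]; [:: 1; 1074540992];
[:: 1; 1191194627]; [:: 1; 1073754563]; [:: 1; 1124872448]; [:: 1; 1124086208];
[:: 1; 1124888576]; [:: 1; 1191968771]; [:: 1; 1074540551]; [:: 1; 1125134339];
[:: 1; 1191968960]; [:: 1; 1074544835]; [:: 1; 1075589312]; [:: 1; 1074540803];
[:: 1; 1124085767]; [:: 1; 1125908483]; [:: 1; 1124102147]; [:: 1; 1125908672];
[:: 1; 1125134528]; [:: 1; 1074540740]; [:: 1; 1125122243]; [:: 1; 1075577027];
[:: 1; 1075589123]; [:: 1; 1191182531]; [:: 1; 1073754311]; [:: 1; 1191981056];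
[:: 1; 1124073671]; [:: 1; 1124860163]; [:: 1; 1124086019]; [:: 1; 1074557120];
[:: 1; 1074528707]; [:: 1; 1124860100]; [:: 1; 1073770691]; [:: 1; 1191194816];
[:: 1; 1124085956]]);
  ([:: 2; 2; 4]%N,
[:: [:: 1; 2249732164]; [:: 1; 2249986180]; [:: 1; 2248417543]; [:: 1; 2266501252];
[:: 1; 2248421764]; [:: 1; 2248417606]; [:: 1; 2248417732]; [:: 1; 2248937860];
[:: 1; 2248437892]; [:: 1; 2248937734]; [:: 1; 2248691782]]);
  ([:: 2; 3; 1]%N,
[:: 
[:: 1; 1109131329; 1142161473; 2166095937; 2215641153; 3256090689; 4313055297; 4329570369;
5386534977];
[:: 1; 1124090049; 1157636289; 2181054657; 2231374017; 3271565505; 4328530113; 4345303233;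
5402267841];
[:: 1; 1107566661; 1141121091; 2164531269; 2214862914; 3255050307; 4312014915; 4328792130;
5385756738];
[:: 1; 1158680640; 1191710784; 2215645248; 2265190464; 3305640000; 4362604608; 4379119680;
5436084288];
[:: 1; 1108607169; 1141637313; 2165571777; 2215116993; 3255566529; 4312531137; 4329046209;
5386010817];
[:: 1; 1108087104; 1141641408; 2165051712; 2215383168; 3255570624; 4312535232; 4329312384;
5386276992];
[:: 1; 1107574977; 1141121217; 2164539585; 2214858945; 3255050433; 4312015041; 4328788161;
5385752769];
[:: 1; 1108099137; 1141645377; 2165063745; 2215383105; 3255574593; 4312539201; 4329312321;
5386276929];
[:: 1; 1108349121; 1141379265; 2165313729; 2214858945; 3255308481; 4312273089; 4328788161;
5385752769];
[:: 1; 1108103232; 1141649472; 2165067840; 2215387200; 3255578688; 4312543296; 4329316416;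
5386281024];
[:: 1; 1108619328; 1141649472; 2165583936; 2215129152; 3255578688; 4312543296; 4329058368;
5386022976];
[:: 1; 1125134400; 1158164544; 2182099008; 2231644224; 3272093760; 4329058368; 4345573440;
5402538048];
[:: 1; 1125134337; 1158164481; 2182098945; 2231644161; 3272093697; 4329058305; 4345573377;
5402537985];
[:: 1; 1107587136; 1141133376; 2164551744; 2214871104; 3255062592; 4312027200; 4328800320;
5385764928];
[:: 1; 1158680577; 1191710721; 2215645185; 2265190401; 3305639937; 4362604545; 4379119617;
5436084225];
[:: 1; 1108619265; 1141649409; 2165583873; 2215129089; 3255578625; 4312543233; 4329058305;
5386022913];
[:: 1; 1107579072; 1141125312; 2164543680; 2214863040; 3255054528; 4312019136; 4328792256;
5385756864];
[:: 1; 1074270657; 1074794817; 2147750337; 2148536577; 3221754177; 4295233857; 4295495937;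
5368975617];
[:: 1; 1125126210; 1158156354; 2182090818; 2231636034; 3272085570; 4329050178; 4345565250;
5402529858];
[:: 1; 1109135361; 1142165505; 2166099969; 2215645185; 3256094721; 4313059329; 4329574401;
5386539009];
[:: 1; 1107571008; 1141125312; 2164535616; 2214867072; 3255054528; 4312019136; 4328796288;
5385760896];
[:: 1; 1124098113; 1157644353; 2181062721; 2231382081; 3271573569; 4328538177; 4345311297;
5402275905];
[:: 1; 1107308613; 1140863043; 2164273221; 2214604866; 3254792259; 4311756867; 4328534082;
5385498690];
[:: 1; 1108087041; 1141641345; 2165051649; 2215383105; 3255570561; 4312535169; 4329312321;
5386276929];
[:: 1; 1125126147; 1158156291; 2182090755; 2231635971; 3272085507; 4329050115; 4345565187;
5402529795];
[:: 1; 1107570945; 1141125249; 2164535553; 2214867009; 3255054465; 4312019073; 4328796225;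
5385760833];
[:: 1; 1107562629; 1141117059; 2164527237; 2214858882; 3255046275; 4312010883; 4328788098;
5385752706];
[:: 1; 1107566913; 1141121217; 2164531521; 2214862977; 3255050433; 4312015041; 4328792193;
5385756801];
[:: 1; 1125646401; 1158676545; 2182611009; 2232156225; 3272605761; 4329570369; 4346085441;
5403050049];
[:: 1; 1108086852; 1141641282; 2165051460; 2215383105; 3255570498; 4312535106; 4329312321;
5386276929];
[:: 1; 1108083009; 1141637313; 2165047617; 2215379073; 3255566529; 4312531137; 4329308289;
5386272897];
[:: 1; 1107562566; 1141116996; 2164527174; 2214858819; 3255046212; 4312010820; 4328788035;
5385752643];
[:: 1; 1107300423; 1140854853; 2164265031; 2214596676; 3254784069; 4311748677; 4328525892;
5385490500];
[:: 1; 1125650496; 1158680640; 2182615104; 2232160320; 3272609856; 4329574464; 4346089536;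
5403054144];
[:: 1; 1074544833; 1075060929; 2148024513; 2148798657; 3222020289; 4295499969; 4295758017;
5369237697];
[:: 1; 1107562692; 1141117122; 2164527300; 2214858945; 3255046338; 4312010946; 4328788161;
5385752769];
[:: 1; 1158676545; 1191706689; 2215641153; 2265186369; 3305635905; 4362600513; 4379115585;
5436080193];
[:: 1; 1108611075; 1141641219; 2165575683; 2215120899; 3255570435; 4312535043; 4329050115;
5386014723];
[:: 1; 1125122241; 1158152385; 2182086849; 2231632065; 3272081601; 4329046209; 4345561281;
5402525889];
[:: 1; 1125122115; 1158152259; 2182086723; 2231631939; 3272081475; 4329046083; 4345561155;
5402525763];
[:: 1; 1108082757; 1141637187; 2165047365; 2215379010; 3255566403; 4312531011; 4329308226;
5386272834];
[:: 1; 1108103169; 1141649409; 2165067777; 2215387137; 3255578625; 4312543233; 4329316353;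
5386280961];
[:: 1; 1157644353; 1191190593; 2214608961; 2264928321; 3305119809; 4362084417; 4378857537;
5435822145];
[:: 1; 1107583041; 1141129281; 2164547649; 2214867009; 3255058497; 4312023105; 4328796225;
5385760833];
[:: 1; 1074294849; 1074810945; 2147774529; 2148548673; 3221770305; 4295249985; 4295508033;
5368987713];
[:: 1; 1107316929; 1140863169; 2164281537; 2214600897; 3254792385; 4311756993; 4328530113;
5385494721];
[:: 1; 1074270531; 1074794691; 2147750211; 2148536451; 3221754051; 4295233731; 4295495811;
5368975491];
[:: 1; 1108348995; 1141379139; 2165313603; 2214858819; 3255308355; 4312272963; 4328788035;
5385752643];
[:: 1; 1074278721; 1074802881; 2147758401; 2148544641; 3221762241; 4295241921; 4295504001;
5368983681];
[:: 1; 1124614209; 1158160449; 2181578817; 2231898177; 3272089665; 4329054273; 4345827393;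
5402792001];
[:: 1; 1125130305; 1158160449; 2182094913; 2231640129; 3272089665; 4329054273; 4345569345;
5402533953];
[:: 1; 1107570693; 1141125123; 2164535301; 2214866946; 3255054339; 4312018947; 4328796162;
5385760770];
[:: 1; 1108611264; 1141641408; 2165575872; 2215121088; 3255570624; 4312535232; 4329050304;
5386014912];
[:: 1; 1107558849; 1141113153; 2164523457; 2214854913; 3255042369; 4312006977; 4328784129;
5385748737];
[:: 1; 1074552897; 1075068993; 2148032577; 2148806721; 3222028353; 4295508033; 4295766081;
5369245761];
[:: 1; 1107300801; 1140855105; 2164265409; 2214596865; 3254784321; 4311748929; 4328526081;
5385490689];
[:: 1; 1107587073; 1141133313; 2164551681; 2214871041; 3255062529; 4312027137; 4328800257;
5385764865];
[:: 1; 1074270405; 1074794691; 2147750085; 2148536514; 3221754051; 4295233731; 4295495874;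
5368975554];
[:: 1; 1107562818; 1141117122; 2164527426; 2214858882; 3255046338; 4312010946; 4328788098;
5385752706];
[:: 1; 1107562881; 1141117185; 2164527489; 2214858945; 3255046401; 4312011009; 4328788161;
5385752769];
[:: 1; 1107570756; 1141125186; 2164535364; 2214867009; 3255054402; 4312019010; 4328796225;
5385760833];
[:: 1; 1108357185; 1141387329; 2165321793; 2214867009; 3255316545; 4312281153; 4328796225;
5385760833];
[:: 1; 1107300549; 1140854979; 2164265157; 2214596802; 3254784195; 4311748803; 4328526018;
5385490626];
[:: 1; 1108607043; 1141637187; 2165571651; 2215116867; 3255566403; 4312531011; 4329046083;
5386010691];
[:: 1; 1074286785; 1074802881; 2147766465; 2148540609; 3221762241; 4295241921; 4295499969;
5368979649];
[:: 1; 1107562944; 1141117248; 2164527552; 2214859008; 3255046464; 4312011072; 4328788224;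
5385752832];
[:: 1; 1107578883; 1141125123; 2164543491; 2214862851; 3255054339; 4312018947; 4328792067;
5385756675];
[:: 1; 1124089923; 1157636163; 2181054531; 2231373891; 3271565379; 4328529987; 4345303107;
5402267715];
[:: 1; 1075068993; 1075585089; 2148548673; 2149322817; 3222544449; 4296024129; 4296282177;
5369761857];
[:: 1; 1107558597; 1141113027; 2164523205; 2214854850; 3255042243; 4312006851; 4328784066;
5385748674];
[:: 1; 1074278469; 1074802755; 2147758149; 2148544578; 3221762115; 4295241795; 4295503938;
5368983618];
[:: 1; 1107316803; 1140863043; 2164281411; 2214600771; 3254792259; 4311756867; 4328529987;
5385494595];
[:: 1; 1108086789; 1141641219; 2165051397; 2215383042; 3255570435; 4312535043; 4329312258;
5386276866];
[:: 1; 1125126273; 1158156417; 2182090881; 2231636097; 3272085633; 4329050241; 4345565313;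
5402529921];
[:: 1; 1108611201; 1141641345; 2165575809; 2215121025; 3255570561; 4312535169; 4329050241;
5386014849];
[:: 1; 1074286659; 1074802755; 2147766339; 2148540483; 3221762115; 4295241795; 4295499843;
5368979523];
[:: 1; 1107300675; 1140854979; 2164265283; 2214596739; 3254784195; 4311748803; 4328525955;
5385490563];
[:: 1; 1074270279; 1074794565; 2147749959; 2148536388; 3221753925; 4295233605; 4295495748;
5368975428];
[:: 1; 1107579009; 1141125249; 2164543617; 2214862977; 3255054465; 4312019073; 4328792193;
5385756801];
[:: 1; 1107324993; 1140871233; 2164289601; 2214608961; 3254800449; 4311765057; 4328538177;
5385502785];
[:: 1; 1074544707; 1075060803; 2148024387; 2148798531; 3222020163; 4295499843; 4295757891;
5369237571];
[:: 1; 1108615233; 1141645377; 2165579841; 2215125057; 3255574593; 4312539201; 4329054273;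
5386018881];
[:: 1; 1109135424; 1142165568; 2166100032; 2215645248; 3256094784; 4313059392; 4329574464;
5386539072];
[:: 1; 1107562755; 1141117059; 2164527363; 2214858819; 3255046275; 4312010883; 4328788035;
5385752643];
[:: 1; 1107558723; 1141113027; 2164523331; 2214854787; 3255042243; 4312006851; 4328784003;
5385748611];
[:: 1; 1107578946; 1141125186; 2164543554; 2214862914; 3255054402; 4312019010; 4328792130;
5385756738];
[:: 1; 1107574851; 1141121091; 2164539459; 2214858819; 3255050307; 4312014915; 4328788035;
5385752643];
[:: 1; 1125650433; 1158680577; 2182615041; 2232160257; 3272609793; 4329574401; 4346089473;
5403054081];
[:: 1; 1107562503; 1141116933; 2164527111; 2214858756; 3255046149; 4312010757; 4328787972;
5385752580];
[:: 1; 1107308865; 1140863169; 2164273473; 2214604929; 3254792385; 4311756993; 4328534145;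
5385498753];
[:: 1; 1108611138; 1141641282; 2165575746; 2215120962; 3255570498; 4312535106; 4329050178;
5386014786];
[:: 1; 1125126336; 1158156480; 2182090944; 2231636160; 3272085696; 4329050304; 4345565376;
5402529984];
[:: 1; 1107558471; 1141112901; 2164523079; 2214854724; 3255042117; 4312006725; 4328783940;
5385748548]]);
  ([:: 3; 1; 4]%N,
[:: [:: 1; 2248691781]; [:: 1; 2248950081]; [:: 1; 2248692033]; [:: 1; 2248417605];
[:: 1; 2248937733]; [:: 1; 2248953924]]);
  ([:: 3; 2; 4]%N,
[:: [:: 1; 2248937861]; [:: 1; 2248692161]; [:: 1; 2248954241]; [:: 1; 2249470148];
[:: 1; 2266509380]; [:: 1; 2248691783]; [:: 1; 2249470211]; [:: 1; 2248417733];
[:: 1; 2248417607]; [:: 1; 2248937924]; [:: 1; 2266505537]; [:: 1; 2248421702];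
[:: 1; 2249994308]; [:: 1; 2266501253]; [:: 1; 2249986181]; [:: 1; 2248953926];
[:: 1; 2248962116]; [:: 1; 2249990465]; [:: 1; 2248421765]; [:: 1; 2248437893];
[:: 1; 2248937798]; [:: 1; 2248700225]; [:: 1; 2248937735]]);
  ([:: 3; 3; 1]%N,
[:: 
[:: 1; 1090797637; 1090805827; 1091055685; 1091579971; 2164535365; 2164801603; 3238281283;
3238539331; 4312019011];
[:: 1; 1090785478; 1090785604; 1107562819; 1141117123; 2164527427; 2181304516; 3238269124;
3255046339; 4312010947];
[:: 1; 1124864068; 1125650497; 1158418498; 1158680641; 2198868034; 2232160321; 3272347714;
3272609857; 4346089537];
[:: 1; 1091318017; 1091326081; 1091588161; 1092104257; 2165067841; 2165321857; 3238801537;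
3239063617; 4312543297];
[:: 1; 1124872195];
[:: 1; 1090801921; 1090809985; 1091072065; 1091588161; 2164551745; 2164805761; 3238285441;
3238547521; 4312027201];
[:: 1; 1124340097; 1124352193; 1157894401; 1157898433; 2198085889; 2231636161; 3271823617;
3271827649; 4345565377];
[:: 1; 1124348161; 1124360257; 1157902465; 1157906497; 2198093953; 2231644225; 3271831681;
3271835713; 4345573441];
[:: 1; 1090793857; 1090801921; 1091064001; 1091580097; 2164543681; 2164797697; 3238277377;
3238539457; 4312019137];
[:: 1; 1124860099];
[:: 1; 1124339782; 1125126211; 1157894212; 1158156355; 2198343748; 2231636035; 3271823428;
3272085571; 4345565251];
[:: 1; 1091313733; 1091321923; 1091571781; 1092096067; 2165051461; 2165317699; 3238797379;
3239055427; 4312535107];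
[:: 1; 1091318017; 1091330113; 1091842177; 1091846209; 2165063809; 2165583937; 3238801537;
3238805569; 4312543297];
[:: 1; 1090793542; 1090801732; 1107578947; 1141125187; 2164543555; 2181312580; 3238277188;
3255054403; 4312019011];
[:: 1; 1090789447; 1090797637; 1091047495; 1091571781; 2164527175; 2164793413; 3238273093;
3238531141; 4312010821];
[:: 1; 1157894401; 1157906497; 1191448705; 1191452737; 2231640193; 2265190465; 3305377921;
3305381953; 4379119681];
[:: 1; 1091834113; 1091846209; 1092358273; 1092362305; 2165579905; 2166100033; 3239317633;
3239321665; 4313059393];
[:: 1; 1091309953; 1091322049; 1091834113; 1091838145; 2165055745; 2165575873; 3238793473;
3238797505; 4312535233];
[:: 1; 1091309638; 1091833924; 1108611139; 1141641283; 2165575747; 2181828676; 3238793284;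
3255570499; 4312535107];
[:: 1; 1124872384]; [:: 1; 1074540739];
[:: 1; 1090789825; 1090797889; 1091047873; 1091572033; 2164527553; 2164793665; 3238273345;
3238531393; 4312011073];
[:: 1; 1090785541; 1090785667; 1107562693; 1141117123; 2164527301; 2181304579; 3238269187;
3255046339; 4312010947];
[:: 1; 1124085955];
[:: 1; 1091313985; 1091322049; 1091572033; 1092096193; 2165051713; 2165317825; 3238797505;
3239055553; 4312535233];
[:: 1; 1090797889; 1090805953; 1091055937; 1091580097; 2164535617; 2164801729; 3238281409;
3238539457; 4312019137]]);
  ([:: 3; 3; 3]%N,
[:: [:: 1; 1124889024]; [:: 1; 2182885509]; [:: 1; 1125921216]; [:: 1; 1075605699];
[:: 1; 2181849537]; [:: 1; 1191997443]; [:: 1; 2248946049]; [:: 1; 1191968967];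
[:: 1; 2248937607]; [:: 1; 2265460869]; [:: 1; 1124102595]; [:: 1; 2248962114];
[:: 1; 2181833157]; [:: 1; 2248417479]; [:: 1; 1074557127]; [:: 1; 1191194823];
[:: 1; 2265456837]; [:: 1; 2248937859]; [:: 1; 2248958145]; [:: 1; 1075589319];
[:: 1; 1191981504]; [:: 1; 1191195075]; [:: 1; 1124888583]; [:: 1; 1075589571];
[:: 1; 1125920775]; [:: 1; 1191981252]; [:: 1; 1125908679]; [:: 1; 2249994306];
[:: 1; 2248937670]; [:: 1; 1125937344]; [:: 1; 2266501314]; [:: 1; 2265461121];
[:: 1; 2266509378]; [:: 1; 1125920964]; [:: 1; 1074540999]; [:: 1; 2249986242];
[:: 1; 2266501251]; [:: 1; 2182885761]; [:: 1; 2181849159]; [:: 1; 2248421763];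
[:: 1; 1191211203]; [:: 1; 1193029824]; [:: 1; 2181853317]; [:: 1; 2181849285];
[:: 1; 1124086215]; [:: 1; 2248421574]; [:: 1; 1193017539]; [:: 1; 1191969219];
[:: 1; 2248937922]; [:: 1; 2181833031]; [:: 1; 2181853569]; [:: 1; 2248958019];
[:: 1; 1193029635]; [:: 1; 1191997632]; [:: 1; 1124860359]; [:: 1; 2181837189];
[:: 1; 2249986179]; [:: 1; 1191981063]; [:: 1; 2248437954]; [:: 1; 2182881477];
[:: 1; 2181575109]; [:: 1; 1125937155]; [:: 1; 1124102343]; [:: 1; 1124872455];
[:: 1; 2248437891]; [:: 1; 1124888772]; [:: 1; 1125908931]; [:: 1; 1124872644];
[:: 1; 2248421511]; [:: 1; 2248417731]; [:: 1; 2248421826]; [:: 1; 2181591237];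
[:: 1; 2248945734]; [:: 1; 1074557379]; [:: 1; 2181574983]; [:: 1; 1125150915];
[:: 1; 1124876739]; [:: 1; 1191981315]; [:: 1; 1124876487]; [:: 1; 1125925059];
[:: 1; 1125134535]; [:: 1; 1125921027]; [:: 1; 1125134787]; [:: 1; 1124888835];
[:: 1; 1191985347]]);
  ([:: 3; 4; 1]%N,
[:: [:: 1; 2181832899]; [:: 1; 2181836931]; [:: 1; 2181836994]; [:: 1; 2181574851]]);
  ([:: 3; 4; 3]%N,
[:: [:: 1; 2266767554]; [:: 1; 2265457091]; [:: 1; 2182885826]; [:: 1; 2265461123];
[:: 1; 2182901954]; [:: 1; 2182885574]; [:: 1; 2181833159]; [:: 1; 2181837254];
[:: 1; 2182885511]; [:: 1; 2181591491]; [:: 1; 2266767491]; [:: 1; 2181837191];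
[:: 1; 2181849287]; [:: 1; 2182901891]; [:: 1; 2265460871]; [:: 1; 2181853634];
[:: 1; 2181853319]; [:: 1; 2182881479]; [:: 1; 2182885763]; [:: 1; 2181849539];
[:: 1; 2265460934]; [:: 1; 2265477251]; [:: 1; 2265456839]; [:: 1; 2265477314];
[:: 1; 2181853571]; [:: 1; 2265461186]; [:: 1; 2181853382]; [:: 1; 2181591239];
[:: 1; 2182881731]; [:: 1; 2181575111]]);
  ([:: 4; 1; 4]%N,
[:: [:: 1; 2248953925]; [:: 1; 2248421701]; [:: 1; 2248954177]; [:: 1; 2248937797]]);
  ([:: 4; 3; 3]%N,
[:: [:: 1; 2266509379]; [:: 1; 2249470147]; [:: 1; 2248937671]; [:: 1; 2248437955];
[:: 1; 2248962241]; [:: 1; 2249986243]; [:: 1; 2266501315]; [:: 1; 2249994433];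
[:: 1; 2248421575]; [:: 1; 2248421827]; [:: 1; 2248946113]; [:: 1; 2248945987];
[:: 1; 2249994307]; [:: 1; 2248945861]; [:: 1; 2248937923]; [:: 1; 2248962115];
[:: 1; 2266509505]; [:: 1; 2248945735]]);
  ([:: 1; 1; 1; 3]%N,
[:: [:: 33; 2149060740]]);
  ([:: 2; 2; 2; 2]%N,
[:: [:: 44; 2197823495]; [:: 41; 4328792195]; [:: 42; 2198339591]; [:: 44; 2148278279];
[:: 41; 2181050438]; [:: 42; 2147770499]; [:: 42; 1073754311]; [:: 41; 1074528455];
[:: 35; 4345307267]; [:: 41; 2181824582]; [:: 37; 2181828992]; [:: 38; 4295762051];
[:: 37; 1074540740]; [:: 42; 4329308291]; [:: 35; 4345831427]; [:: 41; 2148020294];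
[:: 35; 4345831616]; [:: 37; 1074540551]; [:: 37; 2165842112]; [:: 37; 2181828614];
[:: 37; 4312277123]; [:: 35; 4295762051]; [:: 38; 4329316544]; [:: 35; 4345823363];
[:: 44; 4328534147]; [:: 37; 2181828740]; [:: 38; 2198340032]; [:: 38; 1124073923];
[:: 41; 2164285571]; [:: 37; 1074802883]; [:: 44; 4295504003]; [:: 41; 1073754311];
[:: 37; 2165841923]; [:: 41; 2165833859]; [:: 38; 2198339591]; [:: 37; 1074540992];
[:: 38; 1124073671]; [:: 42; 2148020294]; [:: 38; 4329316355]; [:: 37; 4345307267];
[:: 1609; 2147749953]; [:: 1573; 1074528321]; [:: 1349; 1090781250]]);
  ([:: 3; 2; 2; 2]%N,
[:: [:: 54; 1125122243]; [:: 45; 1125908672]; [:: 60; 1125908672]; [:: 46; 1124872448];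
[:: 60; 1124085767]; [:: 60; 1074540740]; [:: 54; 1124085956]; [:: 57; 1124872448];
[:: 54; 1124888576]; [:: 46; 1125134528]; [:: 58; 1074556931]; [:: 60; 1125134528];
[:: 57; 1191194816]; [:: 46; 1124073671]; [:: 60; 1074528455]; [:: 58; 1124086208];
[:: 60; 1124872196]; [:: 46; 1124888576]; [:: 54; 1124102336]; [:: 54; 1124872196];
[:: 58; 1124872196]; [:: 60; 1125908483]; [:: 46; 1125908483]; [:: 53; 1191981056];
[:: 46; 1125134339]; [:: 54; 1124085767]; [:: 46; 1124860100]; [:: 60; 1074544835];
[:: 45; 1191981056]; [:: 57; 1125908672]; [:: 45; 1191968960]; [:: 45; 1125920768];
[:: 60; 1124090051]; [:: 53; 1191968960]; [:: 54; 1125920768]; [:: 45; 1191968771];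
[:: 60; 1124102147]; [:: 54; 1124073923]; [:: 54; 1125134339]; [:: 46; 1125122243];
[:: 54; 1124102147]; [:: 60; 1074540992]; [:: 60; 1124086208]; [:: 54; 1124073671];
[:: 46; 1124860352]; [:: 60; 1074540551]; [:: 57; 1125134528]; [:: 46; 1125920768];
[:: 53; 1191968771]; [:: 60; 1124102336]; [:: 54; 1125908672]; [:: 45; 1125908483];
[:: 46; 1124102147]; [:: 57; 1075589123]; [:: 58; 1074557120]; [:: 57; 1125908483];
[:: 60; 1124872448]; [:: 53; 1125920768]; [:: 46; 1124073923]; [:: 58; 1124073671];
[:: 57; 1124102147]; [:: 46; 1124085767]; [:: 60; 1124085956]; [:: 60; 1191968771];
[:: 46; 1124859911]; [:: 46; 1124090051]; [:: 58; 1191194627]; [:: 54; 1124090051];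
[:: 54; 1124860352]; [:: 57; 1191194627]; [:: 58; 1125908672]; [:: 54; 1124859911];
[:: 58; 1124085767]; [:: 58; 1075589312]; [:: 57; 1191968960]; [:: 46; 1125908672];
[:: 53; 1125908672]; [:: 60; 1074557120]; [:: 58; 1124860100]; [:: 58; 1124090051];
[:: 58; 1125122243]; [:: 46; 1124872196]; [:: 58; 1124859911]; [:: 60; 1074528707];
[:: 46; 1124085956]; [:: 57; 1191968771]; [:: 54; 1125908483]; [:: 58; 1124085956];
[:: 46; 1124102336]; [:: 46; 1124086208]; [:: 58; 1125908483]; [:: 54; 1124872448];
[:: 60; 1191968960]; [:: 58; 1124860352]; [:: 60; 1191981056]; [:: 57; 1124872196];
[:: 58; 1124073923]; [:: 60; 1124073923]; [:: 57; 1124102336]; [:: 60; 1124073671];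
[:: 58; 1075589123]; [:: 54; 1124086208]; [:: 60; 1125920768]; [:: 60; 1074556931];
[:: 53; 1125908483]; [:: 57; 1074557120]; [:: 58; 1191981056]; [:: 60; 1124876291];
[:: 57; 1074556931]; [:: 57; 1075589312]; [:: 58; 1124872448]; [:: 60; 1124860100];
[:: 54; 1124860100]; [:: 54; 1125134528]]);
  ([:: 3; 3; 3; 1]%N,
[:: [:: 57; 1074540739];
[:: 45; 1091313922; 1091326018; 1108095106; 1141645378; 2165059714; 2181832834; 2181836866;
3238797442; 3238801474; 3255574594; 4312539202];
[:: 60; 1107824899; 1107836995; 1108091011; 1108611139; 2181570691; 2181828739; 2181832771;
3255308419; 3255312451; 3255570499; 4329050179];
[:: 53; 1091313922; 1091326018; 1108095106; 1141645378; 2165059714; 2181832834; 2181836866;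
3238797442; 3238801474; 3255574594; 4312539202];
[:: 57; 1091309890; 1091321986; 1108091074; 1141641346; 2165055682; 2181828802; 2181832834;
3238793410; 3238797442; 3255570562; 4312535170];
[:: 1; 1125404939; 1125429509; 1125937415; 1126977797; 1158967559; 1159483655; 1159491845;
1226068229; 2182369547; 2182394117; 2182902023; 2183942405; 3272896775; 3273412871; 3273421061;
3306443015; 3306451205; 3306967301; 4329861383; 4330377479; 4330385669; 5420372231; 5420380421;
5420896517; 5453926661; 6477336839; 6477345029; 6477861125; 7567855877; 8624820485];
[:: 1; 1158435524; 1158459716; 1158967748; 1160008004; 1191997892; 1192513988; 1192522052;
1259098436; 2231915204; 2231939396; 2265477572; 2332578116; 3305927108; 3306443204; 3306451268;
3339473348; 3339481412; 3339997508; 4379406788; 4412953028; 4412961092; 5453402564; 5453410628;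
5453926724; 5486956868; 6526882244; 6526890308; 6560436548; 7600886084; 8674365764];
[:: 53; 1074540739];
[:: 53; 1091309890; 1091321986; 1108091074; 1141641346; 2165055682; 2181828802; 2181832834;
3238793410; 3238797442; 3255570562; 4312535170];
[:: 53; 1091309701; 1091321986; 1108091011; 1141641346; 2165055619; 2181828739; 2181832834;
3238793347; 3238797442; 3255570562; 4312535170];
[:: 1; 1158435083; 1158459653; 1158967559; 1160007941; 1191997703; 1192513799; 1192521989;
1259098373; 2231914763; 2231939333; 2265477383; 2332578053; 3305926919; 3306443015; 3306451205;
3339473159; 3339481349; 3339997445; 4379406599; 4412952839; 4412961029; 5453402375; 5453410565;
5453926661; 5486956805; 6526882055; 6526890245; 6560436485; 7600886021; 8674365701];
[:: 60; 1107824899; 1107836995; 1124606083; 1158156355; 2181570691; 2198343811; 2198347843;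
3255308419; 3255312451; 3272085571; 4329050179];
[:: 60; 1108099075; 1158418435; 2198609923; 3255574531; 3272347651; 4329312259];
[:: 57; 1091313922; 1091326018; 1108095106; 1141645378; 2165059714; 2181832834; 2181836866;
3238797442; 3238801474; 3255574594; 4312539202];
[:: 53; 1091318080; 1141649536; 2181836992; 3238801600; 3255578752; 4312543360];
[:: 51; 1091313922; 1091326018; 1108095106; 1141645378; 2165059714; 2181832834; 2181836866;
3238797442; 3238801474; 3255574594; 4312539202];
[:: 1; 1125405380; 1125429572; 1125937604; 1126977860; 1158967748; 1159483844; 1159491908;
1226068292; 2182369988; 2182394180; 2182902212; 2183942468; 3272896964; 3273413060; 3273421124;
3306443204; 3306451268; 3306967364; 4329861572; 4330377668; 4330385732; 5420372420; 5420380484;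
5420896580; 5453926724; 6477337028; 6477345092; 6477861188; 7567855940; 8624820548];
[:: 43; 1091313922; 1091326018; 1108095106; 1141645378; 2165059714; 2181832834; 2181836866;
3238797442; 3238801474; 3255574594; 4312539202];
[:: 60; 1124859973; 1124860162; 2198601859; 3272343619; 3272343682; 4346085442];
[:: 45; 1074540739];
[:: 57; 1091318080; 1141649536; 2181836992; 3238801600; 3255578752; 4312543360];
[:: 51; 1091309890; 1091321986; 1108091074; 1141641346; 2165055682; 2181828802; 2181832834;
3238793410; 3238797442; 3255570562; 4312535170];
[:: 45; 1091309890; 1091321986; 1108091074; 1141641346; 2165055682; 2181828802; 2181832834;
3238793410; 3238797442; 3255570562; 4312535170];
[:: 53; 1090793794; 1091580034; 1107833026; 1141125250; 2164797634; 2181312706; 2181574786;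
3238277314; 3238539394; 3255054466; 4312019074];
[:: 1; 1125142859; 1125143237; 1125151175; 1125167429; 1158697415; 1158705479; 1158705605;
1225806149; 2182107467; 2182107845; 2182115783; 2182132037; 3272626631; 3272634695; 3272634821;
3306180935; 3306181061; 3306189125; 4329591239; 4329599303; 4329599429; 5420110151; 5420110277;
5420118341; 5453664581; 6477074759; 6477074885; 6477082949; 7567593797; 8624558405];
[:: 54; 1090801858; 1091576002; 1107833026; 1141121218; 2164797634; 2181312706; 2181570754;
3238277314; 3238535362; 3255050434; 4312015042];
[:: 1; 1125400907; 1125401285; 1125925319; 1126973765; 1158955463; 1159479623; 1159479749;
1226064197; 2182365515; 2182365893; 2182889927; 2183938373; 3272884679; 3273408839; 3273408965;
3306438983; 3306439109; 3306963269; 4329849287; 4330373447; 4330373573; 5420368199; 5420368325;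
5420892485; 5453922629; 6477332807; 6477332933; 6477857093; 7567851845; 8624816453];
[:: 57; 1090793794; 1091580034; 1107833026; 1141125250; 2164797634; 2181312706; 2181574786;
3238277314; 3238539394; 3255054466; 4312019074];
[:: 58; 1090793794; 1091580034; 1107833026; 1141125250; 2164797634; 2181312706; 2181574786;
3238277314; 3238539394; 3255054466; 4312019074];
[:: 1; 1158431051; 1158431429; 1158955463; 1160003909; 1191985607; 1192509767; 1192509893;
1259094341; 2231910731; 2231911109; 2265465287; 2332574021; 3305914823; 3306438983; 3306439109;
3339469127; 3339469253; 3339993413; 4379394503; 4412948807; 4412948933; 5453398343; 5453398469;
5453922629; 5486952773; 6526878023; 6526878149; 6560432453; 7600881989; 8674361669];
[:: 53; 1091829955; 1141375171; 2181824707; 3238789315; 3255304387; 4312268995];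
[:: 1; 1158951620; 1158975812; 1159483844; 1160524100; 1192513988; 1193030084; 1193038148;
1259614532; 2232689348; 2234261828; 2266767812; 2333352260; 3306443204; 3306959300; 3306967364;
3339989444; 3339997508; 3340513604; 4380697028; 4413727172; 4414251332; 5453918660; 5453926724;
5454442820; 5487472964; 6527656388; 6528180548; 6561210692; 7601402180; 8675139908];
[:: 1; 1158959684; 1158983876; 1159491908; 1160532164; 1192522052; 1193038148; 1193046212;
1259622596; 2232725636; 2234273924; 2266787972; 2333364356; 3306451268; 3306967364; 3306975428;
3339997508; 3340005572; 3340521668; 4380717188; 4413747332; 4414263428; 5453926724; 5453934788;
5454450884; 5487481028; 6527676548; 6528192644; 6561222788; 7601410244; 8675152004];
[:: 45; 1091842051; 1141387267; 2181836803; 3238801411; 3255316483; 4312281091];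
[:: 45; 1091829955; 1141375171; 2181824707; 3238789315; 3255304387; 4312268995];
[:: 1; 1158951179; 1158975749; 1159483655; 1160524037; 1192513799; 1193029895; 1193038085;
1259614469; 2232688907; 2234261765; 2266767623; 2333352197; 3306443015; 3306959111; 3306967301;
3339989255; 3339997445; 3340513541; 4380696839; 4413726983; 4414251269; 5453918471; 5453926661;
5454442757; 5487472901; 6527656199; 6528180485; 6561210629; 7601402117; 8675139845]]);
  ([:: 3; 4; 3; 1]%N,
[:: [:: 45; 2181312707]; [:: 57; 2148282563]; [:: 53; 2181828803]; [:: 57; 2181828803];
[:: 53; 2181312707]; [:: 39; 2181836867]; [:: 51; 2181836867]; [:: 43; 2181836867];
[:: 51; 2181828803]; [:: 57; 2181836993]; [:: 45; 2181836867]; [:: 53; 2181836867];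
[:: 43; 2181828803]; [:: 45; 2181828803]; [:: 39; 2181836993]; [:: 53; 2148282563];
[:: 53; 2181836993]; [:: 45; 2148282563]; [:: 57; 2181312707]; [:: 57; 2181836867];
[:: 43; 2181836993]; [:: 45; 2181836993]; [:: 51; 2181836993]]);
  ([:: 3; 4; 3; 3]%N,
[:: [:: 43; 2265452743]; [:: 43; 2181853381]; [:: 53; 2148282823]; [:: 43; 2149331143];
[:: 45; 2181329095]; [:: 57; 2182893763]; [:: 45; 2182885825]; [:: 53; 2182885447];
[:: 45; 2148282823]; [:: 43; 2181853255]; [:: 51; 2181853507]; [:: 39; 2181853381];
[:: 39; 2181837253]; [:: 51; 2182901827]; [:: 51; 2181837127]; [:: 51; 2181853633];
[:: 51; 2265477187]; [:: 57; 2182877635]; [:: 51; 2265985219]; [:: 53; 2215407811];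
[:: 45; 2181312967]; [:: 39; 2181837127]; [:: 43; 2264936647]; [:: 45; 2182901953];
[:: 43; 2181845191]; [:: 43; 2216440003]; [:: 45; 2148298951]; [:: 53; 2181312967];
[:: 45; 2215391683]; [:: 39; 2265460933]; [:: 43; 2265985219]; [:: 57; 2215391683];
[:: 43; 2248421575]; [:: 43; 2181837253]; [:: 45; 2215407811]; [:: 53; 2215391683];
[:: 39; 2182885573]; [:: 43; 2182901953]; [:: 53; 2182901827]; [:: 43; 2182877383];
[:: 57; 2182877383]; [:: 43; 2215391431]; [:: 51; 2216440003]; [:: 45; 2215391431];
[:: 53; 2215391431]; [:: 43; 2265477313]; [:: 57; 2215391431]; [:: 2005; 1090785474]]);
  ([:: 4; 3; 3; 1]%N,
[:: [:: 62; 1124872384]; [:: 62; 1124860099]; [:: 62; 1124085955]; [:: 62; 1124872195]]);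
  ([:: 3; 2; 2; 2; 2]%N,
[:: [:: 1587; 4295762051]; [:: 1203; 2181050564]; [:: 1227; 2149327040]; [:: 1818; 2164793729];
[:: 1333; 2148020231]; [:: 1357; 2147754182]; [:: 1581; 2148020609]; [:: 1429; 2147492291];
[:: 1817; 2199400448]; [:: 1235; 2149068929]; [:: 1579; 2148020609]; [:: 1203; 2181824708];
[:: 1818; 2164785350]; [:: 1579; 4295762051]; [:: 1227; 2181312518]; [:: 1331; 2248155203];
[:: 1433; 2147492291]; [:: 1820; 2147754182]; [:: 1436; 2181582914]; [:: 1337; 2148020294];
[:: 1419; 2198339591]; [:: 1195; 2181824708]; [:: 1227; 2149326851]; [:: 1229; 2148282500];
[:: 1686; 2164797446]; [:: 1419; 2198355971]; [:: 1195; 2264932544]; [:: 1235; 2147774594];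
[:: 1197; 1074540740]; [:: 1195; 2248675520]; [:: 1237; 1074802883]; [:: 1579; 2148278657];
[:: 1366; 2149064771]; [:: 1229; 1124073671]; [:: 1363; 2181316802]; [:: 1238; 2248409219];
[:: 1363; 2149064771]; [:: 1365; 2198339591]; [:: 1419; 2164793351]; [:: 1421; 2164793351];
[:: 1625; 2148008135]; [:: 1621; 2148008135]; [:: 1333; 2264924291]; [:: 1237; 1074528707];
[:: 1430; 2147492291]; [:: 1229; 2148036611]; [:: 1230; 1124073671]; [:: 1422; 2164793414];
[:: 1203; 2264932355]; [:: 1235; 2148036611]; [:: 1337; 1073754311]; [:: 1422; 2164797824];
[:: 1430; 2147512451]; [:: 1195; 2264932355]; [:: 1363; 2149318787]; [:: 1434; 2147492291];
[:: 1357; 2148270278]; [:: 1689; 2147492039]; [:: 1370; 1073754311]; [:: 1331; 2264924291];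
[:: 1237; 2148036611]; [:: 1434; 2215387265]; [:: 1227; 2149068866]; [:: 1227; 2148036800];
[:: 1235; 2148278468]; [:: 1197; 1074540992]; [:: 1238; 2248151171]; [:: 1331; 2148020420];
[:: 1230; 1124859911]; [:: 1333; 2148020420]; [:: 1333; 2248671299]; [:: 1820; 2164269254];
[:: 1203; 2164793792]; [:: 1337; 1074528455]; [:: 1363; 2149064897]; [:: 1366; 2149318787];
[:: 1235; 2149326851]; [:: 1331; 2248671299]; [:: 1613; 2148020231]; [:: 1203; 2197823684];
[:: 1429; 2147512451]; [:: 1333; 2149064771]; [:: 1197; 2165841923]; [:: 1227; 1124085956];
[:: 1325; 1074528455]; [:: 1237; 1124073671]; [:: 1814; 2164785350]; [:: 1195; 2181836804];
[:: 1333; 2248155203]; [:: 1427; 2164793351]; [:: 1205; 1074540551]; [:: 1229; 2181312518];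
[:: 1325; 2165833859]; [:: 1357; 2148008387]; [:: 1690; 2147492039]; [:: 1621; 2148020231];
[:: 1195; 2248675331]; [:: 1227; 2147774594]; [:: 1579; 2149068929]; [:: 1229; 1124073923];
[:: 1238; 1124073671]; [:: 1357; 2148286658]; [:: 1203; 2248675331]; [:: 1230; 1124085767];
[:: 1357; 2182611011]; [:: 1357; 2148020672]; [:: 1331; 4295504003]; [:: 1333; 1074528455];
[:: 1613; 2148008135]; [:: 1621; 2149064897]; [:: 1363; 2148008387]; [:: 1369; 2148008387];
[:: 1626; 2181054659]; [:: 1621; 2147754371]; [:: 1230; 2215129091]; [:: 1230; 1125134339];
[:: 1370; 2248155203]; [:: 1229; 2148036800]; [:: 53557; 2147749953]; [:: 45363; 1090523202];
[:: 57754; 1090531329]; [:: 53916; 1090781313]; [:: 1818; 2165841986]; [:: 45269; 2147749953];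
[:: 1235; 1124086019]; [:: 45235; 1090789440]; [:: 51797; 1073754177]; [:: 45235; 1090523328];
[:: 53651; 1074532416]; [:: 45395; 1074016320]; [:: 1358; 2181050564]; [:: 1238; 4328792195]]);
  ([:: 3; 4; 3; 3; 1]%N,
[:: 
[:: 1963; 1090793605; 1090793731; 1107570757; 1141125187; 2164535365; 2181312643; 3238277251;
3255054403; 4312019011];
[:: 1895; 1091309890; 1091321986; 1108091074; 1141641346; 2165055682; 2181828802; 2181832834;
3238793410; 3238797442; 3255570562; 4312535170];
[:: 1995; 1090793668; 1090793794; 1091055937; 1091580097; 2164535617; 2164797634; 3238277314;
3238539457; 4312019137];
[:: 1959; 1090793668; 1090801858; 1107579073; 1141125313; 2164543681; 2181312706; 3238277314;
3255054529; 4312019137];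
[:: 1963; 1074282691; 1075056835; 2148278467; 3221758147; 3222016195; 4295495875];
[:: 1971; 1074016453; 1074802882; 2148020419; 3221500099; 3221762242; 4295241922];
[:: 1971; 1074282691; 1075056835; 2148278467; 3221758147; 3222016195; 4295495875];
[:: 1995; 1074016453; 1074802882; 2148020419; 3221500099; 3221762242; 4295241922];
[:: 2003; 1074016453; 1074802882; 2148020419; 3221500099; 3221762242; 4295241922];
[:: 1959; 1074278659; 1074286723; 1074548803; 1075064899; 2148028483; 2148282499; 3221762179;
3222024259; 4295503939];
[:: 1971; 1091317765; 1141649410; 2181836803; 3238801411; 3255578626; 4312543234];
[:: 1959; 1090793731; 1090801795; 1107578947; 1141125187; 2164543555; 2181312643; 3238277251;
3255054403; 4312019011];
[:: 2009; 1108090948; 1108091137; 1124868226; 1158422593; 2181832834; 2198609986; 2198610049;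
3255574594; 3255574657; 3272351809; 4329316417];
[:: 1963; 1091305669; 1141637314; 2181824707; 3238789315; 3255566530; 4312531138];
[:: 1971; 1091318080; 1141649536; 2181836992; 3238801600; 3255578752; 4312543360];
[:: 1971; 1090531525; 1140863170; 2181050563; 3238015171; 3254792386; 4311756994];
[:: 1895; 1091313922; 1091326018; 1108095106; 1141645378; 2165059714; 2181832834; 2181836866;
3238797442; 3238801474; 3255574594; 4312539202];
[:: 1971; 1090793605; 1090793731; 1107570757; 1141125187; 2164535365; 2181312643; 3238277251;
3255054403; 4312019011];
[:: 1997; 1107824899; 1107836995; 1108091011; 1108611139; 2181570691; 2181828739; 2181832771;
3255308419; 3255312451; 3255570499; 4329050179];
[:: 1963; 1090793668; 1090793794; 1107571009; 1141125313; 2164535617; 2181312706; 3238277314;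
3255054529; 4312019137];
[:: 1963; 1091047621; 1091059906; 1107828931; 1141379266; 2164793539; 2181566659; 2181570754;
3238531267; 3238535362; 3255308482; 4312273090];
[:: 1963; 1091318080; 1141649536; 2181836992; 3238801600; 3255578752; 4312543360];
[:: 2003; 1090793605; 1090793731; 1091055685; 1091579971; 2164535365; 2164797571; 3238277251;
3238539331; 4312019011];
[:: 1963; 1074016453; 1074802882; 2148020419; 3221500099; 3221762242; 4295241922];
[:: 1971; 1091305669; 1141637314; 2181824707; 3238789315; 3255566530; 4312531138];
[:: 2005; 1107824836; 1107837121; 1108091074; 1108611265; 2181570754; 2181828802; 2181832897;
3255308482; 3255312577; 3255570625; 4329050305];
[:: 1971; 1091309701; 1091321986; 1108091011; 1141641346; 2165055619; 2181828739; 2181832834;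
3238793347; 3238797442; 3255570562; 4312535170];
[:: 1971; 1091313796; 1091326081; 1108095106; 1141645441; 2165059714; 2181832834; 2181836929;
3238797442; 3238801537; 3255574657; 4312539265];
[:: 1971; 1091047621; 1091059906; 1107828931; 1141379266; 2164793539; 2181566659; 2181570754;
3238531267; 3238535362; 3255308482; 4312273090];
[:: 1963; 1091313922; 1091326018; 1108095106; 1141645378; 2165059714; 2181832834; 2181836866;
3238797442; 3238801474; 3255574594; 4312539202];
[:: 1895; 1091309701; 1091321986; 1108091011; 1141641346; 2165055619; 2181828739; 2181832834;
3238793347; 3238797442; 3255570562; 4312535170];
[:: 1959; 1091309890; 1091321986; 1108091074; 1141641346; 2165055682; 2181828802; 2181832834;
3238793410; 3238797442; 3255570562; 4312535170];
[:: 1997; 1108082947; 1158414403; 2198601859; 3255566467; 3272343619; 4329308227];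
[:: 1991; 1090793668; 1090801858; 1091064001; 1091580097; 2164543681; 2164797634; 3238277314;
3238539457; 4312019137];
[:: 1959; 1091305669; 1141637314; 2181824707; 3238789315; 3255566530; 4312531138];
[:: 1959; 1091318080; 1141649536; 2181836992; 3238801600; 3255578752; 4312543360];
[:: 1997; 1124614147; 1125388291; 2198609923; 3272089603; 3272347651; 4345827331];
[:: 1963; 1090531525; 1140863170; 2181050563; 3238015171; 3254792386; 4311756994];
[:: 1971; 1090793668; 1090793794; 1107571009; 1141125313; 2164535617; 2181312706; 3238277314;
3255054529; 4312019137];
[:: 1959; 1091317765; 1141649410; 2181836803; 3238801411; 3255578626; 4312543234];
[:: 1959; 1091309701; 1091321986; 1108091011; 1141641346; 2165055619; 2181828739; 2181832834;
3238793347; 3238797442; 3255570562; 4312535170];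
[:: 1959; 1091313922; 1091326018; 1108095106; 1141645378; 2165059714; 2181832834; 2181836866;
3238797442; 3238801474; 3255574594; 4312539202];
[:: 1963; 1091309890; 1091321986; 1108091074; 1141641346; 2165055682; 2181828802; 2181832834;
3238793410; 3238797442; 3255570562; 4312535170]])])%num.

(** The blocks in increasing order of weight, each with its families: the words of
    [E] followed by the matrices [A], coded row by row like words. In all families
    but one [E] is a spike, with exponents (63), (31,31,1), (31,15,15,1,1),
    (31,15,7,7,3) or (15,15,15,15,3). The spikes give only 440 functionals in
    weight (5,3,3,3,1). The other 15 come from the product of the spike 31 in one
    variable with a sum of 36 monomials of degree 32 in the other four, obtained
    by replacing each exponent [e] with [2e + 1] in a sum of degree 14 that also
    vanishes on hits. *)
Definition functionals : seq block :=
 ([:: ([:: 1; 1; 1; 1; 1; 1]%N,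
  [:: ([:: 1627931152],
[:: 33554448; 33554944; 33570816; 34078720; 50331648; 33554960; 33570832; 33571328; 34078736;
34079232; 34095104; 50331664; 50332160; 50348032; 50855936; 33571344; 34079248; 34095120;
34095616; 50332176; 50348048; 50348544; 50855952; 50856448; 50872320; 34095632; 50348560;
50856464; 50872336; 50872832; 50872848])]);
  ([:: 3; 2; 2; 2; 2; 0]%N,
  [:: ([:: 1099719452],
[:: 33563140; 33562768; 33558800; 33817092; 33816720; 33832964; 33833088; 33820688; 33821184;
33685776; 33693712; 33694208; 41943556; 41943184; 41959428; 41959552; 41947152; 41947648;
42467332; 42467456; 42471424; 42074128; 42074624; 42090496; 37749008; 37756944; 37757440;
38010896; 38011392; 38027264; 33563280; 33575184; 33566992; 34087428; 34087056; 34083088;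
33817232; 33833476; 33833104; 33825284; 33824912; 33821200; 33820944; 33837072; 33837568;
33702160; 33694224; 33693968; 34210064; 34218000; 34218496; 33947920; 33955856; 33956352;
50340356; 50339984; 50336016; 50594308; 50593936; 50610180; 50610304; 50597904; 50598400;
50462992; 50470928; 50471424; 41943696; 41959940; 41959568; 41951748; 41951376; 41947664;
41947408; 41963536; 41964032; 42467844; 42467472; 42483716; 42483840; 42471440; 42471936;
42205700; 42205328; 42221572; 42221696; 42209296; 42209792; 42074640; 42074384; 42090512;
42091008; 42082320; 42082816; 42598416; 42598912; 42614784; 37765392; 37757456; 37757200;
38273296; 38281232; 38281728; 38011408; 38011152; 38027280; 38027776; 38019088; 38019584;
54526224; 54534160; 54534656; 54788112; 54788608; 54804480; 46137616; 46145552; 46146048;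
46399504; 46400000; 46415872; 33583376; 34349572; 34349200; 34345232; 33710352; 34472208;
34480144; 34480640; 50864644; 50864272; 50860304; 50610692; 50610320; 50598416; 50479376;
50471440; 42484228; 42483856; 42471952; 42213892; 42213520; 42209552; 42091024; 42082576;
58728964; 58728592; 58724624; 58982916; 58982544; 58998788; 58998912; 58986512; 58987008;
58851600; 58859536; 58860032; 37773584; 38289680; 38281744; 38027792; 38019344; 38535440;
38543376; 38543872; 62914832; 62922768; 62923264; 63176720; 63177216; 63193088; 33837712;
34218640; 34230544; 33960208; 41964176; 42599056; 42618896; 42619392; 54534800; 54546704;
54788752; 54808592; 54809088; 55181584; 55189520; 55190016; 46149904; 46530832; 46538768;
46539264; 34087568; 34099472; 33833616; 33825424; 33829136; 33956368; 50340496; 50352400;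
50594448; 50614288; 50614784; 50987280; 50995216; 50995712; 41960080; 41951888; 41955600;
42467984; 42487824; 42488320; 42205840; 42222084; 42221712; 42209808; 42225680; 42226176;
42082832; 42336528; 42344464; 42344960; 38019600; 46146064; 46400016; 46415888; 46416384;
33837328; 33964304; 41963792; 42476036; 42475664; 42471696; 42090768; 42598672; 42606608;
42607104; 38027536; 46154000; 46661904; 46669840; 46670336; 34091280; 34218256; 50344208;
50602500; 50602128; 50598160; 50471184; 50725136; 50733072; 50733568; 38281488; 54534416;
54788368; 54796304; 54796800; 42619536; 54809232; 55190160; 55202064; 46543120; 50864784;
50876688; 50610832; 42484368; 42217744; 58999300; 58998928; 58987024; 58860048; 38543888;
59515396; 59515024; 59511056; 58876176; 38560016; 34500880; 62943504; 63832336; 63840272;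
63840768; 42214032; 42738180; 42737808; 42733840; 42098960; 59253252; 59252880; 59248912;
58867984; 38035728; 38551824; 46416400; 34480784; 62923408; 63177360; 63197200; 63197696;
33845520; 50614800; 51003664; 50995728; 41971984; 42488336; 42344720; 42860816; 42868752;
42869248; 34492688; 42226320; 46539280; 62935312; 63570192; 63578128; 63578624; 34349712;
51126788; 51126416; 51122448; 50487568; 58729104; 58983056; 58991108; 58990736; 58986768;
59002896; 59003392; 58859792; 38297872; 38543632; 34369808; 58749200; 59638032; 59645968;
59646464; 46670352; 33976592; 46166288; 47055120; 47063056; 47063552; 34488592; 42222224;
42225936; 42344976; 62931216; 63439120; 63447056; 63447552; 34238736; 54554896; 55443728;
55451664; 55452160; 34107664; 34480400; 50360592; 51249424; 51257360; 51257856; 62923024;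
63176976; 63184912; 63185408; 42607248; 46547216; 42476176; 34484496; 62927120; 63308048;
63315984; 63316480; 50741520; 42352912; 50733584; 46678288; 42606864; 54808848; 50868496;
42619152; 54796944; 50602640; 50614544; 55189776; 46674192; 63861008; 42488080; 42479888;
54796560; 63197840; 50995472; 42234128; 63578768; 58999440; 59535632; 50737424; 46559504;
63840912; 59253392; 55464208; 50606352; 55452304; 63590672; 63852816; 42869392; 42869008;
59003408; 59515536; 59662608; 55210256; 51265808; 50884880; 51126928; 47067408; 42738320;
63447568; 42361104; 59646480; 51257872; 63455504; 63848720; 47063568; 63185552; 51138832;
59654416; 63598864; 42881296; 63205648; 63840528; 63336720; 63197456; 42742032; 63185168;
59011344; 59265296; 63320336; 63844624; 47071504; 58991248; 63324432; 47083792; 42889488;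
59273488; 59646224; 42627344; 63467792; 51011856; 63578384; 54817040; 63316496; 55472400;
46690576; 42758416; 58994960; 50753808; 42750224; 55451920; 63451408; 59003152; 51278096;
51261712; 51147024; 42496272; 50622736; 59257104; 51130640])]);
  ([:: 5; 3; 3; 3; 1; 0]%N,
  [:: ([:: 1091466143],
[:: 50597953; 50595969; 50595876; 50405505; 50405412; 50398468; 42471489; 42469505; 42469412;
42090561; 42076673; 42076208; 42025089; 42024996; 42013185; 42012720; 42010116; 42009744;
36184193; 36184100; 36177156; 35930241; 35930148; 35918337; 35917872; 35915268; 35914896;
35700996; 35693060; 35692688; 50596004; 50600065; 50599972; 50405540; 50406660; 50402564;
50667649; 50667556; 50660612; 50536577; 50536484; 50529540; 42469540; 42473601; 42473508;
42025124; 42014212; 42013840; 42156161; 42156068; 42144257; 42143792; 42141188; 42140816;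
36184228; 36185348; 36181252; 35930276; 35919364; 35918992; 36225284; 35963140; 35955204;
35954832; 35832068; 35824132; 35823760; 52961409; 52961316; 52954372; 52478212; 44572801;
44572708; 44565764; 44318849; 44318756; 44306945; 44306480; 44303876; 44303504; 44089604;
44081668; 44081296; 40378497; 40378404; 40371460; 40124545; 40124452; 40112641; 40112176;
40109572; 40109200; 39895300; 39887364; 39886992; 36217348; 36216976; 52707457; 52707364;
52695553; 52695088; 52692484; 52692112; 52470276; 52469904; 42076720; 42093057; 42092592;
42013232; 42026500; 42026128; 42549377; 42549284; 42537473; 42537008; 42534404; 42534032;
35918384; 35931652; 35931280; 50600100; 50410756; 50668804; 50536612; 50533636; 50798721;
50798628; 50791684; 42473636; 42156196; 42145284; 42144912; 36189444; 36094212; 36086276;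
36085904; 53002500; 44573956; 44351748; 44343812; 44343440; 40378532; 40375556; 40124580;
40113668; 40113296; 40026372; 40018436; 40018064; 48767105; 48767012; 48760068; 48513153;
48513060; 48501249; 48500784; 48498180; 48497808; 48283908; 48275972; 48275600; 36487428;
36356356; 61350017; 61349924; 61342980; 60866820; 57155713; 57155620; 57148676; 56672516;
50667684; 52961444; 52962564; 52958468; 44572836; 44318884; 44307972; 44307600; 36479492;
36479120; 36348420; 36348048; 52994564; 52994192; 61096065; 61095972; 61084161; 61083696;
61081092; 61080720; 60858884; 60858512; 56901761; 56901668; 56889857; 56889392; 56886788;
56886416; 56664580; 56664208; 52740356; 52609284; 50664708; 52707492; 44569860; 44220676;
44212740; 44212368; 42014352; 42030596; 42160641; 42160176; 42141328; 42680449; 42680356;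
42665476; 35919504; 35935748; 50537732; 52695600; 52708868; 52708496; 52696580; 52732420;
52601348; 44613892; 44605956; 40379652; 40419588; 40157444; 40149508; 40149136; 44605584;
40411280; 42549412; 42144304; 52696208; 52732048; 52600976; 44306992; 44320260; 44319888;
40112688; 36618500; 65544321; 65544228; 65537284; 65061124; 50798756; 48767140; 48513188;
48502276; 48501904; 50803972; 48772356; 48677124; 48669188; 48668816; 61351172; 57152772;
42093104; 42537520; 42550788; 42550416; 40411652; 36610564; 36610192; 57155748; 65290369;
65290276; 65278465; 65278000; 65275396; 65275024; 65053188; 65052816; 50672900; 50795780;
44578052; 44482820; 44474884; 44474512; 48764164; 48414980; 48407044; 48406672; 61653252;
57327876; 52966660; 61128964; 56803588; 42538500; 42157200; 40125584; 61350052; 50541828;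
53264644; 53133572; 40383748; 40288516; 40280580; 40280208; 56901796; 44876036; 40550660;
61645316; 52871428; 44868100; 61121028; 61644944; 57319940; 57319568; 61096100; 56890884;
56795652; 42538128; 42157572; 40125956; 44867728; 61391108; 40542352; 57196804; 61120656;
56890512; 56795280; 53256708; 53125636; 61347076; 40542724; 61383172; 53256336; 42145424;
42680484; 53125264; 61382800; 40113808; 57188496; 52863492; 44737028; 61085188; 56934660;
44736656; 56907268; 57188868; 56926724; 48808196; 42161296; 42669572; 44308112; 44324356;
61097476; 61097104; 60997892; 40129680; 57156868; 44744964; 61084208; 56889904; 56926352;
48501296; 60989584; 52712964; 48800260; 42161668; 42669200; 60989956; 40130052; 52863120;
61084816; 56902800; 65544356; 40673424; 52696720; 48799888; 65978628; 48514192; 42160688;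
56903172; 42685956; 65549572; 40681732; 65290404; 65541380; 53395716; 65970692; 65454340;
65970320; 42554884; 42157712; 40673796; 44999172; 65323268; 61355268; 65279492; 48514564;
44998800; 65545476; 65315332; 65192196; 45007108; 65314960; 42538640; 42681860; 65183888;
57065732; 65184260; 65279120; 49201412; 40804496; 65585412; 53387780; 40812804; 65446404;
57057796; 40804868; 49193476; 48939268; 65577476; 57590020; 65708548; 48931332; 57582084;
53387408; 65278512; 61251728; 57057424; 65708176; 48502416; 48930960; 65577104; 65716484;
61784324; 65291408; 61776016; 65295876; 61522180; 61513872; 57458948; 61514244]);
  ([:: 1075162815; 1075164799; 1075164863; 1075228287; 1075228351; 1075230335; 1075170751;
1075172735;
1075172799; 1075236223; 1075236287; 1075238271; 1074921279; 1075046207; 1074982911; 1074986815;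
1075173183; 1075234815; 1075177151; 1075117695; 1075424703; 1075426687; 1075426751; 1075490175;
1075490239; 1075492223; 1075423231; 1075490623; 1075613695; 1075617599; 1075615743; 1075621567;
1075379647; 1075504511; 1075631487; 1075635455],
[:: 34765010; 39889736; 57098658; 61291590; 48826711; 47398738; 38881848; 54779098; 60330506;
55089210; 36462099; 60427147; 51002940; 52667919; 50620413])]);
  ([:: 5; 5; 4; 2; 1; 0]%N,
  [:: ([:: 1091337215],
[:: 50597953; 50597922; 50594946; 50470977; 50470946; 50465025; 50464808; 50464002; 50463816;
50372738; 50368770; 50368584; 42471489; 42471458; 42468482; 42090561; 42090530; 42076673;
42076208; 42075650; 42075216; 41992322; 41980418; 41979984; 38281281; 38281250; 38275329;
38275112; 38274306; 38274120; 38027329; 38027298; 38013441; 38012976; 38012418; 38011984;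
37830913; 37830696; 37822977; 37822512; 37815816; 37815568; 37798146; 37797960; 37790210;
37789776; 37784072; 37783824; 35135618; 35131650; 35131464; 34881666; 34869762; 34869328;
34750722; 34750536; 34742786; 34742352; 34736648; 34736400; 50634882; 50630914; 50630728;
38355201; 38354984; 38347265; 38346800; 38340104; 38339856; 37800456; 37800208; 55058497;
55058466; 55052545; 55052328; 55051522; 55051336; 54804545; 54804514; 54790657; 54790192;
54789634; 54789200; 54608129; 54607912; 54600193; 54599728; 54593032; 54592784; 54575362;
54575176; 54567426; 54566992; 54561288; 54561040; 34753032; 34752784; 35275010; 35274824;
35267074; 35266640; 35260936; 35260688; 43524226; 43520258; 43520072; 43270274; 43258370;
43257936; 43139330; 43139144; 43131394; 43130960; 43125256; 43125008; 51912834; 51908866;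
51908680; 51658882; 51646978; 51646544; 51527938; 51527752; 51520002; 51519568; 51513864;
51513616; 42516610; 42504706; 42504272; 37832200; 37831952; 38322434; 38322248; 38314498;
38314064; 38308360; 38308112; 42076720; 42092034; 42091600; 38013488; 38028802; 38028368;
37823024; 51530248; 51530000; 52052226; 52052040; 52044290; 52043856; 52038152; 52037904;
60301442; 60297474; 60297288; 60047490; 60035586; 60035152; 56246530; 56246344; 56238594;
56238160; 56232456; 56232208; 54837506; 54837320; 54829570; 54829136; 54823432; 43141640;
43663618; 43663432; 43649544; 56508674])]);
  ([:: 5; 5; 4; 4; 0; 0]%N,
  [:: ([:: 1074756607],
[:: 35791361; 35790896; 35783952; 35688720; 34672912; 35791408; 35800336; 35792144; 36213008;
35950864; 35819792; 51450128; 43061520; 38867216; 36770064])])])%num.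

Lemma check_degree63 : check relations functionals = true.
Proof. by vm_compute. Qed.

Theorem mainTheorem5 :
  exists d : nat, has_dim (@QP_deg 5 63) d /\ (1141 <= d <= 1155)%N.
Proof.
have [d dim_d le_d] := check_dim check_degree63 (erefl true).
by exists d.
Qed.
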